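(* There exists a constant $C>0$ depending only on $m$ and $\beta$ such that for every compact convex set $K\subset\mathbb{R}^d$, all probability measures $\mu,\nu\in\mathcal{M}_K$ and every closed domain $F\subset K$, $$\sup_{x,y\in K}\left|D_{\mu,F}(x,y)-D_{\nu,F}(x,y)\right|\le C\,\mathrm{diam}(K)^\beta\,W_p(\mu,\nu).$$
   Context: $\mathbb{R}^d$ carries the Euclidean norm $\|\cdot\|$; $B(x,r)$ is the open ball. Fixed real parameters: $m\in(0,1]$, $p\ge 1$, $\beta\ge 1$. For a probability measure $\mu$ on $\mathbb{R}^d$, $\delta_{\mu,u}(x)=\inf\{r>0:\mu(B(x,r))>u\}$ and the distance-to-measure is $d_\mu(x)=\left(\frac1m\int_0^m\delta_{\mu,u}(x)^p\,du\right)^{1/p}$. $\mathcal{M}_K$ is the set of probability measures on $\mathbb{R}^d$ with support included in $K$. A rectifiable path is a continuous $\gamma:[0,1]\to\mathbb{R}^d$ of finite Euclidean length $|\gamma|=\int_0^1\|\dot\gamma(t)\|\,dt$, parametrized so as to be Lipschitz (always possible, e.g. with constant speed). Its FDTM length is $D_\mu(\gamma)=\int_0^1 d_\mu(\gamma(t))^\beta\|\dot\gamma(t)\|\,dt$. For a closed set $F\subset\mathbb{R}^d$ (the domain) and $x,y\in\mathbb{R}^d$, $\Gamma_F(x,y)$ is the set of rectifiable paths $\gamma$ with $\gamma(0)=x$, $\gamma(1)=y$ such that for every open interval $I\subset[0,1]$ with $\gamma(I)\subset\mathbb{R}^d\setminus F$ there is a unit vector $u\in\mathbb{R}^d$ with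 $\dot\gamma(t)=\|\dot\gamma(t)\|u$ for all $t\in I$ where $\dot\gamma$ is defined. The Fermat distance-to-measure is $D_{\mu,F}(x,y)=\inf_{\gamma\in\Gamma_F(x,y)}D_\mu(\gamma)$. $W_p(\mu,\nu)=\inf_\pi\left(\int\|x-y\|^p\,\pi(dx,dy)\right)^{1/p}$, the infimum being over probability measures $\pi$ on $\mathbb{R}^d\times\mathbb{R}^d$ with marginals $\mu$ and $\nu$ (same $p$ as in $d_\mu$). *)

(* Defs.v *)
From mathcomp Require Import all_boot all_order all_algebra.
From mathcomp Require Import all_classical all_reals all_analysis.

Set Implicit Arguments.
Unset Strict Implicit.
Unset Printing Implicit Defensive.

Import Order.TTheory GRing.Theory Num.Theory.
Import numFieldNormedType.Exports.

Local Open Scope classical_set_scope.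
Local Open Scope ring_scope.

(* R^d is 'rV[R]_d.  The norm `| x | that MathComp-Analysis puts on it is the
   sup norm, so the Euclidean norm is [enorm].  Purely topological notions
   (open, closed, compact, derivable) are the library's: both norms induce the
   same topology. *)
Definition enorm (R : realType) (d : nat) (x : 'rV[R]_d) : R :=
  Num.sqrt (\sum_(i < d) x ord0 i ^+ 2).

Definition eball (R : realType) (d : nat) (x : 'rV[R]_d) (r : R) :
    set 'rV[R]_d :=
  [set y | enorm (y - x) < r].

Definition ediam (R : realType) (d : nat) (K : set 'rV[R]_d) : \bar R :=
  ereal_sup [set (enorm (x - y))%:E | x in K & y in K].

(* R^d with its Borel sigma-algebra. *)
Notation borelRd R d := (g_sigma_algebraType (@open 'rV[R]_d)).

Definition msupport (R : realType) (d : nat)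
    (mu : probability (borelRd R d) R) : set 'rV[R]_d :=
  [set x | forall U : set 'rV[R]_d, open U -> U x -> (0 < mu U)%E].

(* The distances below are extended-real valued, with inf of the empty set
   equal to +oo; no convention on infinite values is therefore hidden in
   reals. *)
Definition delta (R : realType) (d : nat) (mu : probability (borelRd R d) R)
    (u : R) (x : 'rV[R]_d) : \bar R :=
  ereal_inf [set r%:E | r in [set r | 0 < r /\ (u%:E < mu (eball x r))%E]].

Definition dtm (R : realType) (d : nat) (m p : R)
    (mu : probability (borelRd R d) R) (x : 'rV[R]_d) : \bar R :=
  ((m^-1%:E * \int[lebesgue_measure]_(u in `[0%R, m]) (delta mu u x `^ p))
    `^ p^-1)%E.

(* Only the values of [gamma] on [0, 1] matter.  Lipschitz continuity implies
   continuity, finite length and differentiability almost everywhere; at the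
   remaining points [derive1] has a junk value, which the integral in
   [dtm_length] does not see. *)
Definition rectifiable (R : realType) (d : nat) (gamma : R -> 'rV[R]_d) :=
  exists L : R, forall s t : R, 0 <= s <= 1 -> 0 <= t <= 1 ->
    enorm (gamma s - gamma t) <= L * `|s - t|.

Definition speed (R : realType) (d : nat) (gamma : R -> 'rV[R]_d) (t : R) : R :=
  enorm (derive1 gamma t).

Definition dtm_length (R : realType) (d : nat) (m p beta : R)
    (mu : probability (borelRd R d) R) (gamma : R -> 'rV[R]_d) : \bar R :=
  (\int[lebesgue_measure]_(t in `[0%R, 1%R])
     (dtm m p mu (gamma t) `^ beta * (speed gamma t)%:E))%E.

Definition straight_outside (R : realType) (d : nat) (F : set 'rV[R]_d)
    (gamma : R -> 'rV[R]_d) :=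
  forall a b : R, 0 <= a -> a < b -> b <= 1 -> gamma @` `]a, b[ `<=` ~` F ->
    exists2 u : 'rV[R]_d, enorm u = 1 &
      forall t, t \in `]a, b[ -> derivable gamma t 1 ->
        derive1 gamma t = speed gamma t *: u.

Definition admissible (R : realType) (d : nat) (F : set 'rV[R]_d)
    (x y : 'rV[R]_d) : set (R -> 'rV[R]_d) :=
  [set gamma | [/\ rectifiable gamma, gamma 0 = x, gamma 1 = y
    & straight_outside F gamma]].

Definition fermat_dtm (R : realType) (d : nat) (m p beta : R)
    (mu : probability (borelRd R d) R) (F : set 'rV[R]_d) (x y : 'rV[R]_d) :
    \bar R :=
  ereal_inf [set dtm_length m p beta mu gamma | gamma in admissible F x y].

(* Measures of MathComp-Analysis are functions on all sets, meaningful only on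
   measurable ones, hence the comparison of marginals on measurable sets. *)
Definition coupling (R : realType) (d : nat)
    (mu nu : probability (borelRd R d) R) :
    set (probability (borelRd R d * borelRd R d)%type R) :=
  [set pi | forall A : set (borelRd R d), measurable A ->
     pushforward pi fst A = mu A /\ pushforward pi snd A = nu A].

Definition wasserstein (R : realType) (d : nat) (p : R)
    (mu nu : probability (borelRd R d) R) : \bar R :=
  ereal_inf [set ((\int[pi]_z
      (enorm ((z.1 : 'rV[R]_d) - (z.2 : 'rV[R]_d)) `^ p)%:E) `^ p^-1)%E
    | pi in coupling mu nu].

(* Main.v *)
From HB Require Import structures.
Require Import Defs.
From mathcomp Require Import all_boot all_order all_algebra.
From mathcomp Require Import all_classical all_reals all_analysis.
From mathcomp Require Import measurable_realfun zify lra ring.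

Import Order.TTheory GRing.Theory Num.Theory.
Import numFieldNormedType.Exports.

Set Implicit Arguments.
Unset Strict Implicit.
Unset Printing Implicit Defensive.

Local Open Scope classical_set_scope.
Local Open Scope ring_scope.

(* Write d_mu for the distance to measure, k_mu(p, q) for the cost of the segment
   [p, q] and D for the diameter of K.  Two facts on d_mu are used: it is
   1-Lipschitz, and at most N ~ 2/m points with d_mu <= r can be pairwise at
   distance >= 6r, since each ball B(x, 3r) has mass at least m/2.

   Up to an arbitrarily small error, the cost of an admissible path bounds the
   cost of a chain of segments whose interior vertices lie in F, and conversely
   every such chain is admissible.  Shortcutting makes the chain optimal: no
   subchain costs more than the segment between its ends.  Since
   k(p, q) >= c max(d(p), |q - p|)^beta |q - p|, optimality and the packing bound
   limit the total length of the edges l with max(d(p_l), |e_l|) in ]r/2, r] to a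
   multiple of r; summing over r = D, D/2, D/4, ... bounds the length of the chain
   by C' D, with C' depending on m and beta only.  Along that chain, replacing nu
   by mu costs at most beta D^(beta - 1) sup |d_mu - d_nu| per unit of length.

   Finally |d_mu - d_nu| <= m^(-1/p) W_p: the p-th moment of the quantile function
   over [0, m[ is a supremum over l of m l - E (l - Z^p)_+, and these functionals
   can be compared through any coupling. *)

(** The obstacle is that d_nu^beta may be arbitrarily small on parts of K: a cheap path can be very
    long there, while exchanging mu and nu costs an amount proportional to length. The cost of a
    path alone therefore does not bound the error, and optimality has to be used. Passing to finite
    chains makes optimality attainable by deleting vertices, a process that ends, so no minimising
    path has to exist. The constraint on directions outside F makes this passage exact there, since
    such a piece of a path runs along its own chord. Convexity of K and F [<=] K keep every segment
    of the chain in K, where both distances to measure are at most D. The packing bound counts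
    masses and not volumes, so no constant depends on the dimension; m^(-1/p) is replaced by 1/m so
    that none depends on p. The Minkowski-type inequalities come from estimates linear in p-th
    moments with a free parameter t in ]0, 1[, which is the form that the duality argument for
    quantiles delivers. *)

Section lip.
Context (R : realType).
Local Notation leb := (@lebesgue_measure R).

(** * Lipschitz functions on [0, 1] are integrals of their derivatives *)

Section monotone_lip.
Variables (F : R -> R) (M : R).
Hypothesis Fnd : {homo F : x y / x <= y}.
Hypothesis Flip : forall x y, x <= y -> F y - F x <= M * (y - x).

(* dF and M dx - dF are both positive measures, and their sum is M times the
   Lebesgue measure: this is what makes dF absolutely continuous. *)
Definition compl_lip (x : R) := M * x - F x.

Lemma lip_continuous : continuous F.
Proof.
have M0 : 0 <= M.
  have := Flip ler01; rewrite subr0 mulr1; apply: le_trans.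
  by rewrite subr_ge0 Fnd.
move=> x; apply/cvgrPdist_le => e e0; near=> y.
have [xy|/ltW yx] := leP x y.
  rewrite distrC ger0_norm ?subr_ge0 ?Fnd// (le_trans (Flip xy))//.
  have -> : y - x = `|x - y| by rewrite distrC ger0_norm ?subr_ge0.
  rewrite (@le_trans _ _ ((M + 1) * `|x - y|)) ?ler_wpM2r ?lerDl//.
  rewrite mulrC -ler_pdivlMr ?ltr_pwDr//.
  by near: y; apply: cvgr_dist_le; [exact: cvg_id|rewrite divr_gt0 ?ltr_pwDr].
rewrite ger0_norm ?subr_ge0 ?Fnd// (le_trans (Flip yx))//.
have -> : x - y = `|x - y| by rewrite ger0_norm ?subr_ge0.
rewrite (@le_trans _ _ ((M + 1) * `|x - y|)) ?ler_wpM2r ?lerDl//.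
rewrite mulrC -ler_pdivlMr ?ltr_pwDr//.
by near: y; apply: cvgr_dist_le; [exact: cvg_id|rewrite divr_gt0 ?ltr_pwDr].
Unshelve. all: by end_near. Qed.

Lemma compl_lip_nd : {homo compl_lip : x y / x <= y}.
Proof. move=> x y xy; rewrite /compl_lip; have := Flip xy; lra. Qed.

Lemma compl_lip_continuous : continuous compl_lip.
Proof.
move=> x; apply: cvgB; last exact: lip_continuous.
by apply: cvgM; [exact: cvg_cst|exact: cvg_id].
Qed.

Let F_rc : right_continuous F.
Proof. by apply: right_continuousW; exact: lip_continuous. Qed.
Let F2_rc : right_continuous compl_lip.
Proof. by apply: right_continuousW; exact: compl_lip_continuous. Qed.

HB.instance Definition _ := isCumulative.Build R _ R F Fnd F_rc.
HB.instance Definition _ := isCumulative.Build R _ R compl_lip compl_lip_nd F2_rc.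

Local Notation nu := (lebesgue_stieltjes_measure F).
Local Notation nu2 := (lebesgue_stieltjes_measure compl_lip).

Lemma ls_itv (f : cumulative R R) (a b : R) : a <= b ->
  lebesgue_stieltjes_measure f `]a, b]%classic = (f b - f a)%:E.
Proof.
move=> ab; rewrite /lebesgue_stieltjes_measure /measure_extension.
by rewrite measurable_mu_extE/= ?wlength_itv_bnd//; exact: is_ocitv.
Qed.

Lemma ls_lip_dominates (M0 : 0 < M) (A : set R) : measurable A ->
  leb A = 0%E -> nu A = 0%E.
Proof.
move=> mA; pose k := NngNum (ltW (divr_gt0 ltr01 M0)).
have E (B : set R) : mscale k (measure_add nu nu2) B = (k%:num%:E * (nu B + nu2 B))%E.
  by congr (_ * _)%E; exact: measure_addE.
(* Both sides give b - a on []a, b]], and these intervals determine the measure. *)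
have lE : leb A = (k%:num%:E * (nu A + nu2 A))%E.
  rewrite -E; apply: lebesgue_measure_unique => // X [[a b] _ <-].
  apply: etrans (esym (E _)) => /=.
  have [ab|ba] := leP a b; last first.
    rewrite set_itv_ge ?bnd_simp -?leNgt ?ltW// !measure0.
    by rewrite adde0 mule0.
  rewrite !ls_itv//= lebesgue_measure_itv/= lte_fin.
  rewrite /compl_lip -!EFinD -EFinM.
  have [ab'|ba] := ltP a b.
    by congr EFin; field; rewrite gt_eqF.
  have -> : a = b by apply/le_anti/andP.
  by congr EFin; ring.
rewrite lE => /eqP; rewrite mule_eq0 => /orP[|].
  by rewrite eqe /= mul1r invr_eq0 gt_eqF.
rewrite padde_eq0; [|exact: measure_ge0..].
by case/andP => /eqP.
Qed.

(** g is the Radon-Nikodym density of dF; Lebesgue differentiation identifies it almost everywhere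
    with the derivative of F. *)
Lemma lip_nd_ac (M0 : 0 < M) : exists g : R -> R,
  [/\ (forall x, 0 <= g x),
     leb.-integrable setT (EFin \o g),
     (forall a b, 0 <= a -> a <= b -> b <= 1 ->
        (F b - F a)%:E = (\int[leb]_(x in `]a, b]) (g x)%:E)%E) &
     {ae leb, forall x, 0 < x < 1 -> derivable F x 1 /\ derive1 F x = g x}].
Proof.
have mD : measurable (`]0%R, 1%R]%classic : set (measurableTypeR R)).
  exact: measurable_itv.
have nuoo : (nu (`]0%R, 1%R]%classic : set (measurableTypeR R)) < +oo)%E.
  by rewrite ls_itv// ltry.
(* Restricting dF to ]0, 1] makes it finite, so that g is integrable over the whole line. *)
pose nu01 : {finite_measure set (measurableTypeR R) -> \bar R} := mfrestr mD nuoo.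
have dom : nu01 `<< leb.
  apply/null_content_dominatesP => A mA A0.
  rewrite /nu01/= /mfrestr /mrestr; apply: (ls_lip_dominates M0); first exact: measurableI.
  apply/eqP; rewrite eq_le measure_ge0 andbT -A0.
  by apply: le_measure; rewrite ?inE//; exact: measurableI.
have [h [h0 hfin inth hE]] := radon_nikodym_sigma_finite dom.
pose g := fine \o h.
have gE : EFin \o g = h by apply/funext => x /=; rewrite fineK.
have HE a b : 0 <= a -> a <= b -> b <= 1 ->
    (F b - F a)%:E = (\int[leb]_(x in `]a, b]) (g x)%:E)%E.
  move=> a0 ab b1; rewrite -ls_itv//.
  transitivity (\int[leb]_(x in `]a, b]) h x)%E; last first.
    by apply: eq_integral => x _; rewrite /g fineK.
  apply: etrans (hE _ (measurable_itv _)).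
  rewrite /nu01/= /mfrestr /mrestr setIidl// => x /=; rewrite !in_itv/= => /andP[ax xb].
  by rewrite (le_lt_trans a0)//= (le_trans xb).
exists g; split => //; first by move=> x; rewrite fine_ge0.
  by rewrite gE.
have locg : locally_integrable setT g.
  by apply: open_integrable_locally; [exact: openT|rewrite gE].
have := lebesgue_differentiation locg.
apply: filterS; first exact: (ae_filter_ringOfSetsType leb).
move=> x xg /andP[x0 x1].
have intg : leb.-integrable [set` Interval (BRight 0) (BRight (1:R))] (EFin \o g).
  by apply: (integrableS measurableT) => //; rewrite gE.
have [] := FTC1_lebesgue_pt x1 intg _ xg; first by rewrite /= lte_fin.
set Phi := (fun y => _) => dPhi Phig.
have near_F : \forall y \near x, F 0 + Phi y = F y.
  near=> y; rewrite /Phi /Rintegral -HE//=; first ring.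
    by near: y; apply: filterS (lt_nbhsr x0) => y /ltW.
  by near: y; apply: filterS (lt_nbhsl x1) => y /ltW.
have dc : derivable (cst (F 0)) x 1 by exact: derivable_cst.
split; first by apply: (near_eq_derivable near_F); exact: derivableD.
rewrite derive1E -(near_eq_derive _ near_F) -Phig derive1E.
by rewrite (deriveD dc dPhi) derive_cst add0r.
Unshelve. all: by end_near. Qed.

End monotone_lip.

(** Retraction of the line onto [0, 1]: composing with it extends maps controlled on [0, 1] only,
    without increasing their Lipschitz constant. It also serves to write broken lines in closed
    form. *)
Definition clamp01 (t : R) := Num.max 0 (Num.min t 1).

Lemma clamp01P (t : R) : [\/ t <= 0 /\ clamp01 t = 0,
  0 <= t <= 1 /\ clamp01 t = t | 1 <= t /\ clamp01 t = 1].
Proof.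
rewrite /clamp01; have [t0|/ltW t0] := leP t 0.
  apply: Or31; split => //; rewrite (min_l (le_trans t0 ler01)).
  by rewrite max_l.
have [t1|/ltW t1] := leP t 1.
  apply: Or32; split; first by rewrite t0.
  by rewrite max_r.
by apply: Or33; split => //; rewrite max_r.
Qed.

Lemma clamp01_nd (s t : R) : s <= t -> clamp01 s <= clamp01 t.
Proof.
by move=> st; case: (clamp01P s) => -[? ->]; case: (clamp01P t) => -[? ->]; lra.
Qed.

Lemma clamp01_lip (s t : R) : s <= t -> clamp01 t - clamp01 s <= t - s.
Proof.
by move=> st; case: (clamp01P s) => -[? ->]; case: (clamp01P t) => -[? ->]; lra.
Qed.

Lemma clamp01_in (t : R) : 0 <= clamp01 t <= 1.
Proof. by case: (clamp01P t) => -[? ->]; lra. Qed.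

Lemma clamp01_id (t : R) : 0 <= t <= 1 -> clamp01 t = t.
Proof. by case: (clamp01P t) => -[? ->]; lra. Qed.

Lemma clamp01_dist (s t : R) : `|clamp01 s - clamp01 t| <= `|s - t|.
Proof.
have [ts|/ltW st] := leP t s.
  by rewrite !ger0_norm ?subr_ge0 ?clamp01_nd//; exact: clamp01_lip.
by rewrite distrC [leRHS]distrC !ger0_norm ?subr_ge0 ?clamp01_nd//; exact: clamp01_lip.
Qed.

(** Adding a line of slope M = |L| + 1 makes [phi] nondecreasing with slopes at most 2M, so the
    monotone case applies; M is then subtracted from the density. The + 1 keeps M positive. *)
Lemma lip_ac (phi : R -> R) (L : R) :
  (forall s t, 0 <= s <= 1 -> 0 <= t <= 1 -> `|phi s - phi t| <= L * `|s - t|) ->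
  exists g : R -> R,
  [/\ leb.-integrable `[0, 1] (EFin \o g),
     (forall a b, 0 <= a -> a <= b -> b <= 1 ->
        phi b - phi a = \int[leb]_(x in `]a, b]) (g x)) &
     {ae leb, forall x, 0 < x < 1 -> derivable phi x 1 /\ derive1 phi x = g x}].
Proof.
move=> Lphi; pose M := `|L| + 1; pose F t := phi (clamp01 t) + M * t.
have M0 : 0 < M by rewrite ltr_pwDr.
have lp s t : s <= t -> `|phi (clamp01 t) - phi (clamp01 s)| <= M * (t - s).
  move=> st; apply: le_trans (Lphi _ _ (clamp01_in _) (clamp01_in _)) _.
  have cc := clamp01_nd st; have := clamp01_lip st.
  rewrite ger0_norm ?subr_ge0// => cl.
  apply: (@le_trans _ _ (M * (clamp01 t - clamp01 s))).
    by rewrite ler_wpM2r ?subr_ge0// /M (le_trans (ler_norm _))// lerDl.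
  by rewrite ler_wpM2l// ltW.
have Fnd : {homo F : x y / x <= y}.
  move=> x y xy; have := lp _ _ xy; rewrite ler_norml /F; lra.
have Flip x y : x <= y -> F y - F x <= (M + M) * (y - x).
  move=> xy; have := lp _ _ xy; rewrite ler_norml /F; lra.
have [g [g0 intg gE gd]] := lip_nd_ac Fnd Flip (addr_gt0 M0 M0).
have intgI (A : set R) : measurable A -> leb.-integrable A (EFin \o g).
  by move=> mA; exact: (integrableS measurableT).
have intc (A : set R) : measurable A -> (leb A < +oo)%E ->
    leb.-integrable A (EFin \o (fun=> M)).
  move=> mA Aoo; apply: measurable_bounded_integrable => //.
  exists `|M|; split; first exact: num_real.
  by move=> x Mx y _; exact: ltW.
exists (fun x => g x - M); split.
- rewrite (_ : _ \o _ = (fun x => (EFin \o g) x - (EFin \o (fun=> M)) x)%E)//.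
  apply: integrableB => //; [exact: intgI|apply: intc => //].
  by rewrite lebesgue_measure_itv/= lte_fin ltr01 ltry.
- move=> a b a0 ab b1; rewrite RintegralB//; [|exact: intgI|]; last first.
    apply: intc => //; rewrite lebesgue_measure_itv/= lte_fin.
    by case: ifP => _; rewrite ?ltry.
  rewrite Rintegral_cst//= lebesgue_measure_itv/= lte_fin.
  have -> : \int[leb]_(x in `]a, b]) g x = F b - F a by rewrite /Rintegral -gE.
  rewrite /F !clamp01_id; [|lra..].
  case: ltP => //= ab'; first ring.
  by rewrite (@le_anti _ _ a b) ?ab//; ring.
- move: gd; apply: filterS; first exact: (ae_filter_ringOfSetsType leb).
  move=> x xg x01; have [dF Fg] := xg x01; move/andP: (x01) => [x0 x1].
  have near_F : \forall y \near x, F y - M * y = phi y.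
    near=> y; rewrite /F clamp01_id; first ring.
    apply/andP; split; near: y.
      by apply: filterS (lt_nbhsr x0) => y /ltW.
    by apply: filterS (lt_nbhsl x1) => y /ltW.
  have dl : is_derive x 1 (fun y : R => M * y) M.
    by apply: is_derive_eq; rewrite scaler1 /GRing.scale/= ?mulr1.
  split; first by apply: (near_eq_derivable near_F); exact: derivableB.
  rewrite derive1E -(near_eq_derive _ near_F) -Fg derive1E.
  by rewrite deriveB// [X in _ - X]derive_val.
Unshelve. all: by end_near. Qed.
End lip.

(** * The Euclidean norm and its comparison with the sup norm *)

Section enorm.
Context (R : realType) (d : nat).
Implicit Types x y z : 'rV[R]_d.

Definition edot x y : R := \sum_(i < d) x ord0 i * y ord0 i.

Lemma enorm_ge0 x : 0 <= enorm x.
Proof. exact: sqrtr_ge0. Qed.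

Lemma enorm2E x : enorm x ^+ 2 = \sum_(i < d) x ord0 i ^+ 2.
Proof. by rewrite sqr_sqrtr// sumr_ge0// => i _; exact: sqr_ge0. Qed.

Lemma edotxx x : edot x x = enorm x ^+ 2.
Proof. by rewrite enorm2E; apply: eq_bigr => i _; rewrite expr2. Qed.

Lemma enormZ (a : R) x : enorm (a *: x) = `|a| * enorm x.
Proof.
rewrite /enorm -sqrtr_sqr -sqrtrM ?sqr_ge0//; congr Num.sqrt.
by rewrite mulr_sumr; apply: eq_bigr => i _; rewrite mxE exprMn.
Qed.

Lemma enormN x : enorm (- x) = enorm x.
Proof. by rewrite -scaleN1r enormZ normrN1 mul1r. Qed.

Lemma enorm0 : enorm (0 : 'rV[R]_d) = 0.
Proof. by rewrite -(scale0r 0) enormZ normr0 mul0r. Qed.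

Lemma enormB x y : enorm (x - y) = enorm (y - x).
Proof. by rewrite -enormN opprB. Qed.

Lemma enorm_eq0 x : enorm x = 0 -> x = 0.
Proof.
move=> x0; have := enorm2E x; rewrite x0 expr0n/= => /esym/eqP.
rewrite psumr_eq0; last by move=> i _; exact: sqr_ge0.
move=> /allP h; apply/rowP => i; rewrite mxE.
by have := h i (mem_index_enum i); rewrite /= sqrf_eq0 => /eqP.
Qed.

Lemma edotZl a x y : edot (a *: x) y = a * edot x y.
Proof. by rewrite /edot mulr_sumr; apply: eq_bigr => i _; rewrite mxE mulrA. Qed.

Lemma edotZr a x y : edot x (a *: y) = a * edot x y.
Proof.
by rewrite /edot mulr_sumr; apply: eq_bigr => i _; rewrite mxE mulrCA.
Qed.

Lemma cauchy_schwarz x y : edot x y <= enorm x * enorm y.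
Proof.
have [/enorm_eq0 ->|x0] := eqVneq (enorm x) 0.
  by rewrite -(scale0r 0) edotZl enormZ normr0 !mul0r.
have [/enorm_eq0 ->|y0] := eqVneq (enorm y) 0.
  by rewrite -(scale0r 0) edotZr enormZ normr0 !mul0r mulr0.
have xp : 0 < enorm x by rewrite lt_neqAle eq_sym x0 enorm_ge0.
have yp : 0 < enorm y by rewrite lt_neqAle eq_sym y0 enorm_ge0.
have H u v : 2 * edot u v <= enorm u ^+ 2 + enorm v ^+ 2.
  rewrite !enorm2E -big_split/= /edot mulr_sumr; apply: ler_sum => i _.
  by rewrite -subr_ge0 (_ : _ - _ = (u ord0 i - v ord0 i) ^+ 2) ?sqr_ge0//; ring.
have := H ((enorm x)^-1 *: x) ((enorm y)^-1 *: y).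
rewrite !enormZ !ger0_norm ?invr_ge0 ?enorm_ge0// !mulVf// expr1n edotZl edotZr.
rewrite mulrA => le2; have {le2} : (enorm x)^-1 * (enorm y)^-1 * edot x y <= 1.
  by move: le2; rewrite -mulrA; lra.
by rewrite -invfM mulrC ler_pdivrMr ?mulr_gt0// mul1r.
Qed.

Lemma enormD x y : enorm (x + y) <= enorm x + enorm y.
Proof.
rewrite -(ler_pXn2r (n := 2))// ?nnegrE ?addr_ge0 ?enorm_ge0//.
have := cauchy_schwarz x y.
have -> : enorm (x + y) ^+ 2 = enorm x ^+ 2 + 2 * edot x y + enorm y ^+ 2.
  rewrite !enorm2E /edot mulr_sumr -!big_split/=.
  by apply: eq_bigr => i _; rewrite !mxE; ring.
lra.
Qed.

Lemma enorm_sub_triangle z x y : enorm (x - y) <= enorm (x - z) + enorm (z - y).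
Proof. by apply: le_trans (enormD _ _); rewrite subrKA. Qed.

Lemma normr_coord_le_enorm x i : `|x ord0 i| <= enorm x.
Proof.
rewrite -sqrtr_sqr ler_wsqrtr// (bigD1 i)//= lerDl.
by apply: sumr_ge0 => j _; exact: sqr_ge0.
Qed.

Lemma enorm_le_sum x : enorm x <= \sum_(i < d) `|x ord0 i|.
Proof.
rewrite -(ler_pXn2r (n := 2)) ?nnegrE ?enorm_ge0 ?sumr_ge0//.
rewrite enorm2E expr2 mulr_suml; apply: ler_sum => i _.
rewrite -real_normK ?num_real// expr2 ler_wpM2l// (bigD1 i)//= lerDl.
by apply: sumr_ge0 => j _.
Qed.

Lemma enorm_delta (i : 'I_d) : enorm (delta_mx ord0 i : 'rV[R]_d) = 1.
Proof.
rewrite /enorm (bigD1 i)//= mxE !eqxx expr1n big1 ?addr0 ?sqrtr1// => j ji.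
by rewrite mxE eqxx (negbTE ji) expr0n.
Qed.

Lemma normr_coord_le x i : `|x ord0 i| <= `|x|.
Proof.
rewrite [leRHS]/Num.Def.normr/= mx_normrE.
exact: (le_bigmax _ (fun ij => `|x ij.1 ij.2|) (ord0, i)).
Qed.

Lemma enorm_le_norm x : enorm x <= d%:R * `|x|.
Proof.
apply: (le_trans (enorm_le_sum x)).
rewrite -[X in X%:R]card_ord -sum1_card natr_sum mulr_suml.
by apply: ler_sum => i _; rewrite mul1r normr_coord_le.
Qed.

Lemma norm_le_enorm x : `|x| <= enorm x.
Proof.
rewrite /Num.Def.normr/= mx_normrE (bigmax_le _ (enorm_ge0 x))//= => -[i j] _/=.
by rewrite ord1 normr_coord_le_enorm.
Qed.

Lemma enorm_dist x y : `|enorm x - enorm y| <= enorm (x - y).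
Proof.
rewrite ler_norml; have := enormD (x - y) y; have := enormD (y - x) x.
by rewrite !subrK (enormB y x); lra.
Qed.

(** The topology comes from the sup norm, hence a factor d; the two + 1 in the constant keep it
    positive when L or d is zero. *)
Lemma enorm_lip_continuous (f : 'rV[R]_d -> R) (L : R) :
  (forall x y, `|f x - f y| <= L * enorm (x - y)) -> continuous f.
Proof.
move=> fL x; apply/(@cvgrPdist_le _ _ _ (nbhs (x : 'rV[R]_d))) => e e0.
pose M := (`|L| + 1) * (d%:R + 1).
have M0 : 0 < M by rewrite mulr_gt0// ltr_wpDl.
near=> y; apply: (le_trans (fL _ _)).
apply: (@le_trans _ _ (M * `|x - y|)).
  apply: (@le_trans _ _ ((`|L| + 1) * enorm (x - y))).
    rewrite ler_wpM2r ?enorm_ge0// (le_trans (ler_norm _))// lerDl//.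
  rewrite /M -mulrA ler_wpM2l ?addr_ge0// (le_trans (enorm_le_norm _))//.
  by rewrite ler_wpM2r// lerDl.
rewrite mulrC -ler_pdivlMr//; near: y.
have := (@cvgrPdist_le R ('rV[R]_d : normedModType R) _ (nbhs x) _ id x).1.
by apply; [exact: cvg_id|rewrite divr_gt0].
Unshelve. all: by end_near. Qed.

Lemma clamp01_lip_continuous (gamma : R -> 'rV[R]_d) (L : R) : 0 <= L ->
  (forall s t : R, 0 <= s <= 1 -> 0 <= t <= 1 ->
    enorm (gamma s - gamma t) <= L * `|s - t|) ->
  continuous (gamma \o @clamp01 R).
Proof.
move=> L0 gL t; apply: (@cvgrPdist_le R ('rV[R]_d : normedModType R) _ (nbhs t) _ _ _).2.
move=> e e0; have L1 : 0 < L + 1 by rewrite ltr_wpDl.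
near=> s; apply: (le_trans (norm_le_enorm _)).
apply: (le_trans (gL _ _ (clamp01_in _) (clamp01_in _))).
apply: (@le_trans _ _ ((L + 1) * `|t - s|)).
  by apply: ler_pM => //; [rewrite lerDl|exact: clamp01_dist].
rewrite mulrC -ler_pdivlMr//; near: s.
by apply: cvgr_dist_le; [exact: cvg_id|rewrite divr_gt0].
Unshelve. all: by end_near. Qed.
End enorm.

Import HBNNSimple.
(* Stated for a possibly non-measurable h because speed gamma is only known to
   coincide almost everywhere with a measurable function. *)
Lemma ge0_le_integral_ae_nomeas dT (T : measurableType dT) (R : realType)
    (mu : {measure set T -> \bar R}) (D : set T) (f h : T -> \bar R) :
  measurable D -> measurable_fun D f ->
  (forall x, D x -> (0 <= f x)%E) -> (forall x, D x -> (0 <= h x)%E) ->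
  {ae mu, forall x, D x -> (f x <= h x)%E} ->
  (\int[mu]_(x in D) f x <= \int[mu]_(x in D) h x)%E.
Proof.
move=> mD mf f0 h0 [N [mN N0 subN]].
rewrite (ge0_negligible_integral mN mD mf f0 N0).
rewrite !ge0_integralE//; last by move=> x [/f0].
(* A simple function below f off N and below 0 on N is below h everywhere, and the integral of h is
   the supremum over such functions. *)
apply: ereal_sup_le => _ [g /= gf <-]; exists g => // x.
apply: (le_trans (gf x)); rewrite !patchE.
case: ifPn => [|_]; last by case: ifPn => // /set_mem /h0.
rewrite inE => -[Dx Nx]; rewrite mem_set//.
by apply: contrapT => fh; apply: Nx; apply: subN => /(_ Dx).
Qed.

(** * Length and weighted length along a rectifiable path *)

Section vec.
Context (R : realType) (d : nat).
Local Notation leb := (@lebesgue_measure R).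

Lemma rectifiable_ac (gamma : R -> 'rV[R]_d) : rectifiable gamma ->
  exists v : R -> 'rV[R]_d,
  [/\ (forall i, leb.-integrable `[0, 1] (EFin \o (fun t => v t ord0 i))),
     (forall a b i, 0 <= a -> a <= b -> b <= 1 ->
        gamma b ord0 i - gamma a ord0 i =
        \int[leb]_(x in `]a, b[) (v x ord0 i)) &
     {ae leb, forall x, 0 < x < 1 ->
        derivable gamma x 1 /\ derive1 gamma x = v x}].
Proof.
move=> [L gL].
have H (i : 'I_d) : exists g : R -> R,
  [/\ leb.-integrable `[0, 1] (EFin \o g),
     (forall a b, 0 <= a -> a <= b -> b <= 1 ->
        gamma b ord0 i - gamma a ord0 i = \int[leb]_(x in `]a, b]) (g x)) &
     {ae leb, forall x, 0 < x < 1 -> derivable (fun t => gamma t ord0 i) x 1 /\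
       derive1 (fun t => gamma t ord0 i) x = g x}].
  apply: (@lip_ac _ _ L) => s t s01 t01.
  apply: le_trans (gL _ _ s01 t01).
  by have := normr_coord_le_enorm (gamma s - gamma t) i; rewrite !mxE.
have /choice[g gP] := H.
exists (fun t => \row_i g i t); split.
- move=> i; rewrite (_ : (fun t => _) = g i); first by case: (gP i).
  by apply/funext => t; rewrite mxE.
- move=> a b i a0 ab b1; have [ig HE _] := gP i; rewrite HE//.
  under [RHS]eq_Rintegral do rewrite mxE.
  rewrite -Rintegral_itv_bndo_bndc//.
  apply: integrableS ig => // x /=; rewrite !in_itv/= => /andP[ax xb].
  by rewrite (le_trans a0 (ltW ax)) (le_trans (ltW xb)).
- have aeF := ae_filter_ringOfSetsType leb.
  have : {ae leb, forall x, forall i, 0 < x < 1 ->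
      derivable (fun t => gamma t ord0 i) x 1 /\
      derive1 (fun t => gamma t ord0 i) x = g i x}.
    by apply: filter_forall => i; case: (gP i).
  apply: filterS => x xP x01; split.
    by apply/derivable_mxP => i j; rewrite ord1; case: (xP j x01).
  have dg : derivable gamma x 1.
    by apply/derivable_mxP => i j; rewrite ord1; case: (xP j x01).
  apply/rowP => j; rewrite derive1E derive_mx// !mxE.
  by case: (xP j x01) => _; rewrite derive1E.
Qed.

Lemma integrable_itv_sub (g : R -> R) (a b : R) (x y : bool) :
  0 <= a -> b <= 1 ->
  leb.-integrable `[0, 1] (EFin \o g) ->
  leb.-integrable [set` Interval (BSide x a) (BSide y b)] (EFin \o g).
Proof.
move=> a0 b1; apply: integrableS => //.
by apply: subset_itv; case: x y => -[]; rewrite bnd_simp.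
Qed.

Lemma Rintegral_itv_split (g : R -> R) (a b c : R) :
  0 <= a -> a <= b -> b <= c -> c <= 1 ->
  leb.-integrable `[0, 1] (EFin \o g) ->
  \int[leb]_(x in `]a, c[) g x =
  \int[leb]_(x in `]a, b[) g x + \int[leb]_(x in `]b, c[) g x.
Proof.
move=> a0 ab bc c1 ig.
have E (s t : R) : 0 <= s -> t <= 1 ->
    \int[leb]_(x in `]s, t[) g x = \int[leb]_(x in `]s, t]) g x.
  by move=> s0 t1; rewrite Rintegral_itv_bndo_bndc//; exact: integrable_itv_sub.
have b0 := le_trans a0 ab; have b1 := le_trans bc c1.
rewrite !E//.
rewrite -(@Rintegral_itvB _ g (BRight a) (BRight c) b).
- by rewrite addrC subrK.
- exact: integrable_itv_sub.
- by rewrite bnd_simp.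
- by rewrite bnd_simp.
Qed.

(** S and Phi are the length and the weighted length run up to a given time, computed from the
    measurable density v and not from [speed gamma]. Apart from the Lipschitz bound, these four
    properties are all that the reduction to chains uses about the path. *)
Lemma rectifiable_arclength (F : set 'rV[R]_d) (gamma : R -> 'rV[R]_d)
    (w : R -> R) (W : R) : rectifiable gamma -> straight_outside F gamma ->
  measurable_fun (`[0, 1]%classic : set R) w -> (forall t, 0 <= w t <= W) ->
  exists S Phi : R -> R,
  [/\ (forall a b, 0 <= a -> a <= b -> b <= 1 ->
        enorm (gamma b - gamma a) <= S b - S a),
     (forall a b c, 0 <= a -> a <= b -> b <= 1 -> 0 <= c ->
        (forall t, a <= t <= b -> c <= w t) ->
        c * (S b - S a) <= Phi b - Phi a),
     ((Phi 1 - Phi 0)%:E <=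
        \int[leb]_(t in `[0%R, 1%R]) (w t * speed gamma t)%:E)%E &
     (forall a b, 0 <= a -> a < b -> b <= 1 -> gamma @` `]a, b[ `<=` ~` F ->
        exists2 u : 'rV[R]_d, enorm u = 1 &
        forall s t, a <= s -> s <= t -> t <= b ->
          gamma t - gamma s = (S t - S s) *: u)].
Proof.
move=> rg sg mw w0W; have [v [iv vE vae]] := rectifiable_ac rg.
pose sigma t := enorm (v t).
have msigma : measurable_fun (`[0, 1]%classic : set R) sigma.
  apply: measurableT_comp => //.
    by apply: continuous_measurable_fun; exact: sqrt_continuous.
  apply: measurable_sum => i; apply: measurable_funX.
  by have /integrableP[/measurable_EFinP] := iv i.
have isigma : leb.-integrable `[0, 1] (EFin \o sigma).
  apply: (@le_integrable _ _ _ leb `[0, 1]%classic _ (_ \o _)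
    (fun t => \sum_(i < d) `|(v t ord0 i)%:E|)%E) => //.
  - exact/measurable_EFinP.
  - move=> t _; rewrite gee0_abs ?lee_fin ?enorm_ge0//.
    rewrite gee0_abs; last by apply: sume_ge0.
    by rewrite sumEFin lee_fin enorm_le_sum.
  - by apply: integrable_sum => // i _; exact: (integrable_abse (iv i)).
have mws : measurable_fun (`[0, 1]%classic : set R) (fun t => w t * sigma t).
  exact: measurable_funM.
have iws : leb.-integrable `[0, 1] (EFin \o (fun t => w t * sigma t)).
  apply: (@le_integrable _ _ _ leb `[0, 1]%classic _ (_ \o _) (fun t => W%:E * (EFin \o sigma) t)%E) => //.
  - exact/measurable_EFinP.
  - move=> t _ /=; rewrite lee_fin !normrM ler_wpM2r//.
    have /andP[w0 wW] := w0W t.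
    by rewrite !ger0_norm// (le_trans w0).
  - exact: integrableZl.
exists (fun t => \int[leb]_(x in `]0, t[) sigma x).
exists (fun t => \int[leb]_(x in `]0, t[) (w x * sigma x)).
have SE a b : 0 <= a -> a <= b -> b <= 1 ->
  \int[leb]_(x in `]0, b[) sigma x - \int[leb]_(x in `]0, a[) sigma x =
  \int[leb]_(x in `]a, b[) sigma x.
  by move=> a0 ab b1; rewrite (@Rintegral_itv_split _ 0 a b)// addrAC subrr add0r.
have PE a b : 0 <= a -> a <= b -> b <= 1 ->
  \int[leb]_(x in `]0, b[) (w x * sigma x) - \int[leb]_(x in `]0, a[) (w x * sigma x) =
  \int[leb]_(x in `]a, b[) (w x * sigma x).
  by move=> a0 ab b1; rewrite (@Rintegral_itv_split _ 0 a b)// addrAC subrr add0r.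
split.
- move=> a b a0 ab b1; rewrite SE//.
  set e := gamma b - gamma a.
  have [e0|e0] := eqVneq (enorm e) 0.
    by rewrite e0; apply: Rintegral_ge0 => x _; exact: enorm_ge0.
  have ep : 0 < enorm e by rewrite lt_neqAle eq_sym e0 enorm_ge0.
  (* |e|^2 is the integral of the inner product of e and v, hence at most |e| times the integral of
     |v|. *)
  rewrite -(ler_pM2l ep) -expr2 -edotxx /edot.
  pose h i x := e ord0 i * v x ord0 i.
  have iev i : leb.-integrable `]a, b[ (EFin \o h i).
    rewrite (_ : _ \o _ = (fun x => (e ord0 i)%:E * (EFin \o (fun t => v t ord0 i)) x)%E).
      by apply: integrableZl => //; exact: integrable_itv_sub.
    by apply/funext => x.
  have sumE : EFin \o (fun x => edot e (v x)) =
      (fun x => \sum_(i < d) (EFin \o h i) x)%E.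
    by apply/funext => x /=; rewrite /edot sumEFin.
  have iedot : leb.-integrable `]a, b[ (EFin \o (fun x => edot e (v x))).
    by rewrite sumE; apply: integrable_sum.
  have -> : \sum_(i < d) e ord0 i * e ord0 i =
      \int[leb]_(x in `]a, b[) edot e (v x).
    rewrite /Rintegral -[X in integral _ _ X]/(EFin \o (fun x => edot e (v x))).
    rewrite sumE integral_sum// -sum_fine; last first.
      by move=> i _; apply: integrable_fin_num.
    apply: eq_bigr => i _.
    have -> : e ord0 i * e ord0 i = e ord0 i * \int[leb]_(x in `]a, b[) v x ord0 i.
      by rewrite -vE// !mxE.
    rewrite -[RHS]/(\int[leb]_(x in `]a, b[) (e ord0 i * v x ord0 i)).
    by rewrite RintegralZl//; apply: integrable_itv_sub a0 b1 (iv i).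
  rewrite -RintegralZl//; last exact: integrable_itv_sub.
  apply: le_Rintegral => //; last by move=> x _; exact: cauchy_schwarz.
  rewrite (_ : _ \o _ = (fun x => (enorm e)%:E * (EFin \o sigma) x)%E)//.
  by apply: integrableZl => //; exact: integrable_itv_sub.
- move=> a b c a0 ab b1 c0 cw; rewrite SE// PE// -RintegralZl//; last exact: integrable_itv_sub.
  apply: le_Rintegral => //.
  + rewrite (_ : _ \o _ = (fun x => c%:E * (EFin \o sigma) x)%E)//.
    by apply: integrableZl => //; exact: integrable_itv_sub.
  + exact: integrable_itv_sub.
  + move=> x; rewrite /= in_itv/= => /andP[ax xb].
    by rewrite ler_wpM2r ?enorm_ge0// cw// !ltW.
- rewrite PE// /Rintegral fineK; last first.
    by apply: integrable_fin_num => //; exact: integrable_itv_sub.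
  (* The endpoints are added on the side of [w * sigma], whose measurability is known; [speed gamma]
     is identified with sigma only almost everywhere inside ]0, 1[. *)
  rewrite -(@integral_itv_bndoo _ 0 1 _ true false); last first.
    apply/measurable_EFinP; apply: measurable_funS mws => //.
    exact: subset_itv_oo_cc.
  have aeF := ae_filter_ringOfSetsType leb.
  apply: ge0_le_integral_ae_nomeas => //.
  + exact/measurable_EFinP.
  + move=> x _; have /andP[w0 _] := w0W x.
    by rewrite lee_fin mulr_ge0// enorm_ge0.
  + move=> x _; have /andP[w0 _] := w0W x.
    by rewrite lee_fin mulr_ge0// enorm_ge0.
  + have ne c : {ae leb, forall x : R, x != c}.
      exists [set c]; split => //; first by rewrite lebesgue_measure_set1.
      by move=> x /= /negP; rewrite negbK => /eqP.
    move: (ne 0) (ne 1) vae; apply: filterS3 => x x0 x1 xv.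
    rewrite /= in_itv/= => /andP[x0' x1'].
    have [|_ xE] := xv; first by rewrite !lt_neqAle eq_sym x0 x0' x1 x1'.
    by rewrite /speed xE.
- move=> a b a0 ab b1 abF; have [u u1 gu] := sg _ _ a0 ab b1 abF.
  exists u => // s t as_ st tb; have s0 := le_trans a0 as_; have t1 := le_trans tb b1.
  rewrite SE//; apply/rowP => i; rewrite !mxE vE// mulrC -RintegralZl//; last exact: integrable_itv_sub.
  congr fine; apply: ae_eq_integral => //.
  + apply/measurable_EFinP; have /integrableP[/measurable_EFinP mv _] := iv i.
    by apply: measurable_funS mv => // x /=; rewrite !in_itv/=; lra.
  + apply/measurable_EFinP; apply: measurable_funM => //.
    by apply: measurable_funS msigma => // x /=; rewrite !in_itv/=; lra.
  + move: vae; apply: filterS; first exact: (ae_filter_ringOfSetsType leb).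
    move=> x xv; rewrite /= in_itv/= => /andP[sx xt].
    have [|dx xE] := xv; first by lra.
    rewrite /sigma -xE gu//; last by rewrite in_itv/=; lra.
    by rewrite !mxE enormZ u1 mulr1 ger0_norm ?enorm_ge0// mulrC.
Qed.
End vec.

(** * Shortcutting a chain *)

Section shortcut_free.
Context (R : realType) (T : eqType) (k : T -> T -> R).

Definition shortcut_free (n : nat) (p : nat -> T) := forall i j : nat,
  (i < j <= n)%N -> \sum_(i <= l < j) k (p l) (p l.+1) <= k (p i) (p j).

(** As long as some subchain costs more than the edge joining its ends, that edge replaces it. The
    number of edges drops each time, and no vertex is created, so the interior ones keep Q. *)
Lemma shortcut_free_exists (Q : T -> Prop) (n : nat) (p : nat -> T) :
  (0 < n)%N -> (forall i, (0 < i < n)%N -> Q (p i)) ->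
  exists m (q : nat -> T),
  [/\ (0 < m)%N, q 0 = p 0 /\ q m = p n, (forall i, (0 < i < m)%N -> Q (q i)),
      \sum_(0 <= l < m) k (q l) (q l.+1) <= \sum_(0 <= l < n) k (p l) (p l.+1)
    & shortcut_free m q].
Proof.
have [b] := ubnP n; elim: b n p => // b IH n p nb n0 Qp.
have [sf|] := pselect (shortcut_free n p); first by exists n, p.
move=> /existsNP[i] /existsNP[j] /not_implyP[/andP[ij jn]] /negP; rewrite -ltNge => sf.
have ij1 : (i.+1 < j)%N.
  rewrite ltn_neqAle ij andbT; apply/eqP => E.
  by move: sf; rewrite -E big_nat1 ltxx.
(* g counts the vertices strictly between i and j, which q skips. *)
pose g := (j - i.+1)%N; pose q l := if (l <= i)%N then p l else p (l + g)%N.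
pose m := (n - g)%N.
have gE : (i.+1 + g = j)%N by rewrite /g; lia.
have mn : (m < n)%N by rewrite /m /g; lia.
have im : (i < m)%N by rewrite /m /g; lia.
have mb : (m < b)%N by lia.
have m0 : (0 < m)%N by lia.
have Qq l : (0 < l < m)%N -> Q (q l).
  by move=> lm; rewrite /q; case: ifP => li; apply: Qp; rewrite /m in lm; lia.
have [m' [q' [m'0 [q'0 q'm] Qq' le' sf']]] := IH m q mb m0 Qq.
exists m', q'; split => //.
  by rewrite q'0 q'm /q leq0n leqNgt im/=; split => //; congr p; rewrite /m; lia.
apply: (le_trans le').
rewrite (big_cat_nat (n := i))//=; last by lia.
rewrite [leRHS](big_cat_nat (n := i))//=; last by lia.
apply: lerD.
  rewrite big_nat_cond [leRHS]big_nat_cond; apply: ler_sum => l /andP[/andP[_ li] _].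
  by rewrite /q (ltnW li) li.
rewrite [leRHS](big_cat_nat (n := j))//=; last by lia.
rewrite big_ltn//; apply: lerD.
  by rewrite /q leqnn ltnn addSn -addSn gE ltW.
rewrite -{1}gE (_ : n = (m + g)%N); last by rewrite /m /g; lia.
rewrite big_addn addnK; apply: ler_sum_nat => l /andP[il _].
have -> : q l = p (l + g)%N by rewrite /q leqNgt il.
by have -> : q l.+1 = p (l + g).+1 by rewrite /q leqNgt ltnS (ltnW il).
Qed.
End shortcut_free.

(** * Length of a shortcut-free chain *)

Section shortcut.
Context (R : realType) (T : eqType).
Variables (dist : T -> T -> R) (k : T -> T -> R) (f : T -> R).
Variables (beta c : R) (N : nat).
(** 6 is twice 3: balls of radius 3r centred at points this far apart are disjoint. *)
Definition sep (r : R) : R := 6 * r.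
Let sep_gt0 r : 0 < r -> 0 < sep r. Proof. by move=> r0; rewrite mulr_gt0. Qed.
Hypothesis dist_sym : forall x y, dist x y = dist y x.
Hypothesis dist_ge0 : forall x y, 0 <= dist x y.
Hypothesis dist_xx : forall x, dist x x = 0.
Hypothesis dist_triangle : forall x y z, dist x z <= dist x y + dist y z.
Hypothesis f_ge0 : forall x, 0 <= f x.
Hypothesis beta_ge0 : 0 <= beta.
Hypothesis c_gt0 : 0 < c.
Hypothesis k_le : forall p q, k p q <= dist p q * (f p + dist p q) `^ beta.
Hypothesis k_ge : forall p q, c * Num.max (f p) (dist p q) `^ beta * dist p q <= k p q.
Hypothesis cov : forall (r : R) (xs : seq T), 0 < r ->
  all (fun x => f x <= r) xs -> pairwise (fun x y => sep r <= dist x y) xs ->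
  (size xs <= N)%N.

Lemma k_ge0 p q : 0 <= k p q.
Proof. by apply: le_trans (k_ge p q); rewrite !mulr_ge0 ?powR_ge0// ltW. Qed.

Section level.
Variables (n : nat) (p : nat -> T).
Hypothesis opt : shortcut_free k n p.

Let e l := dist (p l) (p l.+1).
Let sigma l := Num.max (f (p l)) (e l).
(** B r is the quotient of 7r (8r)^beta, which bounds the cost of a segment of length at most 7r
    starting where f <= r, by the least cost c (r/2)^beta per unit length of an edge of level r. *)
Let B := 7 * 16 `^ beta / c.

Let B_ge0 : 0 <= B.
Proof. by rewrite !mulr_ge0 ?powR_ge0 ?invr_ge0 ?ltW. Qed.

Let P (r : R) l := (r / 2 < sigma l) && (sigma l <= r).

Lemma level_edge (r : R) l : 0 < r -> P r l -> e l <= k (p l) (p l.+1) / (c * (r / 2) `^ beta).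
Proof.
move=> r0 /andP[rs _].
have r2 : 0 < (r / 2) `^ beta by rewrite powR_gt0// divr_gt0.
rewrite ler_pdivlMr ?mulr_gt0// mulrC; apply: le_trans (k_ge _ _).
rewrite -!mulrA ler_pM2l//; apply: ler_wpM2r; first exact: dist_ge0.
apply: ge0_ler_powR => //; rewrite ?nnegrE.
- by rewrite divr_ge0// ltW.
- by rewrite le_max f_ge0.
- exact: ltW.
Qed.

(* By optimality, the edges of level r ending up within 6r of p i cost at most the
   segment from p i to the last of them, which has length at most 7r. *)
Lemma pivot_sum (r : R) (i J : nat) : 0 < r -> f (p i) <= r -> (J <= n)%N ->
  \sum_(i <= l < J | P r l && (dist (p i) (p l) < sep r)) e l <= B * r.
Proof.
move=> r0 fi; elim: J => [|J IH] Jn.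
  by rewrite big_geq// mulr_ge0// ltW.
have [iJ|Ji] := leqP i J; last by rewrite big_geq// mulr_ge0// ltW.
rewrite big_mkcond big_nat_recr//= -big_mkcond/=.
(* Only a qualifying last edge J matters: the whole subchain from i to J + 1 is then compared with
   the segment joining its ends. *)
case: ifPn => [/andP[PJ iJr]|_]; last by rewrite addr0 IH// ltnW.
have r2 : 0 < c * (r / 2) `^ beta by rewrite mulr_gt0// powR_gt0// divr_gt0.
apply: (@le_trans _ _ ((\sum_(i <= l < J.+1) k (p l) (p l.+1)) / (c * (r / 2) `^ beta))).
  rewrite [X in _ <= X / _]big_nat_recr// mulrDl; apply: lerD; last exact: level_edge.
  rewrite mulr_suml big_mkcond/=; apply: ler_sum => l _.
  case: ifPn => [/andP[Pl _]|_]; first exact: level_edge.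
  by rewrite divr_ge0 ?k_ge0// ltW.
rewrite ler_pdivrMr//.
apply: (le_trans (opt _)); first by rewrite ltnS iJ.
apply: (le_trans (k_le _ _)).
have d7 : dist (p i) (p J.+1) <= 7 * r.
  apply: (le_trans (dist_triangle _ (p J) _)).
  have : e J <= r by move: PJ => /andP[_]; apply: le_trans; rewrite le_max lexx orbT.
  by move: iJr; rewrite /e /sep; lra.
apply: (@le_trans _ _ (7 * r * (8 * r) `^ beta)).
  apply: ler_pM => //; first exact: powR_ge0.
  have r8 : 0 <= 8 * r by lra.
  by apply: ge0_ler_powR => //; rewrite ?nnegrE ?addr_ge0//; lra.
have -> : 8 * r = 16 * (r / 2) by field.
rewrite powRM// ?divr_ge0// ?(ltW r0)//.
by rewrite /B le_eqVlt; apply/orP; left; apply/eqP; field; rewrite gt_eqF.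
Qed.

(* Pivots are chosen greedily: the first vertex of level r that is 6r away from the
   previous pivots, which form the list xs below. *)
Lemma level_sum (r : R) : 0 < r ->
  \sum_(0 <= l < n | P r l) e l <= N%:R * B * r.
Proof.
move=> r0.
(* m counts the edges still to be scanned. Each pivot in [xs] has used up one of the N allowed, and
   only edges starting far from all of them remain to be counted. *)
suff H m (xs : seq T) : all (fun x => f x <= r) xs ->
    pairwise (fun x y => sep r <= dist x y) xs ->
    \sum_(n - m <= l < n | P r l && all (fun x => sep r <= dist (p l) x) xs) e l
      <= (N - size xs)%:R * B * r.
  have := H n [::] isT isT; rewrite subnn subn0; apply: le_trans.
  by rewrite le_eqVlt; apply/orP; left; apply/eqP; apply: eq_bigl => l; rewrite andbT.
elim: m xs => [|m IH] xs fxs pxs.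
  rewrite subn0 big_geq//; apply: mulr_ge0; last exact: ltW.
  exact: mulr_ge0.
have [nm|mn] := leqP n m.
  have := IH xs fxs pxs.
  by rewrite (_ : (n - m = n - m.+1)%N)//; move: nm; lia.
have -> : (n - m.+1 = (n - m).-1)%N by lia.
set i := (n - m).-1.
have ni : (n - m = i.+1)%N by rewrite /i; lia.
have iin : (i < n)%N by lia.
have [/andP[Pi ai]|Ni] := boolP (P r i && all (fun x => sep r <= dist (p i) x) xs); last first.
  by rewrite big_mkcond big_ltn// (negbTE Ni)/= add0r -big_mkcond -ni; exact: IH.
have fi : f (p i) <= r by move: Pi => /andP[_]; apply: le_trans; rewrite le_max lexx.
have pxs' : pairwise (fun x y => sep r <= dist x y) (p i :: xs) by rewrite /= ai.
have fxs' : all (fun x => f x <= r) (p i :: xs) by rewrite /= fi.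
(* The packing bound guarantees that a pivot was still available, so the natural subtraction below
   is not truncated. *)
have sN := cov r0 fxs' pxs'.
have -> : ((N - size xs) = (N - size (p i :: xs)).+1)%N by move: sN => /=; lia.
rewrite -natr1 addrC !mulrDl mul1r.
rewrite (bigID (fun l => dist (p i) (p l) < sep r))/= lerD//.
  apply: le_trans (pivot_sum r0 fi (leqnn n)).
  rewrite big_mkcond [leRHS]big_mkcond; apply: ler_sum => l _.
  case: ifPn => [/andP[/andP[-> _] ->]//|_]; case: ifP => // _; exact: dist_ge0.
apply: le_trans (IH _ fxs' pxs').
rewrite ni big_mkcond big_ltn//= dist_xx sep_gt0// andbF add0r.
rewrite [leRHS]big_mkcond; apply: ler_sum => l _.
case: ifPn => [/andP[/andP[-> ->]]|_].
  by rewrite -leNgt dist_sym => ->.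
by case: ifP => // _; exact: dist_ge0.
Qed.

(* Dyadic summation over the levels r = D / 2^J, J < n; the n edges below level
   D / 2^n contribute at most n D / 2^n <= D. *)
Lemma shortcut_free_length (D : R) : 0 < D ->
  (forall l, (l < n)%N -> f (p l) <= D /\ e l <= D) ->
  \sum_(0 <= l < n) e l <= (2 * N%:R * B + 1) * D.
Proof.
move=> D0 bnd.
(* 2 - 2 / 2^J is the sum of the first J terms of 1 + 1/2 + 1/4 + ...; for J = 0 no edge
   qualifies. *)
have H J : \sum_(0 <= l < n | D / 2 ^+ J < sigma l) e l <=
    N%:R * B * D * (2 - 2 / 2 ^+ J).
  elim: J => [|J IH].
    rewrite expr0 divr1 big1_seq ?mulr0 ?divr1 ?subrr ?mulr0// => l /=.
    rewrite mem_index_iota/= => /andP[+ ln]; have [fl el] := bnd l ln.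
    by rewrite ltNge ge_max fl el.
  have r0 : 0 < D / 2 ^+ J by rewrite divr_gt0// exprn_gt0.
  rewrite (bigID (fun l => D / 2 ^+ J < sigma l))/=.
  have -> : N%:R * B * D * (2 - 2 / 2 ^+ J.+1) = N%:R * B * D * (2 - 2 / 2 ^+ J) +
     N%:R * B * (D / 2 ^+ J).
    by rewrite exprS; field; rewrite expf_neq0.
  rewrite lerD//.
    apply: le_trans IH; rewrite big_mkcond [leRHS]big_mkcond.
    apply: ler_sum => l _; case: ifPn => [/andP[_ ->]//|_]; case: ifP => // _.
    exact: dist_ge0.
  apply: le_trans (level_sum r0).
  rewrite big_mkcond [leRHS]big_mkcond.
  apply: ler_sum => l _; rewrite -leNgt /P.
  have -> : D / 2 ^+ J / 2 = D / 2 ^+ J.+1 by rewrite exprS; field; rewrite expf_neq0.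
  by [].
rewrite (bigID (fun l => D / 2 ^+ n < sigma l))/= mulrDl mul1r lerD//.
  apply: (le_trans (H n)).
  have h : 0 <= N%:R * B * D.
    by apply: mulr_ge0; [exact: mulr_ge0|exact: ltW].
  have h2 : 0 <= 2 / 2 ^+ n :> R by rewrite divr_ge0// exprn_ge0.
  have : N%:R * B * D * (2 - 2 / 2 ^+ n) <= N%:R * B * D * 2.
    by apply: ler_wpM2l => //; lra.
  by move=> /le_trans; apply; rewrite le_eqVlt; apply/orP; left; apply/eqP; ring.
apply: (@le_trans _ _ (\sum_(0 <= l < n) D / 2 ^+ n)).
  rewrite big_mkcond; apply: ler_sum => l _; case: ifPn => [|_].
    by rewrite -leNgt => /(le_trans _); apply; rewrite le_max lexx orbT.
  by rewrite divr_ge0 ?exprn_ge0// ltW.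
rewrite sumr_const_nat subn0 -[leLHS]mulr_natr -mulrA ler_piMr ?(ltW D0)//.
by rewrite mulrC ler_pdivrMr ?exprn_gt0// mul1r -natrX ler_nat ltnW// ltn_expl.
Qed.
End level.

End shortcut.

(** * Primitives of continuous weights, and increments of powers *)

Section prim.
Context (R : realType).
Local Notation leb := (@lebesgue_measure R).
Variable w : R -> R.
Hypothesis cw : continuous w.

Definition prim (r : R) : R := \int[leb]_(x in `]0, r[) w x.

Lemma continuous_integrable01 : leb.-integrable `[0, 1] (EFin \o w).
Proof.
apply: continuous_compact_integrable; first exact: segment_compact.
exact: continuous_subspaceT.
Qed.

Lemma primB (a b : R) : 0 <= a -> a <= b -> b <= 1 ->
  prim b - prim a = \int[leb]_(x in `]a, b[) w x.
Proof.
move=> a0 ab b1; rewrite /prim (@Rintegral_itv_split _ _ 0 a b)//.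
  by rewrite addrAC subrr add0r.
exact: continuous_integrable01.
Qed.

Lemma prim_cst (a b c : R) : a <= b -> \int[leb]_(x in `]a, b[) c = c * (b - a).
Proof.
move=> ab; rewrite Rintegral_cst//= lebesgue_measure_itv/= lte_fin.
case: ltP => //= ba.
by rewrite (@le_anti _ _ a b) ?ab// subrr.
Qed.

Lemma integrable_itv_cst (a b c : R) : leb.-integrable `]a, b[ (EFin \o (fun=> c)).
Proof.
have oo : (leb (`]a, b[%classic : set R) < +oo)%E.
  by rewrite lebesgue_measure_itv/= lte_fin; case: ifP => _; rewrite ?ltry// -EFinD ltry.
apply: measurable_bounded_integrable => //.
exists `|c|; split; first exact: num_real.
by move=> x Mx y _; exact: ltW.
Qed.

Lemma prim_ge (a b c : R) : 0 <= a -> a <= b -> b <= 1 ->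
  (forall s, a <= s <= b -> c <= w s) -> c * (b - a) <= prim b - prim a.
Proof.
move=> a0 ab b1 cws; rewrite primB// -prim_cst//; apply: le_Rintegral => //.
- exact: integrable_itv_cst.
- by apply: integrable_itv_sub => //; exact: continuous_integrable01.
- by move=> x; rewrite /= in_itv/= => /andP[? ?]; apply: cws; rewrite !ltW.
Qed.

Lemma prim_le (a b c : R) : 0 <= a -> a <= b -> b <= 1 ->
  (forall s, a <= s <= b -> w s <= c) -> prim b - prim a <= c * (b - a).
Proof.
move=> a0 ab b1 cws; rewrite primB// -prim_cst//; apply: le_Rintegral => //.
- by apply: integrable_itv_sub => //; exact: continuous_integrable01.
- exact: integrable_itv_cst.
- by move=> x; rewrite /= in_itv/= => /andP[? ?]; apply: cws; rewrite !ltW.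
Qed.

Lemma prim_nd (a b : R) : (forall s, 0 <= w s) -> 0 <= a -> a <= b -> b <= 1 ->
  prim a <= prim b.
Proof.
move=> w0 a0 ab b1; rewrite -subr_ge0.
by have := prim_ge a0 ab b1 (fun s _ => w0 s); rewrite mul0r.
Qed.

Lemma prim0 : prim 0 = 0.
Proof. by rewrite /prim set_itv_ge ?bnd_simp ?ltxx// Rintegral_set0. Qed.
End prim.

Lemma prim_leM (R : realType) (w1 w2 : R -> R) (c : R) :
  continuous w1 -> continuous w2 -> (forall s, 0 <= s <= 1 -> w1 s <= w2 s + c) ->
  prim w1 1 <= prim w2 1 + c.
Proof.
move=> c1 c2 w12.
rewrite -[X in _ <= _ + X]mulr1 -[X in _ <= _ + c * X]subr0 -prim_cst// /prim.
have i1 := continuous_integrable01 c1; have i2 := continuous_integrable01 c2.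
rewrite -RintegralD//; last 2 first.
- exact: integrable_itv_sub.
- exact: integrable_itv_cst.
apply: le_Rintegral => //.
- exact: integrable_itv_sub.
- rewrite (_ : _ \o _ = (EFin \o w2) \+ (EFin \o (fun=> c)))%E//.
  apply: integrableD => //; first exact: integrable_itv_sub.
  exact: integrable_itv_cst.
- by move=> x; rewrite /= in_itv/= => /andP[? ?]; apply: w12; rewrite !ltW.
Qed.

Section powR_lip.
Context (R : realType) (beta : R).
Hypothesis beta_ge1 : 1 <= beta.

(** Young's inequality for u and 1 with exponents beta and beta / (beta - 1); beta = 1 is separate
    because its conjugate exponent is infinite. *)
Lemma bernoulli_powR (u : R) : 0 <= u -> 1 + beta * (u - 1) <= u `^ beta.
Proof.
move=> u0; have [b1|bn1] := eqVneq beta 1; first by rewrite b1 powRr1//; lra.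
have b1 : 1 < beta by rewrite lt_neqAle eq_sym bn1.
have b0 : 0 < beta by lra.
have q0 : 0 < beta / (beta - 1) by rewrite divr_gt0// subr_gt0.
have := @conjugate_powR R u 1 beta (beta / (beta - 1)) u0 ler01 b0 q0.
rewrite powR1 mulr1 => H.
have /H : beta^-1 + (beta / (beta - 1))^-1 = 1.
  by field; rewrite !gt_eqF//; lra.
have -> : 1 / (beta / (beta - 1)) = 1 - beta^-1 by field; rewrite !gt_eqF//; lra.
rewrite -(ler_pM2l b0) mulrDr mulrCA divff ?gt_eqF// mulr1 mulrBr divff ?gt_eqF//.
lra.
Qed.

(** Bernoulli's inequality at y / x, scaled by x^beta, does the work of the mean value theorem. *)
Lemma powR_sub_le (x y M : R) : 0 <= y -> y <= x -> x <= M ->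
  x `^ beta - y `^ beta <= beta * M `^ (beta - 1) * (x - y).
Proof.
move=> y0 yx xM; have b0 : 0 <= beta by exact: le_trans beta_ge1.
have [x0|xn0] := eqVneq x 0.
  have -> : y = x by apply/le_anti; rewrite yx x0 y0.
  by rewrite !subrr mulr0.
have x0 : 0 < x by rewrite lt_neqAle eq_sym xn0 (le_trans y0).
have := bernoulli_powR (divr_ge0 y0 (ltW x0)).
have xb : 0 < x `^ beta by rewrite powR_gt0.
rewrite -(ler_pM2l xb) -powRM ?divr_ge0 ?(ltW x0)// mulrCA divff// mulr1 => H.
have xE : x `^ beta = x `^ (beta - 1) * x.
  rewrite -{3}(powRr1 (ltW x0)) -powRD ?subrK//.
  by rewrite (negbTE xn0) implybT.
apply: (@le_trans _ _ (beta * x `^ (beta - 1) * (x - y))).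
  have -> : beta * x `^ (beta - 1) * (x - y) =
     x `^ beta - x `^ beta * (1 + beta * (y / x - 1)).
    by rewrite xE; field.
  lra.
rewrite ler_wpM2r ?subr_ge0// ler_wpM2l//.
by apply: ge0_ler_powR; rewrite ?nnegrE ?subr_ge0// ?(ltW x0)// (le_trans (ltW x0)).
Qed.
End powR_lip.

(** * Cost of a segment *)

Section segcost.
Context (R : realType) (d : nat).
Implicit Types p q x y : 'rV[R]_d.

Definition seg p q (s : R) := p + s *: (q - p).

Lemma seg0 p q : seg p q 0 = p. Proof. by rewrite /seg scale0r addr0. Qed.
Lemma seg1 p q : seg p q 1 = q. Proof. by rewrite /seg scale1r addrC subrK. Qed.
Lemma segB p q s t : seg p q s - seg p q t = (s - t) *: (q - p).
Proof. by rewrite /seg opprD addrACA subrr add0r -scalerBl. Qed.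

Lemma seg_continuous p q : continuous (seg p q).
Proof.
move=> s; apply: cvgD; first exact: cvg_cst.
by apply: cvgZr_tmp; exact: cvg_id.
Qed.

Definition edist p q : R := enorm (q - p).

Section cost.
Variables (f : 'rV[R]_d -> R) (beta : R).
Hypothesis f_ge0 : forall x, 0 <= f x.
Hypothesis f_lip : forall x y, f x <= f y + enorm (x - y).
Hypothesis beta_ge1 : 1 <= beta.
Let beta_ge0 : 0 <= beta. Proof. exact: le_trans beta_ge1. Qed.

Definition segcost p q := edist p q * prim (fun s => f (seg p q s) `^ beta) 1.

Lemma f_continuous : continuous f.
Proof.
apply: (@enorm_lip_continuous _ _ _ 1) => x y; rewrite mul1r ler_norml.
by have := f_lip x y; have := f_lip y x; rewrite (enormB y x); lra.
Qed.

Lemma pow_f_sub_le x y (M : R) : f x <= M -> f y <= M ->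
  f x `^ beta - f y `^ beta <= beta * M `^ (beta - 1) * enorm (x - y).
Proof.
move=> xM yM; have M0 := le_trans (f_ge0 x) xM.
have c0 : 0 <= beta * M `^ (beta - 1) by rewrite mulr_ge0// powR_ge0.
have [xy|/ltW yx] := leP (f x) (f y).
  apply: (@le_trans _ _ 0); last by rewrite mulr_ge0// enorm_ge0.
  by rewrite subr_le0 ge0_ler_powR// nnegrE.
apply: (le_trans (powR_sub_le beta_ge1 (f_ge0 y) yx xM)).
by rewrite ler_wpM2l//; have := f_lip x y; lra.
Qed.

Lemma pow_f_continuous : continuous (fun x => f x `^ beta).
Proof.
move=> x; apply/(@cvgrPdist_le _ _ _ (nbhs (x : 'rV[R]_d))) => e e0.
pose M := f x + 1; have M0 : 0 < M by rewrite ltr_wpDl.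
pose C := beta * M `^ (beta - 1).
have C0 : 0 <= C by rewrite mulr_ge0// powR_ge0.
have := (@cvgrPdist_le _ _ _ (nbhs (x : 'rV[R]_d)) _ f (f x)).1 (@f_continuous x).
move=> /(_ _ _ ltr01) fx1.
have Cd : 0 < (C + 1) * (d%:R + 1) by rewrite mulr_gt0// ltr_wpDl.
have ed := (@cvgrPdist_le R ('rV[R]_d : normedModType R) _ (nbhs (x : 'rV[R]_d)) _ id x).1
  cvg_id _ (divr_gt0 e0 Cd).
near=> y.
have fy1 : `|f x - f y| <= 1 by near: y.
have fyM : f y <= M by move: fy1; rewrite ler_norml /M; lra.
have fxM : f x <= M by rewrite /M lerDl.
have : enorm (x - y) <= e / (C + 1).
  have : `|x - y| <= e / ((C + 1) * (d%:R + 1)) by near: y; exact: ed.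
  rewrite invfM mulrA ler_pdivlMr ?ltr_wpDl//; apply: le_trans.
  apply: (le_trans (enorm_le_norm _)); rewrite mulrC ler_wpM2l//.
  by rewrite lerDl.
rewrite ler_pdivlMr ?ltr_wpDl// => exy.
have H1 := pow_f_sub_le fxM fyM; have H2 := pow_f_sub_le fyM fxM.
have e1 := enorm_ge0 (x - y).
by move: H1 H2; rewrite -/C ler_norml (enormB y x); nra.
Unshelve. all: by end_near. Qed.

Lemma seg_f_continuous p q : continuous (fun s => f (seg p q s) `^ beta).
Proof.
move=> s; apply: (@continuous_comp _ _ _ (seg p q) (fun x => f x `^ beta)).
  exact: seg_continuous.
exact: pow_f_continuous.
Qed.

Lemma f_seg_le p q s : 0 <= s <= 1 -> f (seg p q s) <= f p + edist p q.
Proof.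
move=> /andP[s0 s1]; apply: (le_trans (f_lip _ p)); rewrite lerD2l.
rewrite -[X in _ - X](seg0 p q) segB subr0 enormZ ger0_norm//.
by rewrite ler_piMl// enorm_ge0.
Qed.

Lemma segcost_le_sup p q (M : R) : (forall s, 0 <= s <= 1 -> f (seg p q s) <= M) ->
  segcost p q <= edist p q * M `^ beta.
Proof.
move=> fM; rewrite ler_wpM2l ?enorm_ge0//.
have M0 : 0 <= M by apply: le_trans (fM 0 _) => //; rewrite lexx ler01.
have := @prim_le _ _ (@seg_f_continuous p q) 0 1 (M `^ beta) (lexx _) ler01 (lexx _).
rewrite prim0 !subr0 mulr1; apply => s s01.
by apply: ge0_ler_powR => //; rewrite ?nnegrE//; exact: fM.
Qed.

Lemma segcost_le p q : segcost p q <= edist p q * (f p + edist p q) `^ beta.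
Proof. by apply: segcost_le_sup => s; exact: f_seg_le. Qed.

Lemma segcost_ge_itv p q a b (c : R) : 0 <= a -> a <= b -> b <= 1 -> 0 <= c ->
  (forall s, a <= s <= b -> c <= f (seg p q s)) ->
  edist p q * (c `^ beta * (b - a)) <= segcost p q.
Proof.
move=> a0 ab b1 c0 cf; rewrite ler_wpM2l ?enorm_ge0//.
apply: (@le_trans _ _ (prim (fun s => f (seg p q s) `^ beta) b -
  prim (fun s => f (seg p q s) `^ beta) a)).
  apply: prim_ge => //; first exact: seg_f_continuous.
  by move=> s sab; apply: ge0_ler_powR => //; rewrite ?nnegrE//; exact: cf.
have pn := @prim_nd _ _ (@seg_f_continuous p q) _ _ (fun s => powR_ge0 _ _).
have := pn 0 a (lexx _) a0 (le_trans ab b1).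
have := pn b 1 (le_trans a0 ab) b1 (lexx _).
by rewrite prim0; lra.
Qed.

Variable (N : nat).
Hypothesis N_gt0 : (0 < N)%N.
Hypothesis cov : forall (r : R) (xs : seq 'rV[R]_d), 0 < r ->
  all (fun x => f x <= r) xs -> pairwise (fun x y => 6 * r <= edist x y) xs ->
  (size xs <= N)%N.

(* If f p is small compared to the length l of the segment, one of its N + 1
   equally spaced points has f > l / (6N), by the packing bound. *)
Lemma segcost_ge p q :
  (24 * N%:R)^-1 `^ beta / (12 * N%:R) * Num.max (f p) (edist p q) `^ beta * edist p q
  <= segcost p q.
Proof.
set l := edist p q; have l0 : 0 <= l by exact: enorm_ge0.
have n0 : 0 < N%:R :> R by rewrite ltr0n.
have n1 : 1 <= N%:R :> R by rewrite ler1n.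
have n0' : N%:R != 0 :> R by rewrite gt_eqF.
have M0 : 0 <= Num.max (f p) l by rewrite le_max f_ge0.
have n24 : 0 <= (24 * N%:R)^-1 :> R by rewrite invr_ge0 mulr_ge0.
rewrite [_ / _ * _]mulrAC -powRM// -/l mulrC.
(* When f p >= 2l, the Lipschitz bound gives f >= f p / 2 on the whole segment. *)
have [lf|fl] := leP (2 * l) (f p).
  have := @segcost_ge_itv p q 0 1 ((24 * N%:R)^-1 * Num.max (f p) l) (lexx _) ler01 (lexx _).
  rewrite subr0 mulr1 => H.
  apply: le_trans (H _ _).
  - rewrite ler_wpM2l// ler_pdivrMr ?mulr_gt0// ler_peMr ?powR_ge0//; lra.
  - exact: mulr_ge0.
  - move=> s s01; rewrite max_l; last lra.
    rewrite mulrC ler_pdivrMr ?mulr_gt0//.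
    have := f_lip p (seg p q s); rewrite -{3}(seg0 p q) segB sub0r.
    rewrite enormZ normrN ger0_norm; last by case/andP: s01.
    have sl : s * enorm (q - p) <= l by rewrite ler_piMl ?enorm_ge0//; case/andP: s01.
    move: (f_ge0 (seg p q s)) (f_ge0 p) => fs fp H2; nra.
have lp : 0 < l by move: (f_ge0 p); lra.
(* The N + 1 points are at least l / N = 6r apart, too many for f to be at most r at all of them. *)
pose r := l / (6 * N%:R); have r0 : 0 < r by rewrite divr_gt0// mulr_gt0.
have [i iN fi] : exists2 i, (i <= N)%N & r < f (seg p q (i%:R / N%:R)).
  apply: contrapT => no; pose xs := [seq seg p q (i%:R / N%:R) | i <- iota 0 N.+1].
  have : (size xs <= N)%N.
    apply: (cov r0).
      apply/allP => _ /mapP[i + ->]; rewrite mem_iota add0n ltnS/= => iN.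
      by rewrite leNgt; apply/negP => fi; apply: no; exists i.
    rewrite /xs pairwise_map.
    have := iota_ltn_sorted 0 N.+1; rewrite sorted_pairwise; last exact: ltn_trans.
    apply: sub_pairwise => i j /= ij.
    rewrite /edist segB enormZ -/(edist p q) -/l -mulrBl.
    have -> : 6 * r = N%:R^-1 * l by rewrite /r; field.
    rewrite ler_pM2r// ger0_norm; last first.
      by rewrite divr_ge0// subr_ge0 ler_nat ltnW.
    rewrite ler_peMl ?invr_ge0//.
    by rewrite -natrB ?ler1n ?subn_gt0// ltnW.
  by rewrite size_map size_iota ltnn.
(* Since r = 2 h l, f stays above h l for parameters within h of the point found; and h l is
   (24N)^-1 times 2l, which bounds the maximum in this case. *)
pose h : R := (12 * N%:R)^-1.
have h0 : 0 < h by rewrite invr_gt0 mulr_gt0.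
have h1 : h <= 1 by rewrite invf_le1 ?mulr_gt0//; lra.
pose t : R := i%:R / N%:R.
have t01 : 0 <= t <= 1.
  by rewrite divr_ge0//= ler_pdivrMr// mul1r ler_nat.
(* This choice puts t in [a, a + h] and that interval in [0, 1], wherever t lies in [0, 1]. *)
pose a := t * (1 - h).
have := @segcost_ge_itv p q a (a + h) ((24 * N%:R)^-1 * Num.max (f p) l).
have a0 : 0 <= a by apply: mulr_ge0; lra.
have ah1 : a + h <= 1 by rewrite /a; nra.
rewrite (addrC a) addrK -/h; apply => //; [lra|lra|exact: mulr_ge0|].
move=> s /andP[as_ sah].
have st : `|t - s| <= h by rewrite ler_norml; move: as_ sah; rewrite /a; nra.
have := f_lip (seg p q t) (seg p q s); rewrite segB enormZ -/(edist p q) -/l.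
have : `|t - s| * l <= h * l by rewrite ler_pM2r.
have rE : r = 2 * (h * l) by rewrite /r /h; field.
have mE : (24 * N%:R)^-1 * Num.max (f p) l <= h * l.
  have -> : h * l = (24 * N%:R)^-1 * (2 * l) by rewrite /h; field.
  by rewrite ler_wpM2l// ge_max (ltW fl)/=; lra.
move: fi; rewrite -/t rE; lra.
Qed.
End cost.
End segcost.

(** * From an admissible path to a chain with interior vertices in F *)

Section approx.
Context (R : realType) (d : nat).
Variables (f : 'rV[R]_d -> R) (beta : R).
Hypothesis f_ge0 : forall x, 0 <= f x.
Hypothesis f_lip : forall x y, f x <= f y + enorm (x - y).
Hypothesis beta_ge1 : 1 <= beta.
Let beta_ge0 : 0 <= beta. Proof. exact: le_trans beta_ge1. Qed.

Section curve.
Variables (F : set 'rV[R]_d) (gamma : R -> 'rV[R]_d) (L : R) (S Phi : R -> R).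
Hypothesis L_ge0 : 0 <= L.
Hypothesis F_closed : closed F.
Hypothesis gL : forall s t : R, 0 <= s <= 1 -> 0 <= t <= 1 ->
  enorm (gamma s - gamma t) <= L * `|s - t|.
Hypothesis arcS : forall a b, 0 <= a -> a <= b -> b <= 1 ->
  enorm (gamma b - gamma a) <= S b - S a.
Hypothesis arcPhi : forall a b c, 0 <= a -> a <= b -> b <= 1 -> 0 <= c ->
  (forall t, a <= t <= b -> c <= f (gamma t) `^ beta) ->
  c * (S b - S a) <= Phi b - Phi a.
Hypothesis arc_chord : forall a b, 0 <= a -> a < b -> b <= 1 ->
  gamma @` `]a, b[ `<=` ~` F ->
  exists2 u : 'rV[R]_d, enorm u = 1 &
    forall s t, a <= s -> s <= t -> t <= b -> gamma t - gamma s = (S t - S s) *: u.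

(** The path stays within L of its start and the points z of [gap] within another L of the path, so
    f <= M wherever it is evaluated. There f^beta has Lipschitz constant C1, and [E delta] bounds
    its variation over a distance 2 L delta. *)
Let M := f (gamma 0) + 2 * L.
Let C1 := beta * M `^ (beta - 1).
Let E (delta : R) := 2 * C1 * L * delta.

Let C1_ge0 : 0 <= C1. Proof. by rewrite mulr_ge0// powR_ge0. Qed.

Let S_nd a b : 0 <= a -> a <= b -> b <= 1 -> S a <= S b.
Proof.
by move=> a0 ab b1; rewrite -subr_ge0 (le_trans _ (arcS a0 ab b1))// enorm_ge0.
Qed.

Let Phi_nd a b : 0 <= a -> a <= b -> b <= 1 -> Phi a <= Phi b.
Proof.
move=> a0 ab b1; rewrite -subr_ge0.
have := @arcPhi a b 0 a0 ab b1 (lexx _); rewrite mul0r; apply => t _.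
exact: powR_ge0.
Qed.

Let E_ge0 delta : 0 <= delta -> 0 <= E delta.
Proof. by move=> d0; do 3![apply: mulr_ge0 => //]. Qed.

Let dist_gap a b delta t : 0 <= a -> b <= 1 -> a <= t <= b -> b - a <= delta ->
  enorm (gamma t - gamma a) <= L * delta.
Proof.
move=> a0 b1 /andP[at_ tb] ab; apply: le_trans (gL _ _) _; [lra|lra|].
by rewrite ler_wpM2l// ger0_norm ?subr_ge0//; lra.
Qed.

(* On a short time interval the integrand of the cost is nearly constant. *)
Let gap a b delta (z : 'rV[R]_d) : 0 <= a -> a <= b -> b <= 1 -> b - a <= delta ->
  delta <= 1 -> enorm (z - gamma a) <= L * delta ->
  f z `^ beta * (S b - S a) <= Phi b - Phi a + E delta * (S b - S a).
Proof.
move=> a0 ab b1 abd d1 za.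
have Ld : L * delta <= L by rewrite ler_piMr.
have a1 : a <= 1 := le_trans ab b1.
have fa : f (gamma a) <= f (gamma 0) + L.
  apply: (le_trans (f_lip _ (gamma 0))); rewrite lerD2l.
  apply: le_trans (gL _ _) _; [lra|lra|].
  by rewrite subr0 ger0_norm// ler_piMr.
have fz : f z <= M by have := f_lip z (gamma a); rewrite /M; lra.
have S0 : 0 <= S b - S a by rewrite subr_ge0 S_nd.
(* The lower bound on the weight is cut at 0 because [arcPhi] asks for a nonnegative constant. *)
pose c := Num.max 0 (f z `^ beta - E delta).
have c0 : 0 <= c by rewrite le_max lexx.
have cle t : a <= t <= b -> c <= f (gamma t) `^ beta.
  move=> tab; rewrite ge_max powR_ge0/= lerBlDr -lerBlDl.
  have tz : enorm (z - gamma t) <= 2 * L * delta.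
    apply: (le_trans (enorm_sub_triangle (gamma a) _ _)).
    have := dist_gap a0 b1 tab abd; rewrite enormB; lra.
  have ft : f (gamma t) <= M.
    have := f_lip (gamma t) (gamma a); have := dist_gap a0 b1 tab abd; rewrite /M; lra.
  apply: (le_trans (pow_f_sub_le f_ge0 f_lip beta_ge1 fz ft)).
  rewrite -/C1 /E (_ : 2 * C1 * L * delta = C1 * (2 * L * delta)); last by ring.
  exact: ler_wpM2l.
have := arcPhi a0 ab b1 c0 cle.
have : f z `^ beta - E delta <= c by rewrite le_max lexx orbT.
move=> h1 h2; have : (f z `^ beta - E delta) * (S b - S a) <= c * (S b - S a).
  exact: ler_wpM2r.
rewrite mulrBl; lra.
Qed.

(** Every point of the segment is within L delta of [gamma a], so [gap] bounds f^beta there by the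
    mean weight along the arc, up to [E delta]; and the chord is no longer than the arc. *)
Lemma segcost_gap a b delta : 0 <= a -> a <= b -> b <= 1 -> b - a <= delta ->
  delta <= 1 ->
  segcost f beta (gamma a) (gamma b) <= Phi b - Phi a + E delta * (S b - S a).
Proof.
move=> a0 ab b1 abd d1.
have d0 : 0 <= delta by apply: le_trans abd; rewrite subr_ge0.
set X := leRHS.
have X0 : 0 <= X.
  apply: addr_ge0; first by rewrite subr_ge0 Phi_nd.
  by apply: mulr_ge0; [exact: E_ge0|rewrite subr_ge0 S_nd].
have eS := arcS a0 ab b1; have e0 := enorm_ge0 (gamma b - gamma a).
have [S0|Sn0] := leP (S b - S a) 0.
  by rewrite /segcost /edist (_ : enorm _ = 0) ?mul0r//; lra.
rewrite /segcost /edist.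
apply: (@le_trans _ _ (enorm (gamma b - gamma a) * (X / (S b - S a)))).
  rewrite ler_wpM2l//.
  have := @prim_le _ _ (@seg_f_continuous _ _ _ _ f_ge0 f_lip beta_ge1 (gamma a) (gamma b))
    0 1 (X / (S b - S a)) (lexx _) ler01 (lexx _).
  rewrite prim0 !subr0 mulr1; apply => s /andP[s0 s1].
  rewrite ler_pdivlMr//; apply: gap => //.
  rewrite -[X in _ - X](seg0 _ (gamma b)) segB subr0 enormZ ger0_norm//.
  apply: (@le_trans _ _ (enorm (gamma b - gamma a))); first by rewrite ler_piMl.
  by apply: (dist_gap a0 b1 _ abd); rewrite ab lexx.
by rewrite mulrCA ler_piMr// ler_pdivrMr// mul1r.
Qed.

Lemma le_add_inv (X Y K : R) : 0 <= K -> (forall n : nat, X <= Y + K / n.+1%:R) ->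
  X <= Y.
Proof.
move=> K0 H; apply/ler_addgt0Pr => e e0.
have := archi_boundP (divr_ge0 K0 (ltW e0)); set n := Num.Def.archi_bound _ => nK.
apply: (le_trans (H n)); rewrite lerD2l ler_pdivrMr ?ltr0n// mulrC.
rewrite -ler_pdivrMr// (le_trans (ltW nK))// ler_nat//.
Qed.

(** Off F the path follows its chord, so no error term is left. Cutting [a, b] into n + 1 equal
    pieces and letting n grow replaces a change of variables along the reparametrisation [r], which
    may be constant on intervals. *)
Lemma segcost_chord a b : 0 <= a -> a <= b -> b <= 1 ->
  gamma @` `]a, b[ `<=` ~` F ->
  segcost f beta (gamma a) (gamma b) <= Phi b - Phi a.
Proof.
move=> a0; rewrite le_eqVlt => /predU1P[<- a1 _|ab b1 abF].
  by rewrite !subrr /segcost /edist subrr enorm0 mul0r.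
have [u u1 gu] := arc_chord a0 ab b1 abF.
have ab' := ltW ab.
have [S0|l0] := leP (S b - S a) 0.
  rewrite /segcost /edist (_ : enorm _ = 0) ?mul0r ?subr_ge0 ?Phi_nd//.
  by have := arcS a0 ab' b1; have := enorm_ge0 (gamma b - gamma a); lra.
set l := S b - S a in l0 *; have ln0 : l != 0 by rewrite gt_eqF.
pose r t := (S t - S a) / l.
have gr t : a <= t <= b -> gamma t = seg (gamma a) (gamma b) (r t).
  move=> /andP[at_ tb]; rewrite /seg (gu a b)// scalerA -/l divfK//.
  by rewrite -(gu a t)// addrC subrK.
have el : edist (gamma a) (gamma b) = l.
  by rewrite /edist (gu a b)// enormZ u1 mulr1 ger0_norm// ltW.
have rnd t t' : a <= t -> t <= t' -> t' <= b -> r t <= r t'.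
  by move=> at_ tt tb; rewrite ler_pM2r ?invr_gt0// lerB// S_nd//; lra.
have ra : r a = 0 by rewrite /r subrr mul0r.
have rb : r b = 1 by rewrite /r divff.
set Psi := prim (fun s => f (seg (gamma a) (gamma b) s) `^ beta).
have step t t' delta : a <= t -> t <= t' -> t' <= b -> t' - t <= delta -> delta <= 1 ->
    l * (Psi (r t') - Psi (r t)) <= Phi t' - Phi t + E delta * (S t' - S t).
  move=> at_ tt tb td d1.
  have t0 : 0 <= t by lra.
  have t1 : t' <= 1 by lra.
  have d0 : 0 <= delta by apply: le_trans td; rewrite subr_ge0.
  set X := leRHS.
  have X0 : 0 <= X.
    apply: addr_ge0; first by rewrite subr_ge0 Phi_nd.
    by apply: mulr_ge0; [exact: E_ge0|rewrite subr_ge0 S_nd].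
  have rr := rnd _ _ at_ tt tb.
  have [S0|Sn0] := leP (S t' - S t) 0.
    have SE : S t' = S t by apply/le_anti/andP; split; [lra|exact: S_nd].
    by rewrite /r SE subrr mulr0.
  have := @prim_le _ _ (@seg_f_continuous _ _ _ _ f_ge0 f_lip beta_ge1 (gamma a) (gamma b))
    (r t) (r t') (X / (S t' - S t)).
  rewrite -ra -rb -/Psi => H.
  apply: (@le_trans _ _ (l * (X / (S t' - S t) * (r t' - r t)))).
    rewrite ler_pM2l//; apply: H => //.
    - by apply: rnd => //; lra.
    - by apply: rnd => //; lra.
    move=> s /andP[s0 s1]; rewrite ler_pdivlMr//; apply: gap => //.
    rewrite (gr t) ?segB ?enormZ; last lra.
    rewrite ger0_norm ?subr_ge0// -/(edist _ _) el.
    apply: (@le_trans _ _ (enorm (gamma t' - gamma t))); last first.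
      by apply: (dist_gap t0 t1 _ td); rewrite tt lexx.
    rewrite (gu t t')// enormZ u1 mulr1 ger0_norm ?(ltW Sn0)//.
    have : (s - r t) * l <= (r t' - r t) * l by rewrite ler_pM2r// lerB.
    by rewrite -mulrBl opprB addrA subrK divfK.
  rewrite /r -mulrBl opprB addrA subrK le_eqVlt; apply/orP; left; apply/eqP.
  by field; rewrite ln0 gt_eqF.
have chain n j : (j <= n.+1)%N ->
    l * Psi (r (a + j%:R * ((b - a) / n.+1%:R))) <=
    Phi (a + j%:R * ((b - a) / n.+1%:R)) - Phi a +
      E ((b - a) / n.+1%:R) * (S (a + j%:R * ((b - a) / n.+1%:R)) - S a).
  have h0 : 0 <= (b - a) / n.+1%:R by rewrite divr_ge0// subr_ge0.
  elim: j => [_|j IH jn].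
    by rewrite mul0r addr0 ra /Psi prim0 !subrr !mulr0 addr0.
  have := IH (ltnW jn); set h := (b - a) / n.+1%:R in h0 *.
  set t := a + j%:R * h; set t' := a + j.+1%:R * h.
  have th : t' - t = h by rewrite /t' /t -natr1; ring.
  have := @step t t' h; rewrite th => H H1.
  have at_ : a <= t by rewrite lerDl mulr_ge0.
  have tt : t <= t' by lra.
  have tb : t' <= b.
    rewrite /t' -lerBrDl /h mulrA ler_pdivrMr ?ltr0n// mulrC ler_wpM2l ?subr_ge0//.
    by rewrite ler_nat.
  have h1 : h <= 1.
    rewrite /h ler_pdivrMr ?ltr0n// mul1r.
    have : 1 <= n.+1%:R :> R by rewrite ler1n.
    lra.
  have := H at_ tt tb (lexx _) h1.
  rewrite mulrBr; lra.
rewrite /segcost el -/Psi.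
apply: (@le_add_inv _ _ (2 * C1 * L * (b - a) * l)).
  apply: mulr_ge0; last exact: ltW.
  by apply: E_ge0; rewrite subr_ge0.
move=> n; have := chain n n.+1 (leqnn _).
have -> : a + n.+1%:R * ((b - a) / n.+1%:R) = b.
  by rewrite mulrC divfK ?pnatr_eq0// addrC subrK.
rewrite rb => /le_trans; apply.
by rewrite lerD2l -/l /E le_eqVlt; apply/orP; left; apply/eqP; ring.
Qed.

(** F is imposed on interior vertices only, since the ends of an admissible path may lie off F. *)
Definition reach (x : 'rV[R]_d) (c : R) := exists n (p : nat -> 'rV[R]_d),
  [/\ (0 < n)%N, p 0 = x /\ p n = gamma 1,
      (forall i, (0 < i < n)%N -> F (p i)) &
      \sum_(0 <= l < n) segcost f beta (p l) (p l.+1) <= c].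

Lemma reach1 x c : segcost f beta x (gamma 1) <= c -> reach x c.
Proof.
move=> xc; exists 1, (fun i => if i == 0 then x else gamma 1); split => //.
  by case => [//|[|i]] //.
by rewrite big_nat1.
Qed.

Lemma reach_cons x z c e : F z -> reach z c -> segcost f beta x z <= e ->
  reach x (e + c).
Proof.
move=> Fz [n [p [n0 [p0 pn] Fp sp]]] xz.
exists n.+1, (fun i => if i is j.+1 then p j else x); split => //.
  by case => [|[|i]]//= ni; [rewrite p0|apply: Fp].
rewrite big_nat_recl//= p0 lerD//.
Qed.

Let T := [set t : R | 0 <= t <= 1 /\ (F (gamma t) \/ t = 0 \/ t = 1)].

(** The part of T in [a, b] is compact because F is closed, so it has a first and a last element.
    The clamp appears because [gamma] is controlled on [0, 1] only. *)
Let T_min (a b : R) : 0 <= a -> a <= b -> b <= 1 ->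
  (exists2 t, T t & a <= t <= b) ->
  (exists2 t, T t /\ a <= t <= b & forall s, T s -> a <= s <= b -> t <= s) /\
  (exists2 t, T t /\ a <= t <= b & forall s, T s -> a <= s <= b -> s <= t).
Proof.
move=> a0 ab b1 [t0 Tt0 t0ab].
have cg := clamp01_lip_continuous L_ge0 gL.
have cT : compact (`[a, b] `&` ((gamma \o @clamp01 R) @^-1` F `|` [set 0] `|` [set 1])).
  apply: compact_closedI; first exact: segment_compact.
  apply: closedU; last exact: closed_eq.
  apply: closedU; last exact: closed_eq.
  by apply: closed_comp => // t _; exact: cg.
set A := (X in compact X) in cT.
have AE t : A t <-> T t /\ a <= t <= b.
  rewrite /A /T /= in_itv/=; split.
    move=> [tab H]; split=> //; split; first lra.
    by move: H; rewrite clamp01_id; [tauto|lra].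
  move=> [[t01 H] tab]; split=> //; move: H.
  by rewrite clamp01_id//; tauto.
have A0 : A !=set0 by exists t0; apply/AE.
have ci : {within A, continuous (@id R)} by apply: continuous_subspaceT => x; exact: cvg_id.
split.
  have [c cA cmin] := compact_EVT_min A0 cT ci.
  exists c; first by apply/AE; rewrite inE in cA.
  by move=> s Ts sab; apply: cmin; rewrite inE; apply/AE.
have [c cA cmax] := compact_EVT_max A0 cT ci.
exists c; first by apply/AE; rewrite inE in cA.
by move=> s Ts sab; apply: cmax; rewrite inE; apply/AE.
Qed.

Let T_F t : T t -> 0 < t -> t < 1 -> F (gamma t).
Proof. by move=> [_ [//|[->|->]]]; rewrite ltxx. Qed.

(* Times at which gamma is in F are visited with steps of at most delta; a larger
   gap between consecutive such times is a straight piece of gamma. *)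
Lemma reach_time (delta : R) (j : nat) (t : R) : 0 < delta -> delta <= 1 ->
  T t -> t < 1 -> 1 - j%:R * delta <= t ->
  reach (gamma t) (Phi 1 - Phi t + E delta * (S 1 - S t)).
Proof.
move=> d0 d1; elim: j t => [|j IH] t Tt t1 jt; first by lra.
have [/andP[t0 _] _] := Tt.
have [td|td] := leP 1 (t + delta).
  by apply: reach1; apply: segcost_gap => //; lra.
have T1 : T 1 by split; [lra|right; right].
(* s is the first time of T from t + delta on and t' the last one up to t + delta. The path takes a
   short step from t to t' and is off F between t' and s. *)
have [[s [Ts /andP[ds s1]] smin] _] := T_min (addr_ge0 t0 (ltW d0)) (ltW td) (lexx 1)
  (ex_intro2 _ _ 1 T1 (introT andP (conj (ltW td) (lexx 1)))).
have tdt : t <= t + delta by lra.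
have [_ [t' [Tt' /andP[tt' t'd]] t'max]] := T_min t0 tdt (ltW td)
  (ex_intro2 _ _ t Tt (introT andP (conj (lexx t) tdt))).
have t's : t' <= s by lra.
have chord : segcost f beta (gamma t') (gamma s) <= Phi s - Phi t'.
  have t'0 : 0 <= t' by lra.
  apply: (segcost_chord t'0 t's s1) => w [v /= + <-] Fv.
  rewrite in_itv/= => /andP[t'v vs].
  have Tv : T v by split; [lra|left].
  have [vd|dv] := leP v (t + delta).
    have : v <= t' by apply: t'max => //; rewrite vd andbT; lra.
    lra.
  have : s <= v by apply: smin => //; rewrite (ltW dv)/=; lra.
  lra.
have Snd : S t <= S t' by apply: S_nd; lra.
have Ed : 0 <= E delta by apply: E_ge0; lra.
have reach' : reach (gamma t') (Phi 1 - Phi t' + E delta * (S 1 - S t')).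
  have [s1'|s1'] := eqVneq s 1.
    apply: reach1; move: chord; rewrite s1'.
    have : 0 <= E delta * (S 1 - S t') by rewrite mulr_ge0// subr_ge0 S_nd//; lra.
    lra.
  have s1lt : s < 1 by rewrite lt_neqAle s1' s1.
  have Fs : F (gamma s) by apply: T_F => //; lra.
  (* s is later than t by at least delta, which pays for the decrease of j. *)
  have js : 1 - j%:R * delta <= s by move: jt; rewrite -natr1 mulrDl; lra.
  have [n [p [n0 pp Fp sp]]] := reach_cons Fs (IH s Ts s1lt js) chord.
  exists n, p; split => //; apply: (le_trans sp).
  have : E delta * (S 1 - S s) <= E delta * (S 1 - S t').
    by rewrite ler_wpM2l// lerB// S_nd//; lra.
  lra.
(* If t = t' there is no short step. Otherwise t' is neither 0 nor 1, so [gamma t'] lies in F and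
   may be an interior vertex. *)
have [->//|tt'n] := eqVneq t t'.
have Ft' : F (gamma t').
  by apply: T_F => //; [rewrite lt_neqAle in tt'n *; lra|lra].
have gp : segcost f beta (gamma t) (gamma t') <= Phi t' - Phi t + E delta * (S t' - S t).
  by apply: segcost_gap => //; lra.
have [n [p [n0 pp Fp sp]]] := reach_cons Ft' reach' gp.
exists n, p; split => //; apply: (le_trans sp).
by rewrite le_eqVlt; apply/orP; left; apply/eqP; ring.
Qed.

Lemma reach_start (eta : R) : 0 < eta -> reach (gamma 0) (Phi 1 - Phi 0 + eta).
Proof.
move=> eta0.
have S0 : 0 <= S 1 - S 0 by rewrite subr_ge0 S_nd.
pose K := 2 * C1 * L * (S 1 - S 0).
have K0 : 0 <= K by rewrite mulr_ge0// -[X in 0 <= X]mulr1 E_ge0.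
have := archi_boundP (divr_ge0 K0 (ltW eta0)); set n := Num.Def.archi_bound _ => nK.
have T0 : T 0 by split; [rewrite lexx ler01|right; left].
have n1 : 1 <= n.+1%:R :> R by rewrite ler1n.
have [||||m [p [m0 pp Fp sp]]] := @reach_time n.+1%:R^-1 n.+1 0 _ _ T0 _ _.
- by rewrite invr_gt0 ltr0n.
- by rewrite invf_le1// ltr0n.
- exact: ltr01.
- by rewrite divff ?subrr// pnatr_eq0.
exists m, p; split => //; apply: (le_trans sp); rewrite lerD2l.
rewrite /E mulrAC -/K ler_pdivrMr ?ltr0n// mulrC -ler_pdivrMr//.
by rewrite (le_trans (ltW nK))// ler_nat.
Qed.
End curve.
End approx.

(** * From a chain to an admissible path *)

Section polygon.
Context (R : realType) (d : nat).
Local Notation leb := (@lebesgue_measure R).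
Variables (n : nat) (p : nat -> 'rV[R]_d).
Hypothesis n_gt0 : (0 < n)%N.

(** The broken line visiting p i at time i / n: the i-th increment is switched on during
    [i / n, (i + 1) / n]. In this closed form the Lipschitz bound is obtained term by term, without
    gluing. *)
Definition polygon (t : R) : 'rV[R]_d :=
  p 0 + \sum_(0 <= i < n) clamp01 (n%:R * t - i%:R) *: (p i.+1 - p i).

Let n0 : 0 < n%:R :> R. Proof. by rewrite ltr0n. Qed.

Lemma clamp01_le0 (t : R) : t <= 0 -> clamp01 t = 0.
Proof. by case: (clamp01P t) => -[? ->]; lra. Qed.

Lemma clamp01_ge1 (t : R) : 1 <= t -> clamp01 t = 1.
Proof. by case: (clamp01P t) => -[? ->]; lra. Qed.

Lemma polygon_piece (i : nat) (t : R) : (i < n)%N ->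
  i%:R <= n%:R * t <= i%:R + 1 ->
  polygon t = seg (p i) (p i.+1) (n%:R * t - i%:R).
Proof.
move=> ni /andP[it ti]; rewrite /polygon /seg.
rewrite (big_cat_nat (n := i))//=; last exact: ltnW.
rewrite [X in _ + (_ + X)]big_ltn// clamp01_id; last lra.
rewrite (eq_big_nat _ _ (F2 := fun j => p j.+1 - p j)); last first.
  move=> j /andP[_ ji]; rewrite clamp01_ge1 ?scale1r//.
  have : j.+1%:R <= i%:R :> R by rewrite ler_nat.
  rewrite -natr1; lra.
rewrite telescope_sumr// [X in _ + (_ + (_ + X))]big_nat_cond big1 ?addr0.
  by rewrite addrA [p 0 + _]addrC subrK.
move=> j /andP[/andP[ij _] _]; rewrite clamp01_le0 ?scale0r//.
have : i.+1%:R <= j%:R :> R by rewrite ler_nat.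
rewrite -natr1; lra.
Qed.

Lemma polygon_vertex (i : nat) : (i <= n)%N -> polygon (i%:R / n%:R) = p i.
Proof.
rewrite leq_eqVlt => /predU1P[->|ni].
  have nE : n%:R = n.-1%:R + 1 :> R by rewrite natr1 prednK.
  rewrite divff ?gt_eqF// (@polygon_piece n.-1) ?prednK// mulr1; last lra.
  by rewrite nE addrAC subrr add0r seg1.
rewrite (@polygon_piece i)//; last by rewrite mulrC divfK ?gt_eqF//; lra.
by rewrite mulrC divfK ?gt_eqF// subrr seg0.
Qed.

Lemma enorm_sum (I : Type) (r : seq I) (P : pred I) (F : I -> 'rV[R]_d) :
  enorm (\sum_(i <- r | P i) F i) <= \sum_(i <- r | P i) enorm (F i).
Proof.
elim/big_rec2 : _ => [|i y x _ xy]; first by rewrite enorm0.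
by apply: (le_trans (enormD _ _)); rewrite lerD2l.
Qed.

Lemma polygon_rectifiable : rectifiable polygon.
Proof.
exists (\sum_(0 <= i < n) n%:R * enorm (p i.+1 - p i)) => s t _ _.
rewrite /polygon opprD addrACA subrr add0r -sumrB mulr_suml.
apply: (le_trans (enorm_sum _ _ _)); apply: ler_sum => i _.
rewrite -scalerBl enormZ mulrAC ler_wpM2r ?enorm_ge0//.
apply: (le_trans (clamp01_dist _ _)).
by rewrite opprB addrA subrK -mulrBr normrM ger0_norm.
Qed.

Lemma derive1_affine (g : R -> 'rV[R]_d) (A B : 'rV[R]_d) (t : R) :
  (\forall s \near t, g s = A + s *: B) -> derive1 g t = B.
Proof.
move=> gAB; rewrite derive1E -(near_eq_derive (f := fun s : R => A + s *: B)); last first.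
  by apply: filterS gAB => s ->.
apply/cvg_lim => //; apply: (@cvg_trans _ (cst B @ (0 : R)^')); last exact: cvg_cst.
apply: near_eq_cvg; near=> h => /=.
have -> : h *: (1 : R) = h by exact: mulr1.
rewrite opprD addrACA subrr add0r -scalerBl addrK scalerA mulVf ?scale1r//.
by near: h; exact: nbhs_dnbhs_neq.
Unshelve. all: by end_near. Qed.

Lemma polygon_derive (i : nat) (t : R) : (i < n)%N ->
  i%:R < n%:R * t < i%:R + 1 -> derive1 polygon t = n%:R *: (p i.+1 - p i).
Proof.
move=> ni /andP[it ti].
apply: (@derive1_affine _ (p i - i%:R *: (p i.+1 - p i))).
have it' : i%:R / n%:R < t by rewrite ltr_pdivrMr// mulrC.
have ti' : t < (i%:R + 1) / n%:R by rewrite ltr_pdivlMr// mulrC.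
near=> s; rewrite (@polygon_piece i)//.
  by rewrite /seg scalerBl scalerA addrCA addrC mulrC.
apply/andP; split.
  rewrite [leRHS]mulrC -ler_pdivrMr//; near: s.
  by apply: filterS (lt_nbhsr it') => y /ltW.
rewrite [leLHS]mulrC -ler_pdivlMr//; near: s.
by apply: filterS (lt_nbhsl ti') => y /ltW.
Unshelve. all: by end_near. Qed.

(** At the times i / n with 0 < i < n the path is in F, so an open interval of times sent off F
    contains none of them and lies within one piece. *)
Lemma polygon_straight (F : set 'rV[R]_d) : (0 < d)%N ->
  (forall i, (0 < i < n)%N -> F (p i)) -> straight_outside F polygon.
Proof.
move=> d0 Fp a b a0 ab b1 abF.
have [i iP imax] : exists2 i : nat, i%:R / n%:R <= a & a < (i.+1)%:R / n%:R.
  exists (Num.truncn (n%:R * a)).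
    by rewrite ler_pdivrMr// mulrC truncn_le// mulr_ge0.
  by rewrite ltr_pdivlMr// mulrC truncnS_gt.
have ni : (i < n)%N.
  rewrite -(ltr_nat R) -[ltRHS]mul1r -ltr_pdivrMr//.
  exact: (le_lt_trans iP (lt_le_trans ab b1)).
have bi : b <= i.+1%:R / n%:R.
  rewrite leNgt; apply/negP => ib.
  have ni1 : (i.+1 < n)%N.
    by rewrite -(ltr_nat R) -[ltRHS]mul1r -ltr_pdivrMr// (lt_le_trans ib).
  apply: (abF (p i.+1)); last exact: Fp.
  exists (i.+1%:R / n%:R) => /=; last by rewrite polygon_vertex// ltnW.
  by rewrite in_itv/= imax ib.
set D := p i.+1 - p i.
have dE t : t \in `]a, b[ -> derive1 polygon t = n%:R *: D.
  rewrite in_itv/= => /andP[at_ tb]; apply: polygon_derive => //.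
  have it := le_lt_trans iP at_; have ti := lt_le_trans tb bi.
  by move: it ti; rewrite ltr_pdivrMr// ltr_pdivlMr// natr1 [t * _]mulrC => -> ->.
(* On a piece reduced to a point any unit vector serves; one exists because d > 0. *)
have [D0|D0] := eqVneq (enorm D) 0.
  exists (delta_mx ord0 (Ordinal d0)); first exact: enorm_delta.
  move=> t tab _; rewrite /speed dE//.
  by rewrite (enorm_eq0 D0) scaler0 enorm0 scale0r.
exists ((enorm D)^-1 *: D).
  by rewrite enormZ ger0_norm ?invr_ge0 ?enorm_ge0// mulVf.
move=> t tab _; rewrite /speed dE// enormZ ger0_norm// scalerA.
by rewrite mulfK.
Qed.

Section cost.
Variables (f : 'rV[R]_d -> R) (beta : R).
Hypothesis f_ge0 : forall x, 0 <= f x.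
Hypothesis f_lip : forall x y, f x <= f y + enorm (x - y).
Hypothesis beta_ge1 : 1 <= beta.

Let h t := (f (polygon t) `^ beta * speed polygon t)%:E.

(** Inside a piece the derivative is constant, and the substitution s = n t - i maps the piece onto
    the unit interval. Measurability is obtained piece by piece because [derive1] is not controlled
    at the vertices. *)
Lemma polygon_cost_piece (i : nat) : (i < n)%N ->
  let a : R := i%:R / n%:R in let b : R := i.+1%:R / n%:R in
  measurable_fun (`]a, b[%classic : set R) h /\
  (\int[leb]_(t in `]a, b[) h t = (segcost f beta (p i) (p i.+1))%:E)%E.
Proof.
move=> ni a b.
pose G s := f (seg (p i) (p i.+1) s) `^ beta.
have cG : continuous G by exact: seg_f_continuous.
pose e := edist (p i) (p i.+1).
pose A (t : R) := n%:R * t - i%:R.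
have ab : a < b by rewrite ltr_pM2r ?invr_gt0// ltr_nat.
have cA : continuous A.
  by move=> t; apply: cvgB; [apply: cvgM; [exact: cvg_cst|exact: cvg_id]|exact: cvg_cst].
have cGA : continuous (G \o A).
  by move=> t; apply: continuous_comp; [exact: cA|exact: cG].
have hE t : t \in `]a, b[ -> h t = (e%:E * (n%:R * G (A t))%:E)%E.
  rewrite in_itv/= => /andP[at_ tb].
  have it : i%:R < n%:R * t < i%:R + 1.
    by move: at_ tb; rewrite ltr_pdivrMr// ltr_pdivlMr// natr1 [t * _]mulrC => -> ->.
  rewrite /h /speed (@polygon_derive i)// (@polygon_piece i)//; last lra.
  by rewrite enormZ ger0_norm// -EFinM -/(edist _ _) -/e -/(A t) -/(G (A t)); congr EFin; ring.
have mh : measurable_fun (`]a, b[%classic : set R) h.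
  apply: (eq_measurable_fun (fun t => e%:E * (n%:R * G (A t))%:E)%E).
    by move=> t; rewrite inE => tab; rewrite hE.
  apply/measurable_EFinP; apply: measurable_funM => //.
  apply: measurable_funM => //; apply: measurable_funTS.
  exact: continuous_measurable_fun.
split => //.
transitivity (\int[leb]_(t in `]a, b[) (e%:E * (n%:R * G (A t))%:E))%E.
  by apply: eq_integral => t; rewrite inE => tab; rewrite hE.
have a0 : 0 <= a by rewrite divr_ge0.
have G0 t : 0 <= G t by exact: powR_ge0.
rewrite ge0_integralZl//; last 3 first.
- apply/measurable_EFinP; apply: measurable_funM => //; apply: measurable_funTS.
  exact: continuous_measurable_fun.
- by move=> t _; rewrite lee_fin mulr_ge0.
- by rewrite lee_fin enorm_ge0.
rewrite /segcost EFinM; congr (_ * _)%E.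
have dA (t : R) : is_derive t 1 A n%:R.
  rewrite /A; apply: is_derive_eq.
  by rewrite subr0 scaler1 /GRing.scale/= ?mulr1.
have A'E : derive1 A = cst n%:R.
  by apply/funext => t; rewrite derive1E derive_val.
have Aa : A a = 0 by rewrite /A /a mulrC divfK ?gt_eqF// subrr.
have Ab : A b = 1.
  by rewrite /A /b mulrC divfK ?gt_eqF// -natr1 addrAC subrr add0r.
have iG : leb.-integrable `]0, 1[ (EFin \o G).
  by apply: integrable_itv_sub => //; exact: continuous_integrable01.
transitivity (\int[leb]_(t in `[0%R, 1%R]) (G t)%:E)%E; last first.
  rewrite /prim /Rintegral fineK; last exact: integrable_fin_num.
  rewrite (@integral_itv_bndoo _ 0 1)//.
  by case/integrableP : iG.
have := @integration_by_substitution_increasing R A G a b (ltW ab).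
rewrite Aa Ab A'E => ->.
- rewrite (@integral_itv_bndoo _ a b)//; last first.
    apply/measurable_EFinP; apply: measurable_funM => //; apply: measurable_funTS.
    exact: continuous_measurable_fun.
  by apply: eq_integral => t _; rewrite /= mulrC.
- by move=> s t _ _ st; rewrite /A ltrD2r ltr_pM2l.
- by move=> t _; exact: cvg_cst.
- exact: is_cvg_cst.
- exact: is_cvg_cst.
- split.
  + by move=> t _; case: (dA t).
  + by apply: cvg_at_right_filter; exact: cA.
  + by apply: cvg_at_left_filter; exact: cA.
- exact: continuous_subspaceT.
Qed.

Lemma polygon_cost : (\int[leb]_(t in `[0%R, 1%R]) h t =
  (\sum_(0 <= i < n) segcost f beta (p i) (p i.+1))%:E)%E.
Proof.
have h0 t : (0 <= h t)%E by rewrite lee_fin mulr_ge0 ?powR_ge0// enorm_ge0.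
have H j : (j <= n)%N -> measurable_fun (`[0, j%:R / n%:R[%classic : set R) h /\
    (\int[leb]_(t in `[0%R, (j%:R / n%:R)%R[) h t =
      (\sum_(0 <= i < j) segcost f beta (p i) (p i.+1))%:E)%E.
  elim: j => [_|j IH jn].
    rewrite mul0r set_itvco0; split; first exact: measurable_fun_set0.
    by rewrite integral_set0 big_geq.
  have [mj Ej] := IH (ltnW jn); have [mp Ep] := polygon_cost_piece jn.
  set a : R := j%:R / n%:R in mj Ej mp Ep *; set b : R := j.+1%:R / n%:R in mp Ep *.
  have a0 : 0 <= a by rewrite divr_ge0.
  have ab : a < b by rewrite ltr_pM2r ?invr_gt0// ltr_nat.
  have mp' : measurable_fun (`[a, b[%classic : set R) h.
    by apply/emeasurable_fun_itv_obnd_cbndP.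
  have U : `[0, b[%classic = `[0, a[ `|` `[a, b[ :> set R.
    by apply: itv_bndbnd_setU; rewrite ?bnd_simp// ltW.
  have mU : measurable_fun (`[0, a[ `|` `[a, b[ : set R) h.
    by apply/measurable_funU.
  rewrite U; split => //.
  rewrite ge0_integral_setU//; last first.
    rewrite disj_set2E; apply/eqP; rewrite -subset0 => x []/=.
    by rewrite !in_itv/= => /andP[_ xa] /andP[ax _]; rewrite ltNge ax in xa.
  rewrite big_nat_recr//= EFinD -Ej -Ep; congr (_ + _)%E.
  exact: integral_itv_bndoo.
have [m1 E1] := H n (leqnn n); rewrite divff ?gt_eqF// in m1 E1.
by rewrite -E1 integral_itv_bndo_bndc.
Qed.
End cost.
End polygon.

(** * Quantile functions of bounded random variables *)

Section quantile.
Context (R : realType) (dO : measure_display) (Om : measurableType dO).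
Local Notation leb := (@lebesgue_measure R).
Variables (P : probability Om R) (Z : Om -> R) (R0 : R).
Hypothesis mZ : measurable_fun setT Z.
Hypothesis Z_ge0 : forall w, 0 <= Z w.
Hypothesis R0_gt0 : 0 < R0.
Hypothesis Z_bnd : P [set w | Z w < R0] = 1%E.

(** For Z the distance to x under mu this is [delta mu u x]. An arbitrary probability space is
    allowed so that two measures can be compared on the space of a coupling. *)
Definition quantile (u : R) : \bar R :=
  ereal_inf [set r%:E | r in [set r | 0 < r /\ (u%:E < P [set w | (Z w < r)%R])%E]].

Let mball r : measurable [set w | Z w < r].
Proof.
rewrite (_ : [set w | _] = setT `&` Z @^-1` `]-oo, r[); last first.
  by apply/seteqP; split => w /=; rewrite in_itv/= ?andbT//; case.
exact: mZ.
Qed.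

Let G_nd r s : r <= s -> (P [set w | (Z w < r)%R] <= P [set w | (Z w < s)%R])%E.
Proof.
move=> rs; apply: le_measure; rewrite ?inE// => w /= /lt_le_trans; exact.
Qed.

Lemma quantile_ge0 u : (0 <= quantile u)%E.
Proof. by apply: le_ereal_inf_tmp => _ [r [r0 _] <-]; rewrite lee_fin ltW. Qed.

Lemma quantile_le u : u < 1 -> (quantile u <= R0%:E)%E.
Proof. by move=> u1; apply: ereal_inf_lbound; exists R0 => //=; rewrite Z_bnd lte_fin. Qed.

Lemma quantile_fin u : u < 1 -> quantile u \is a fin_num.
Proof.
move=> u1; rewrite ge0_fin_numE ?quantile_ge0//.
by rewrite (le_lt_trans (quantile_le u1))// ltry.
Qed.

Lemma quantile_nd u v : u <= v -> (quantile u <= quantile v)%E.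
Proof.
move=> uv; apply: ereal_inf_le_tmp => _ [r [r0 vr] <-]; exists r => //; split => //.
by rewrite (le_lt_trans _ vr)// lee_fin.
Qed.

(* Strictness on both sides comes from the left continuity of r |-> P (Z < r). *)
Lemma quantile_ltP u r : 0 <= u ->
  (quantile u < r%:E)%E <-> (u%:E < P [set w | (Z w < r)%R])%E.
Proof.
move=> u0; split.
  move=> /ereal_inf_lt[_ [s [s0 us] <-]]; rewrite lte_fin => sr.
  by apply: (lt_le_trans us); apply: G_nd; exact: ltW.
move=> ur.
have r0 : 0 < r.
  rewrite ltNge; apply/negP => r0; move: ur.
  rewrite (_ : [set w | _] = set0) ?measure0 ?lte_fin ?ltNge ?u0//.
  by apply/seteqP; split => w //=; have := Z_ge0 w; lra.
pose A n := [set w | Z w < r - n.+1%:R^-1].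
have mA n : measurable (A n) by exact: mball.
have : (P \o A) n @[n --> \oo] --> P (\bigcup_n A n).
  apply: nondecreasing_cvg_mu => //; first exact: bigcup_measurable.
  move=> i j ij; apply/subsetPset => w /= /lt_le_trans; apply.
  by rewrite lerB// lef_pV2 ?posrE ?ltr0n// ler_nat.
have -> : \bigcup_n A n = [set w | Z w < r].
  apply/seteqP; split => w /=.
    by move=> [n _ /= /lt_le_trans]; apply; rewrite gerBl invr_ge0.
  by move=> /ltr_add_invr[k kr]; exists k => //=; rewrite /A/= ltrBrDr.
move=> cA.
have [n un] : exists n, (u%:E < P (A n))%E.
  apply: contrapT => no; have : (P [set w | (Z w < r)%R] <= u%:E)%E.
    rewrite -(cvg_lim _ cA)//; apply: lime_le; first by apply/cvg_ex; eexists; exact: cA.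
    apply: nearW => n; rewrite leNgt; apply/negP => un; apply: no; by exists n.
  by rewrite leNgt ur.
apply: (@le_lt_trans _ _ (r - n.+1%:R^-1)%:E); last by rewrite lte_fin gtrBl invr_gt0.
apply: ereal_inf_lbound; exists (r - n.+1%:R^-1) => //; split => //.
rewrite ltNge; apply/negP => r0'; move: un.
rewrite /A (_ : [set w | _] = set0) ?measure0 ?lte_fin ?ltNge ?u0//.
rewrite -subset0 => w /lt_le_trans/(_ r0')/(le_lt_trans (Z_ge0 w)).
by rewrite ltxx.
Qed.

(* Cut to 0 from u = 1 on, where the infimum defining the quantile is over the
   empty set. *)
Definition rquantile (u : R) : R := if 0 <= u < 1 then fine (quantile u) else 0.

Lemma rquantileE u : 0 <= u < 1 -> (rquantile u)%:E = quantile u.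
Proof.
by move=> u01; rewrite /rquantile u01 fineK// quantile_fin//; case/andP: u01.
Qed.

Lemma rquantile_ge0 u : 0 <= rquantile u.
Proof. by rewrite /rquantile; case: ifP => // _; rewrite fine_ge0// quantile_ge0. Qed.

Lemma rquantile_le u : rquantile u <= R0.
Proof.
have [u01|u01] := boolP (0 <= u < 1); last by rewrite /rquantile (negbTE u01) ltW.
by rewrite -lee_fin rquantileE// quantile_le//; case/andP: u01.
Qed.

Lemma rquantile_nd u v : 0 <= u -> u <= v -> v < 1 -> rquantile u <= rquantile v.
Proof.
move=> u0 uv v1; rewrite -lee_fin !rquantileE ?quantile_nd ?u0 ?v1 ?andbT//.
  exact: le_trans uv.
exact: le_lt_trans v1.
Qed.

(** Hence, under the uniform law on [0, 1[, the quantile function falls below r with the same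
    probability as Z. *)
Lemma rquantile_preimage r :
  `[0, 1[ `&` rquantile @^-1` `]-oo, r[ = `[0, fine (P [set w | Z w < r])[%classic.
Proof.
have Pf : P [set w | Z w < r] \is a fin_num by exact: fin_num_measure.
apply/seteqP; split => u /=; rewrite !in_itv/= ?andbT.
  move=> [u01]; rewrite -lte_fin rquantileE// => ur; case/andP: (u01) => u0 _.
  by rewrite u0/= -lte_fin fineK//; apply/quantile_ltP.
move=> /andP[u0 ur].
have u01 : 0 <= u < 1.
  rewrite u0/= (lt_le_trans ur)// -lee_fin fineK//; exact: probability_le1.
split => //; rewrite -lte_fin rquantileE//; apply/quantile_ltP => //.
by rewrite -[P _]fineK.
Qed.

Let mpre r : measurable (rquantile @^-1` `]-oo, r[).
Proof.
have -> : rquantile @^-1` `]-oo, r[ = (`[0, 1[ `&` rquantile @^-1` `]-oo, r[) `|`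
   ((~` `[0, 1[) `&` [set u | 0 < r]).
  apply/seteqP; split => u /=; rewrite !in_itv/= ?andbT.
    by rewrite /rquantile; case: ifPn => [? ?|/negP ? ?]; [left|right].
  move=> [[//]|[/negP u01 r0]]; by rewrite /rquantile (negbTE u01).
rewrite rquantile_preimage; apply: measurableU; first exact: measurable_itv.
apply: measurableI; first by apply: measurableC; exact: measurable_itv.
have [r0|r0] := ltP 0 r.
  rewrite (_ : [set _ | _] = setT)//; by apply/seteqP; split.
by rewrite (_ : [set _ | _] = set0)//; apply/seteqP; split => // u /=.
Qed.

Lemma measurable_rquantile : measurable_fun setT rquantile.
Proof.
apply: (measurability _ (RGenInftyO.measurableE R)) => // _ [_ [r ->] <-].
by rewrite setTI; exact: mpre.
Qed.

(** The law of Z and that of its quantile function under the uniform law agree on the half-lines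
    []-oo, r[], which are stable under intersection, hence on all Borel sets. *)
Lemma integral_rquantile (phi : R -> \bar R) : measurable_fun setT phi ->
  (forall r, (0 <= phi r)%E) ->
  (\int[P]_w phi (Z w) = \int[leb]_(u in `[0%R, 1%R[) phi (rquantile u))%E.
Proof.
move=> mphi phi0.
have m01 : measurable (`[0%R, 1%R[%classic : set (measurableTypeR R)).
  exact: measurable_itv.
have mZ' : @measurable_fun _ _ Om (measurableTypeR R) setT Z by exact: mZ.
have mq' : @measurable_fun _ _ (measurableTypeR R) (measurableTypeR R) setT rquantile.
  exact: measurable_rquantile.
pose nu : {measure set (measurableTypeR R) -> \bar R} := mrestr leb m01.
pose pushZ : {measure set (measurableTypeR R) -> \bar R} :=
  pushforward P (Z : Om -> measurableTypeR R).
pose pushq : {measure set (measurableTypeR R) -> \bar R} :=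
  pushforward nu (rquantile : measurableTypeR R -> measurableTypeR R).
pose m1 := pushZ mZ'; pose m2 := pushq mq'.
have m12 (A : set (measurableTypeR R)) : measurable A -> m1 A = m2 A.
  move=> mA.
  have mu := @measure_unique _ R (measurableTypeR R) (@RGenInftyO.G R)
    (fun k => `]-oo, k%:R[%classic) _ _ _ _ m1 m2.
  apply: mu mA => //.
  - exact: RGenInftyO.measurableE.
  - move=> _ _ [x ->] [y ->]; exists (Num.min x y).
    by apply/seteqP; split => z /=; rewrite !in_itv/= lt_min => /andP.
  - by move=> k; exists k%:R.
  - apply/seteqP; split => // x _; exists (Num.truncn `|x|).+1 => //=.
    by rewrite in_itv/= (le_lt_trans (ler_norm x))// truncnS_gt.
  - move=> _ [r ->].
    have -> : m1 `]-oo, r[%classic = P [set w | Z w < r].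
      by congr (P _); apply/seteqP; split => w /=; rewrite in_itv.
    have -> : m2 `]-oo, r[%classic = leb (`[0, fine (P [set w | Z w < r])[%classic).
      by rewrite -rquantile_preimage setIC.
    rewrite lebesgue_measure_itv/= lte_fin.
    have Pf : P [set w | Z w < r] \is a fin_num by exact: fin_num_measure.
    case: ltP => [_|P0]; first by rewrite sube0 fineK.
    by apply/eqP; rewrite eq_le measure_ge0 andbT -[P _]fineK.
  - move=> k; have -> : m1 `]-oo, k%:R[%classic = P [set w | Z w < k%:R].
      by congr (P _); apply/seteqP; split => w /=; rewrite in_itv.
    by apply: (@le_lt_trans _ _ 1%E); [exact: probability_le1|rewrite ltry].
transitivity (\int[m1]_z phi z)%E.
  by rewrite (ge0_integral_pushforward mZ').
rewrite (eq_measure_integral m2) => [|A mA _]; last exact: m12.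
rewrite (ge0_integral_pushforward mq')// preimage_setT.
have mN : measurable (~` `[0%R, 1%R[%classic : set (measurableTypeR R)).
  exact: measurableC.
rewrite (@ge0_negligible_integral _ _ _ nu _ (~` `[0, 1[%classic))//; first last.
- by rewrite /nu/= /mrestr setICl measure0.
- by move=> u _; exact: phi0.
- exact: (measurableT_comp mphi measurable_rquantile).
rewrite setTD setCK.
apply: eq_measure_integral => A mA A01.
by rewrite /nu/= /mrestr setIidl.
Qed.
End quantile.

(** * Minkowski's inequality from convexity *)

Section powR_minkowski.
Context (R : realType) (p : R).
Hypothesis p_ge1 : 1 <= p.
Let p_gt0 : 0 < p. Proof. exact: lt_le_trans p_ge1. Qed.

(* Convexity of x^p at a + b = (1 - t) (a / (1 - t)) + t (b / t); powR_barycenter is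
   the equality case t = b / (a + b). *)
Lemma powR_add_le (a b t : R) : 0 <= a -> 0 <= b -> 0 < t -> t < 1 ->
  (a + b) `^ p <= (1 - t) `^ (1 - p) * a `^ p + t `^ (1 - p) * b `^ p.
Proof.
move=> a0 b0 t0 t1.
have s0 : 0 < 1 - t by lra.
have H (s c : R) : 0 < s -> 0 <= c -> s `^ (1 - p) * c `^ p = s * (c / s) `^ p.
  move=> s1 c0; rewrite powRM ?invr_ge0 ?(ltW s1)// -powR_inv1 ?(ltW s1)//.
  rewrite -powRrM mulN1r mulrCA mulrC; congr (_ * _).
  rewrite -{2}(powRr1 (ltW s1)) -powRD//.
  by apply/implyP => _; rewrite gt_eqF.
rewrite !H// [leRHS]addrC.
have -> : a + b = t * (b / t) + (1 - t) * (a / (1 - t)).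
  by field; rewrite !gt_eqF.
have := @convex_powR R p p_ge1 (Itv01 (ltW t0) (ltW t1)) (b / t) (a / (1 - t)).
rewrite !inE/= !in_itv/= !andbT !divr_ge0 ?(ltW t0) ?(ltW s0)// => /(_ isT isT).
by rewrite !convRE.
Qed.

Lemma powR_barycenter (a b : R) : 0 < a -> 0 < b ->
  (a / (a + b)) `^ (1 - p) * a `^ p + (b / (a + b)) `^ (1 - p) * b `^ p =
  (a + b) `^ p.
Proof.
move=> a0 b0; have : 0 < a + b by rewrite addr_gt0.
move cE : (a + b) => c c0.
have S (x : R) : 0 < x -> (x / c) `^ (1 - p) * x `^ p = x * c `^ (p - 1).
  move=> x0; rewrite powRM ?invr_ge0 ?(ltW x0) ?(ltW c0)//.
  rewrite -powR_inv1 ?(ltW c0)// -powRrM mulN1r opprB mulrAC.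
  rewrite -powRD; last by rewrite (gt_eqF x0) implybT.
  by rewrite subrK powRr1 ?(ltW x0).
rewrite (S _ a0) (S _ b0) -mulrDl cE -{1}(powRr1 (ltW c0)) -powRD ?subrKC//.
by rewrite (gt_eqF c0) implybT.
Qed.

Lemma le_powR_of_root_le (x c : R) : 0 <= x -> x `^ p^-1 <= c -> x <= c `^ p.
Proof.
move=> x0 xc; have c0 : 0 <= c by apply: le_trans xc; exact: powR_ge0.
have pp : p^-1 * p = 1 by rewrite mulVf// gt_eqF.
rewrite -[leLHS](powRr1 x0) -pp powRrM.
by apply: ge0_ler_powR; rewrite ?nnegrE ?powR_ge0// ltW.
Qed.

Lemma root_le_of_le_powR (x c : R) : 0 <= x -> 0 <= c -> x <= c `^ p -> x `^ p^-1 <= c.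
Proof.
move=> x0 c0 xc; have pp : p * p^-1 = 1 by rewrite divff// gt_eqF.
rewrite -[leRHS](powRr1 c0) -pp powRrM.
by apply: ge0_ler_powR; rewrite ?nnegrE ?powR_ge0// invr_ge0 ltW.
Qed.

(** With a and b the p-th roots of J2 and e, the best parameter is t = b / (a + b). Enlarging both
    roots by eta / 2 makes them positive, so that t is in ]0, 1[. *)
Lemma minkowski_of_convex (J1 J2 e : R) : 0 <= J1 -> 0 <= J2 -> 0 <= e ->
  (forall t, 0 < t -> t < 1 -> J1 <= (1 - t) `^ (1 - p) * J2 + t `^ (1 - p) * e) ->
  J1 `^ p^-1 <= J2 `^ p^-1 + e `^ p^-1.
Proof.
move=> J10 J20 e0 H; apply/ler_addgt0Pr => eta eta0.
have eta2 : 0 < eta / 2 by rewrite divr_gt0.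
move aE : (J2 `^ p^-1 + eta / 2) => a; move bE : (e `^ p^-1 + eta / 2) => b.
have a0 : 0 < a by rewrite -aE ltr_wpDl ?powR_ge0.
have b0 : 0 < b by rewrite -bE ltr_wpDl ?powR_ge0.
have Ja : J2 <= a `^ p by apply: le_powR_of_root_le => //; rewrite -aE lerDl ltW.
have eb : e <= b `^ p by apply: le_powR_of_root_le => //; rewrite -bE lerDl ltW.
have ab0 : 0 < a + b by rewrite addr_gt0.
have t1 : b / (a + b) < 1 by rewrite ltr_pdivrMr// mul1r ltrDr.
have := H _ (divr_gt0 b0 ab0) t1.
have -> : 1 - b / (a + b) = a / (a + b) by field; rewrite gt_eqF.
move=> J1le; have {J1le} : J1 <= (a + b) `^ p.
  apply: (le_trans J1le); rewrite -(powR_barycenter a0 b0).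
  by apply: lerD; apply: ler_wpM2l; first [exact: powR_ge0|exact: Ja|exact: eb].
move=> /(root_le_of_le_powR J10 (ltW ab0)) /le_trans; apply.
by rewrite -aE -bE le_eqVlt; apply/orP; left; apply/eqP; field.
Qed.
End powR_minkowski.

(** * Moments of truncated quantile functions *)

Section quantile_moment.
Context (R : realType) (dO : measure_display) (Om : measurableType dO).
Local Notation leb := (@lebesgue_measure R).
Variables (P : probability Om R) (m p : R).
Hypothesis m_gt0 : 0 < m.
Hypothesis m_le1 : m <= 1.
Hypothesis p_ge1 : 1 <= p.
Let p_gt0 : 0 < p. Proof. exact: lt_le_trans p_ge1. Qed.

(** For Z the distance to x, m times the p-th power of the distance to measure. The interval is open
    at m because m = 1 is allowed and the quantile is cut there. *)
Definition qmoment (Z : Om -> R) : \bar R :=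
  (\int[leb]_(u in `[0%R, m[) (rquantile P Z u `^ p)%:E)%E.

Definition bounded_rv (Z : Om -> R) (r : R) := [/\ measurable_fun setT Z,
  (forall w, 0 <= Z w), 0 < r & P [set w | Z w < r] = 1%E].

Let sub01 : (`[0%R, m[%classic : set R) `<=` `[0%R, 1%R[%classic.
Proof. by apply: subset_itvl; rewrite bnd_simp. Qed.

Let mq Z r : bounded_rv Z r -> measurable_fun setT (rquantile P Z).
Proof. by case=> mZ Z0 r0 Zr; exact: (measurable_rquantile mZ Z0 r0 Zr). Qed.

Let mphi (q : R -> R) (l A : R) : measurable_fun setT q ->
  measurable_fun setT (fun u => (Num.max 0 (l - A * q u `^ p))%:E).
Proof.
move=> mq_; apply/measurable_EFinP; apply: measurable_maxr => //.
apply: measurable_funB => //; apply: measurable_funM => //.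
by apply: (measurableT_comp (measurable_powR p)).
Qed.

Let mpow (q : R -> R) : measurable_fun setT q ->
  measurable_fun setT (fun u => (q u `^ p)%:E).
Proof.
move=> mq_; apply/measurable_EFinP; exact: (measurableT_comp (measurable_powR p)).
Qed.

Let integral_cut (g : R -> \bar R) : measurable_fun setT g ->
  (forall u, (0 <= g u)%E) -> (forall u, m <= u -> u < 1 -> g u = 0%E) ->
  (\int[leb]_(u in `[0%R, 1%R[) g u = \int[leb]_(u in `[0%R, m[) g u)%E.
Proof.
move=> mg g0 gm; have U : (`[0%R, 1%R[%classic : set R) = `[0%R, m[ `|` `[m, 1%R[.
  by apply: itv_bndbnd_setU; rewrite ?bnd_simp// ltW.
rewrite U ge0_integral_setU//.
- rewrite [X in (_ + X)%E]integral0_eq ?adde0// => u /=.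
  by rewrite in_itv/= => /andP[mu u1]; exact: gm.
- exact: measurable_funTS.
- rewrite disj_set2E; apply/eqP; rewrite -subset0 => x []/=.
  by rewrite !in_itv/= => /andP[_ xm] /andP[mx _]; rewrite ltNge mx in xm.
Qed.

Let cut_cst (l : R) : (\int[leb]_(u in `[0%R, m[) l%:E = (l * m)%:E)%E.
Proof. by rewrite integral_cst//= lebesgue_measure_itv/= lte_fin m_gt0 sube0 EFinM. Qed.

Let cut_le (f g : R -> \bar R) (l : R) : measurable_fun setT f ->
  measurable_fun setT g -> (forall u, (0 <= f u)%E) -> (forall u, (0 <= g u)%E) ->
  (forall u, 0 <= u -> u < m -> (f u + g u <= l%:E)%E) ->
  (\int[leb]_(u in `[0%R, m[) f u + \int[leb]_(u in `[0%R, m[) g u <= (l * m)%:E)%E.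
Proof.
move=> mf mg f0 g0 fgl; rewrite -cut_cst -ge0_integralD//; last 2 first.
- exact: measurable_funTS.
- exact: measurable_funTS.
apply: ge0_le_integral => //.
- by move=> u _; exact: adde_ge0.
- by apply: measurable_funTS; exact: emeasurable_funD.
- by move=> u /=; rewrite in_itv/= => /andP[u0 um]; exact: fgl.
Qed.

Let le_cut (f g : R -> \bar R) (l : R) : 0 <= l -> measurable_fun setT f ->
  measurable_fun setT g -> (forall u, (0 <= f u)%E) -> (forall u, (0 <= g u)%E) ->
  (forall u, (l%:E <= f u + g u)%E) ->
  ((l * m)%:E <= \int[leb]_(u in `[0%R, m[) f u + \int[leb]_(u in `[0%R, 1%R[) g u)%E.
Proof.
move=> l0 mf mg f0 g0 fgl.
apply: (@le_trans _ _ (\int[leb]_(u in `[0%R, m[) f u + \int[leb]_(u in `[0%R, m[) g u)%E).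
  rewrite -cut_cst -ge0_integralD//; last 2 first.
  - exact: measurable_funTS.
  - exact: measurable_funTS.
  apply: ge0_le_integral => //.
  by apply: measurable_funTS; exact: emeasurable_funD.
by rewrite leeD2l//; apply: ge0_subset_integral => //; exact: measurable_funTS.
Qed.

Let integral_leD (f g h : Om -> \bar R) : measurable_fun setT f ->
  measurable_fun setT g -> measurable_fun setT h ->
  (forall u, (0 <= f u)%E) -> (forall u, (0 <= g u)%E) -> (forall u, (0 <= h u)%E) ->
  (forall u, (f u <= g u + h u)%E) ->
  (\int[P]_w f w <= \int[P]_w g w + \int[P]_w h w)%E.
Proof.
move=> mf mg mh f0 g0 h0 fgh; rewrite -ge0_integralD//.
by apply: ge0_le_integral => //; exact: emeasurable_funD.
Qed.

Lemma qmoment_ge0 Z : (0 <= qmoment Z)%E.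
Proof. by apply: integral_ge0 => u _; rewrite lee_fin powR_ge0. Qed.

Lemma qmoment_le Z r : bounded_rv Z r -> (qmoment Z <= (r `^ p * m)%:E)%E.
Proof.
move=> bZ; have [mZ Z0 r0 Zr] := bZ.
rewrite -cut_cst; apply: ge0_le_integral => //.
- by move=> u _; rewrite lee_fin powR_ge0.
- by apply: measurable_funTS; apply: mpow; exact: mq bZ.
- move=> u _; rewrite lee_fin; apply: ge0_ler_powR; rewrite ?nnegrE.
  + exact: ltW.
  + exact: rquantile_ge0.
  + exact: ltW.
  + exact: rquantile_le.
Qed.

(* Weak duality: with c the quantile of Z1 at m and l = c^p, the integral of
   l - q1^p over [0, m[ is E (l - Z1^p)_+, while for any l the integral of
   l - A q2^p is at most E (l - A Z2^p)_+; the expectations are compared pointwise. *)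
Lemma qmoment_convex (Z1 Z2 V : Om -> R) (r1 r2 t : R) :
  bounded_rv Z1 r1 -> bounded_rv Z2 r2 ->
  measurable_fun setT V -> (forall w, 0 <= V w) -> (forall w, Z1 w <= Z2 w + V w) ->
  0 < t -> t < 1 ->
  (qmoment Z1 <= ((1 - t) `^ (1 - p))%:E * qmoment Z2 +
     (t `^ (1 - p))%:E * \int[P]_w (V w `^ p)%:E)%E.
Proof.
move=> b1 b2 mV V0 Z12 t0 t1.
have [mZ1 Z10 r10 Zr1] := b1; have [mZ2 Z20 r20 Zr2] := b2.
set A := (1 - t) `^ (1 - p); set B := t `^ (1 - p).
have A0 : 0 <= A by exact: powR_ge0.
have B0 : 0 <= B by exact: powR_ge0.
pose q1 := rquantile P Z1; pose q2 := rquantile P Z2.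
(* For m = 1 the cut quantile at m is 0, so the upper bound r1 of Z1 takes its place. *)
pose c := if m < 1 then q1 m else r1.
have c0 : 0 <= c by rewrite /c; case: ifP => _; [exact: rquantile_ge0|exact: ltW].
have q1c u : 0 <= u -> u < m -> q1 u <= c.
  rewrite /c => u0 um; case: ifPn => m1; last exact: rquantile_le.
  by apply: (rquantile_nd r10 Zr1) => //; exact: ltW.
have cq1 u : m <= u -> u < 1 -> c <= q1 u.
  rewrite /c => mu u1; rewrite (le_lt_trans mu u1).
  by apply: (rquantile_nd r10 Zr1) => //; exact: ltW.
pose l := c `^ p.
have l0 : 0 <= l by exact: powR_ge0.
pose E1 := (\int[P]_w (Num.max 0 (l - 1 * Z1 w `^ p))%:E)%E.
pose E2 := (\int[P]_w (Num.max 0 (l - A * Z2 w `^ p))%:E)%E.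
have mq1 := mq b1; have mq2 := mq b2.
have mid : measurable_fun setT (@id R) by exact: measurable_id.
have max0 (x : R) : (0 <= (Num.max 0 x)%:E)%E by rewrite lee_fin le_max lexx.
have E1E : E1 = (\int[leb]_(u in `[0%R, 1%R[) (Num.max 0 (l - 1 * q1 u `^ p))%:E)%E.
  rewrite /E1 -(@integral_rquantile _ _ _ _ _ _ mZ1 Z10 r10 Zr1
    (fun x => (Num.max 0 (l - 1 * x `^ p))%:E))//.
  exact: (mphi l 1 mid).
have E2E : E2 = (\int[leb]_(u in `[0%R, 1%R[) (Num.max 0 (l - A * q2 u `^ p))%:E)%E.
  rewrite /E2 -(@integral_rquantile _ _ _ _ _ _ mZ2 Z20 r20 Zr2
    (fun x => (Num.max 0 (l - A * x `^ p))%:E))//.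
  exact: (mphi l A mid).
have mphi1 := mphi l 1 mq1; have mphi2 := mphi l A mq2.
have pow0 (x : R) : (0 <= (x `^ p)%:E)%E by rewrite lee_fin powR_ge0.
have E1cut : E1 = (\int[leb]_(u in `[0%R, m[) (Num.max 0 (l - 1 * q1 u `^ p))%:E)%E.
  apply: (etrans E1E); apply: (integral_cut mphi1 (fun u => max0 _)) => u mu u1.
  congr EFin; rewrite mul1r max_l; first by [].
  rewrite subr_le0.
  by apply: ge0_ler_powR; rewrite ?nnegrE ?(ltW p_gt0) ?rquantile_ge0//; exact: cq1.
have S1 : (qmoment Z1 + E1 <= (l * m)%:E)%E.
  rewrite E1cut; apply: (cut_le (mpow mq1) mphi1 (fun u => pow0 _) (fun u => max0 _)) => u u0 um.
  rewrite mul1r max_r.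
    by rewrite -EFinD addrC subrK.
  rewrite subr_ge0.
  by apply: ge0_ler_powR; rewrite ?nnegrE ?(ltW p_gt0) ?rquantile_ge0//; exact: q1c.
have Apow0 (x : R) : (0 <= A%:E * (x `^ p)%:E)%E by rewrite mule_ge0.
have Bpow0 (x : R) : (0 <= B%:E * (x `^ p)%:E)%E by rewrite mule_ge0.
have S2 : ((l * m)%:E <= A%:E * qmoment Z2 + E2)%E.
  have -> : (A%:E * qmoment Z2 =
      \int[leb]_(u in `[0%R, m[) (A%:E * (rquantile P Z2 u `^ p)%:E))%E.
    apply: esym; apply: ge0_integralZl.
    - exact: measurable_itv.
    - by apply: measurable_funTS; exact: (mpow mq2).
    - by move=> u _; exact: pow0.
    - by rewrite lee_fin.
  rewrite E2E; apply: (le_cut l0 (measurable_funeM _ (mpow mq2)) mphi2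
    (fun u => Apow0 _) (fun u => max0 _)) => u.
  by rewrite -EFinM -EFinD lee_fin -lerBlDl le_max lexx orbT.
(* Pointwise, Z1^p <= A Z2^p + B V^p by [powR_add_le], and x |-> max(0, l - x) is nonincreasing and
   1-Lipschitz. *)
have S3 : (E2 <= E1 + B%:E * \int[P]_w (V w `^ p)%:E)%E.
  have mp (Z : Om -> R) : measurable_fun setT Z -> measurable_fun setT (fun w => Z w `^ p).
    by move=> mZ; exact: (measurableT_comp (measurable_powR p)).
  have mE (Z : Om -> R) (C : R) : measurable_fun setT Z ->
      measurable_fun setT (fun w => (Num.max 0 (l - C * Z w `^ p))%:E).
    move=> mZ; apply/measurable_EFinP; apply: measurable_maxr; first exact: measurable_cst.
    apply: measurable_funB; first exact: measurable_cst.
    by apply: measurable_funM; [exact: measurable_cst|exact: mp].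
  have mVp : measurable_fun setT (fun w => (V w `^ p)%:E).
    by apply/measurable_EFinP; exact: mp.
  have -> : (B%:E * \int[P]_w (V w `^ p)%:E = \int[P]_w (B%:E * (V w `^ p)%:E))%E.
    apply: esym; apply: ge0_integralZl.
    - exact: measurableT.
    - exact: mVp.
    - by move=> u _; exact: pow0.
    - by rewrite lee_fin.
  apply: (integral_leD (mE _ _ mZ2) (mE _ _ mZ1) (measurable_funeM _ mVp)
    (fun w => max0 _) (fun w => max0 _) (fun w => Bpow0 _)) => w.
  rewrite -EFinM -EFinD lee_fin mul1r ge_max; apply/andP; split.
    apply: addr_ge0; first by rewrite le_max lexx.
    by rewrite -lee_fin EFinM; exact: Bpow0.
  have H : Z1 w `^ p <= A * Z2 w `^ p + B * V w `^ p.
    apply: (@le_trans _ _ ((Z2 w + V w) `^ p)).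
      apply: ge0_ler_powR; rewrite ?nnegrE ?(ltW p_gt0) ?addr_ge0//.
    exact: (powR_add_le p_ge1 (Z20 w) (V0 w) t0 t1).
  apply: (@le_trans _ _ (l - Z1 w `^ p + B * V w `^ p)).
    by move: H; move: (Z1 w `^ p) (A * _) (B * _) => x y z; lra.
  by rewrite lerD2r le_max lexx orbT.
have E10 : (0 <= E1)%E by apply: integral_ge0 => w _; exact: max0.
have E1f : E1 \is a fin_num.
  rewrite ge0_fin_numE; last exact: E10.
  apply: (@le_lt_trans _ _ (qmoment Z1 + E1)%E).
    by apply: leeDr; exact: qmoment_ge0.
  by apply: (le_lt_trans S1); rewrite ltry.
(* E1 is finite, so it cancels once S1, S2 and S3 are chained. *)
rewrite -(leeD2rE _ _ E1f); apply: (le_trans S1); apply: (le_trans S2).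
by rewrite -addeA; apply: leeD2l; rewrite addeC; exact: S3.
Qed.

Lemma qmoment_minkowski (Z1 Z2 V : Om -> R) (r1 r2 : R) :
  bounded_rv Z1 r1 -> bounded_rv Z2 r2 ->
  measurable_fun setT V -> (forall w, 0 <= V w) -> (forall w, Z1 w <= Z2 w + V w) ->
  (\int[P]_w (V w `^ p)%:E)%E \is a fin_num ->
  fine (qmoment Z1) `^ p^-1 <=
    fine (qmoment Z2) `^ p^-1 + fine (\int[P]_w (V w `^ p)%:E)%E `^ p^-1.
Proof.
move=> b1 b2 mV V0 Z12 Vf.
have qf Z r : bounded_rv Z r -> qmoment Z \is a fin_num.
  move=> b; rewrite ge0_fin_numE ?qmoment_ge0//.
  by rewrite (le_lt_trans (qmoment_le b))// ltry.
apply: minkowski_of_convex => //; rewrite ?fine_ge0 ?qmoment_ge0//.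
  by apply: integral_ge0 => w _; rewrite lee_fin powR_ge0.
move=> t t0 t1; have := qmoment_convex b1 b2 mV V0 Z12 t0 t1.
rewrite -{1}(fineK (qf _ _ b1)) -{1}(fineK (qf _ _ b2)) -{1}(fineK Vf).
by rewrite -!EFinM -EFinD lee_fin.
Qed.
End quantile_moment.

(** * A measure supported in a closed set gives it full mass *)

Section support.
Context (R : realType) (d : nat).
Implicit Types (K : set 'rV[R]_d) (x y : 'rV[R]_d).

Lemma open_measurable_borel (U : set 'rV[R]_d) : open U ->
  measurable (U : set (borelRd R d)).
Proof. by move=> oU; apply: sub_sigma_algebra. Qed.

Lemma closed_measurable_borel (U : set 'rV[R]_d) : closed U ->
  measurable (U : set (borelRd R d)).
Proof.
move=> cU; rewrite -[U]setCK; apply: measurableC.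
by apply: open_measurable_borel; exact: closed_openC.
Qed.

Lemma continuous_measurable_borel (f : 'rV[R]_d -> R) : continuous f ->
  measurable_fun setT (f : borelRd R d -> R).
Proof.
move=> /continuousP cf; apply: (measurability _ (RGenInftyO.measurableE R)) => // _ [_ [r ->] <-].
rewrite setTI; apply: open_measurable_borel.
by apply: cf; exact: open_lt.
Qed.

Lemma dist_continuous_rV (k : 'rV[R]_d) : continuous (fun x => `|x - k|).
Proof.
apply: (@enorm_lip_continuous _ _ _ 1) => x y; rewrite mul1r.
apply: (le_trans (ler_dist_dist _ _)); apply: le_trans (norm_le_enorm _).
by rewrite opprB addrA subrK.
Qed.

Let away K (n : nat) := [set y : 'rV[R]_d | `|y| <= n%:R] `&`
  \bigcap_(k in K) [set y | n.+1%:R^-1 <= `|y - k|].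

Let away_compact K n : compact (away K n).
Proof.
apply: bounded_closed_compact.
  exists n%:R; split; first exact: num_real.
  by move=> r nr y [/= yn _]; rewrite (le_trans yn)// ltW.
have cn : closed [set y : 'rV[R]_d | `|y| <= n%:R].
  rewrite (_ : [set y | _] = (fun y : 'rV[R]_d => `|y - 0|) @^-1` [set r | r <= n%:R]).
    apply: preimage_closed; last exact: closed_le.
    by move=> y _; exact: dist_continuous_rV.
  by apply/seteqP; split => y /=; rewrite subr0.
apply: closedI => //; apply: closed_bigI => k Kk.
apply: (@preimage_closed _ _ (fun y : 'rV[R]_d => `|y - k|) [set r | n.+1%:R^-1 <= r]).
  by move=> y _; exact: dist_continuous_rV.
exact: closed_ge.
Qed.

(** Each point off K has a null open neighbourhood. Finitely many of these cover the compact set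
    [away K n], and the sets [away K n] cover the complement of K, which is open. *)
Lemma msupport_full K (mu : probability (borelRd R d) R) : closed K ->
  msupport mu `<=` K -> mu K = 1%E.
Proof.
move=> cK sK.
have mK : measurable (K : set (borelRd R d)) by exact: closed_measurable_borel.
have nbh y : exists U : set 'rV[R]_d, ~ K y -> [/\ open U, U y & mu U = 0%E].
  have [Ky|nKy] := pselect (K y); first by exists set0.
  have : ~ msupport mu y by move/sK.
  move=> /existsNP[U] /not_implyP[oU] /not_implyP[Uy] /negP.
  rewrite -leNgt => U0; exists U => _; split => //.
  by apply/eqP; rewrite eq_le U0 measure_ge0.
have [U UP] := choice nbh.
have null n : mu.-negligible (away K n).
  have := @away_compact K n; rewrite compact_cover => /(_ _ (~` K) U)[].
  - by move=> y /UP[].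
  - move=> y [_ yK]; have nKy : ~ K y.
      by move=> /yK /=; rewrite subrr normr0 leNgt invr_gt0 ltr0n.
    by exists y => //; case: (UP y nKy).
  move=> D' D'K aw; apply: (@negligibleS _ (borelRd R d) R mu _ _ aw).
  rewrite /cover bigcup_fset big_seq.
  elim/big_rec : _ => [|y A yD nA]; first exact: negligible_set0.
  have nKy : ~ K y by move: (D'K y yD); rewrite inE.
  have [oU Uy U0] := UP y nKy.
  apply: negligibleU nA; apply/negligibleP => //; exact: open_measurable_borel.
have nKc : mu (~` K) = 0%E.
  apply/negligibleP; first exact: measurableC.
  apply: (@negligibleS _ (borelRd R d) R mu (\bigcup_n away K n)); last first.
    exact: (@negligible_bigcup _ (borelRd R d) R mu).
  move=> y nKy.
  have oK : open (~` K) by exact: closed_openC.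
  have /nbhs_ballP[e /= e0 yeK] : nbhs y (~` K) by exact: open_nbhs_nbhs.
  have [n1 n1e] : exists n, n.+1%:R^-1 < e by have [n] := ltr_add_invr e0; rewrite add0r; exists n.
  have n2y := truncnS_gt `|y|.
  exists (maxn n1 (Num.truncn `|y|).+1) => //; split => /=.
    by rewrite (le_trans (ltW n2y))// ler_nat leq_maxr.
  move=> k Kk /=; apply: (@le_trans _ _ n1.+1%:R^-1).
    by rewrite lef_pV2 ?posrE ?ltr0n// ler_nat ltnS leq_maxl.
  rewrite leNgt; apply/negP => yk; apply: (yeK k) => //.
  by rewrite -ball_normE /= (lt_trans yk).
rewrite -[K]setCK probability_setC; last exact: measurableC.
by rewrite nKc sube0.
Qed.
End support.

(** * The distance to measure: Lipschitz property and packing *)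

Section dtm.
Context (R : realType) (d : nat).
Local Notation leb := (@lebesgue_measure R).
Variables (m p : R).
Hypothesis m_gt0 : 0 < m.
Hypothesis m_le1 : m <= 1.
Hypothesis p_ge1 : 1 <= p.
Let p_gt0 : 0 < p. Proof. exact: lt_le_trans p_ge1. Qed.

Definition dist_to (x : 'rV[R]_d) (y : borelRd R d) : R := enorm ((y : 'rV[R]_d) - x).

Lemma measurable_dist_to x : measurable_fun setT (dist_to x).
Proof.
apply: continuous_measurable_borel.
apply: (@enorm_lip_continuous _ _ _ 1) => y z; rewrite mul1r.
by apply: (le_trans (enorm_dist _ _)); rewrite opprB addrA subrK.
Qed.

Definition fdtm (mu : probability (borelRd R d) R) (x : 'rV[R]_d) : R :=
  (m^-1 * fine (qmoment mu m p (dist_to x))) `^ p^-1.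

Lemma compact_closed_rV (K : set 'rV[R]_d) : compact K -> closed K.
Proof.
by apply: compact_closed; exact: (@norm_hausdorff R ('rV[R]_d : normedModType R)).
Qed.

Section one.
Variables (mu : probability (borelRd R d) R) (K : set 'rV[R]_d).
Hypothesis K_compact : compact K.
Hypothesis muK : mu K = 1%E.

Lemma measurable_lt_borel (x : 'rV[R]_d) (r : R) :
  measurable ([set y : borelRd R d | dist_to x y < r] : set (borelRd R d)).
Proof.
have := measurable_dist_to x measurableT (measurable_itv `]-oo, r[).
by rewrite setTI; congr measurable; apply/seteqP; split => y /=; rewrite in_itv.
Qed.

Lemma bounded_rv_dist_to_of (x : 'rV[R]_d) (r : R) : 0 < r ->
  (forall y, K y -> enorm (y - x) < r) -> bounded_rv mu (dist_to x) r.
Proof.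
move=> r0 Kr; split => //; first exact: measurable_dist_to.
  by move=> y; exact: enorm_ge0.
apply/le_anti/andP; split.
  by apply: probability_le1; exact: measurable_lt_borel.
apply: (@le_trans _ _ (mu K)); first by rewrite muK.
apply: le_measure; rewrite ?inE.
- apply: closed_measurable_borel; exact: compact_closed_rV.
- exact: measurable_lt_borel.
- by move=> y /Kr.
Qed.

Lemma bounded_rv_dist_to (x : 'rV[R]_d) : exists r, bounded_rv mu (dist_to x) r.
Proof.
have [M [_ KM]] := compact_bounded K_compact.
have KM1 := KM (`|M| + 1) (ltr_pwDr ltr01 (ler_norm M)).
exists (d%:R * (`|M| + 1 + `|x|) + 1); apply: bounded_rv_dist_to_of.
  by rewrite ltr_wpDl// mulr_ge0// !addr_ge0.
move=> y Ky; rewrite ltr_pwDr//; apply: (le_trans (enorm_le_norm _)).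
rewrite ler_wpM2l//; apply: (le_trans (ler_normB _ _)).
by rewrite lerD2r; exact: KM1.
Qed.

Lemma deltaE u x : delta mu u x = quantile mu (dist_to x) u.
Proof. by []. Qed.

Lemma qmoment_dist_fin x : qmoment mu m p (dist_to x) \is a fin_num.
Proof.
have [r b] := bounded_rv_dist_to x.
rewrite ge0_fin_numE; last exact: qmoment_ge0.
by apply: (le_lt_trans (qmoment_le m_gt0 p_ge1 b)); rewrite ltry.
Qed.

Lemma dtmE x : dtm m p mu x = (fdtm mu x)%:E.
Proof.
have [r [mZ Z0 r0 Zr]] := bounded_rv_dist_to x.
have E u : 0 <= u < m -> (delta mu u x `^ p)%E = (rquantile mu (dist_to x) u `^ p)%:E.
  move=> /andP[u0 um]; rewrite deltaE -(rquantileE r0 Zr) ?poweR_EFin//.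
  by rewrite u0 (lt_le_trans um).
have mq : measurable_fun (`[0%R, m[%classic : set R)
    (fun u => (rquantile mu (dist_to x) u `^ p)%:E).
  apply: measurable_funTS; apply/measurable_EFinP.
  by apply: (measurableT_comp (measurable_powR p)); exact: (measurable_rquantile mZ Z0 r0 Zr).
(* The end u = m is dropped: for m = 1 the infimum defining [delta mu m x] is over the empty set. *)
rewrite /dtm -(@integral_itv_bndo_bndc _ (BLeft 0)); last first.
  apply: (eq_measurable_fun _ _ mq) => u; rewrite inE/= in_itv/= => u0m.
  by rewrite E.
rewrite /fdtm.
have -> : (\int[leb]_(u in `[0%R, m[) (delta mu u x `^ p) = qmoment mu m p (dist_to x))%E.
  by apply: eq_integral => u; rewrite inE/= in_itv/= => u0m; rewrite E.
by rewrite -[qmoment _ _ _ _]fineK ?qmoment_dist_fin// -EFinM poweR_EFin.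
Qed.

Lemma fdtm_ge0 x : 0 <= fdtm mu x. Proof. exact: powR_ge0. Qed.

Lemma fine_qmoment_ge0 x : 0 <= fine (qmoment mu m p (dist_to x)).
Proof. by rewrite fine_ge0// qmoment_ge0. Qed.

Lemma fdtm_le (x : 'rV[R]_d) (D : R) : (forall y, K y -> enorm (y - x) <= D) ->
  fdtm mu x <= D.
Proof.
move=> KD; apply/ler_addgt0Pr => e e0.
have D0 : 0 <= D.
  have [y Ky] : K !=set0.
    apply/set0P/eqP => K0; move: muK; rewrite K0 measure0.
    by move=> /eqP; rewrite eqe eq_sym oner_eq0.
  by apply: le_trans (KD y Ky); exact: enorm_ge0.
have De : 0 < D + e by rewrite ltr_wpDl.
have b : bounded_rv mu (dist_to x) (D + e).
  apply: bounded_rv_dist_to_of => // y /KD yD.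
  by rewrite (le_lt_trans yD)// ltrDl.
have := qmoment_le m_gt0 p_ge1 b.
rewrite -(fineK (qmoment_dist_fin x)) lee_fin => q.
apply: (root_le_of_le_powR p_ge1).
- by rewrite mulr_ge0 ?fine_qmoment_ge0// invr_ge0 ltW.
- exact: ltW.
- by rewrite mulrC ler_pdivrMr.
Qed.

(** B(y, r) lies in B(x, r + |x - y|), so the quantiles at x and y differ by at most |x - y|;
    Minkowski's inequality on [0, m[ passes this to the p-th means. *)
Lemma fdtm_lip x y : fdtm mu x <= fdtm mu y + enorm (x - y).
Proof.
set c := enorm (x - y).
have c0 : 0 <= c by exact: enorm_ge0.
have cc : (c `^ p) `^ p^-1 = c by rewrite -powRrM divff ?gt_eqF// powRr1.
rewrite -[X in _ <= _ + X]cc; apply: (minkowski_of_convex p_ge1).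
- by rewrite mulr_ge0 ?fine_qmoment_ge0// invr_ge0 ltW.
- by rewrite mulr_ge0 ?fine_qmoment_ge0// invr_ge0 ltW.
- exact: powR_ge0.
move=> t t0 t1.
have [rx bx] := bounded_rv_dist_to x; have [ry by_] := bounded_rv_dist_to y.
have [mX X0 rx0 Xr] := bx; have [mY Y0 ry0 Yr] := by_.
have qxy u : 0 <= u -> u < m -> rquantile mu (dist_to x) u <= rquantile mu (dist_to y) u + c.
  move=> u0 um; have u01 : 0 <= u < 1 by rewrite u0 (lt_le_trans um).
  apply/ler_addgt0Pr => e e0.
  have : (quantile mu (dist_to y) u < (rquantile mu (dist_to y) u + e)%:E)%E.
    by rewrite -(rquantileE ry0 Yr)// lte_fin ltrDl.
  move/(quantile_ltP mu mY Y0 _ u0) => uy.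
  rewrite ltW// -lte_fin (rquantileE rx0 Xr)//; apply/(quantile_ltP mu mX X0 _ u0).
  apply: (lt_le_trans uy); apply: le_measure; rewrite ?inE; [exact: measurable_lt_borel..|].
  move=> z /= zy; apply: le_lt_trans (enorm_sub_triangle y _ _) _.
  by rewrite (enormB y x) -/c addrAC ltrD2r.
move AE : ((1 - t) `^ (1 - p)) => A; move BE : (t `^ (1 - p)) => B.
have A0 : 0 <= A by rewrite -AE powR_ge0.
have B0 : 0 <= B by rewrite -BE powR_ge0.
have mpow z r : bounded_rv mu (dist_to z) r ->
    measurable_fun setT (fun u => (rquantile mu (dist_to z) u `^ p)%:E).
  move=> [mZ Z0 r0 Zr]; apply/measurable_EFinP.
  by apply: (measurableT_comp (measurable_powR p)); exact: (measurable_rquantile mZ Z0 r0 Zr).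
have pow0 (r : R) : (0 <= (r `^ p)%:E)%E by rewrite lee_fin powR_ge0.
have cst0 : (0 <= (B * c `^ p)%:E)%E by rewrite lee_fin mulr_ge0 ?powR_ge0.
have q0 z u : 0 <= rquantile mu (dist_to z) u by exact: rquantile_ge0.
have qle u : 0 <= u -> u < m -> ((rquantile mu (dist_to x) u `^ p)%:E <=
    A%:E * (rquantile mu (dist_to y) u `^ p)%:E + (B * c `^ p)%:E)%E.
  move=> u0 um; rewrite -EFinM -EFinD lee_fin -AE -BE.
  apply: le_trans (powR_add_le p_ge1 (q0 y u) c0 t0 t1).
  apply: ge0_ler_powR; rewrite ?nnegrE ?(ltW p_gt0) ?addr_ge0//.
  exact: qxy.
have : (qmoment mu m p (dist_to x) <=
    A%:E * qmoment mu m p (dist_to y) + (B * c `^ p * m)%:E)%E.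
  rewrite /qmoment -ge0_integralZl; first last.
  - by rewrite lee_fin.
  - by move=> u _; exact: pow0.
  - by apply: measurable_funTS; exact: (mpow _ _ by_).
  - exact: measurable_itv.
  rewrite EFinM (_ : m%:E = leb (`[0%R, m[%classic : set R)); last first.
    by rewrite lebesgue_measure_itv/= lte_fin m_gt0 sube0.
  rewrite -integral_cst; last exact: measurable_itv.
  rewrite -ge0_integralD; first last.
  - exact: measurable_cst.
  - by move=> u _; exact: cst0.
  - by apply: measurable_funTS; apply: measurable_funeM; exact: (mpow _ _ by_).
  - by move=> u _; rewrite mule_ge0.
  - exact: measurable_itv.
  apply: ge0_le_integral.
  - exact: measurable_itv.
  - by move=> u _; exact: pow0.
  - by apply: measurable_funTS; exact: (mpow _ _ bx).
  - apply: emeasurable_funD; last exact: measurable_cst.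
    by apply: measurable_funTS; apply: measurable_funeM; exact: (mpow _ _ by_).
  - by move=> u /=; rewrite in_itv/= => /andP[u0 um]; exact: qle.
rewrite -(fineK (qmoment_dist_fin x)) -(fineK (qmoment_dist_fin y)).
rewrite -EFinM -EFinD lee_fin.
have alg (Jx Jy C : R) : Jx <= A * Jy + B * C * m ->
    m^-1 * Jx <= A * (m^-1 * Jy) + B * C.
  move=> H; rewrite mulrC ler_pdivrMr//; apply: (le_trans H).
  by rewrite le_eqVlt; apply/orP; left; apply/eqP; field; rewrite gt_eqF.
exact: alg.
Qed.

(** Otherwise the quantile is at least 3r on the upper half of [0, m[, so the p-th power of the
    distance to measure is at least 3^p r^p / 2, which exceeds r^p. *)
Lemma fdtm_ball (x : 'rV[R]_d) (r : R) : 0 < r -> fdtm mu x <= r ->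
  ((m / 2)%:E <= mu (eball x (3 * r)))%E.
Proof.
move=> r0 xr; rewrite leNgt; apply/negP => small.
have [rx bx] := bounded_rv_dist_to x; have [mX X0 rx0 Xr] := bx.
have m2 : 0 < m / 2 by rewrite divr_gt0.
have m21 : m / 2 < m by rewrite ltr_pdivrMr// ltr_pMr// ltr1n.
have q3 u : m / 2 <= u -> u < m -> 3 * r <= rquantile mu (dist_to x) u.
  move=> u0 um; rewrite leNgt; apply/negP => q3.
  have u00 : 0 <= u by apply: le_trans u0; exact: ltW.
  have : (quantile mu (dist_to x) u < (3 * r)%:E)%E.
    by rewrite -(rquantileE rx0 Xr) ?lte_fin// u00 (lt_le_trans um).
  move/(quantile_ltP mu mX X0 _ u00); rewrite ltNge; apply/negP; rewrite negbK.
  by apply: ltW; apply: lt_le_trans small _; rewrite lee_fin.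
have r3 : 0 <= 3 * r by rewrite mulr_ge0// ltW.
have mpow : measurable_fun setT (fun u => (rquantile mu (dist_to x) u `^ p)%:E).
  apply/measurable_EFinP; apply: (measurableT_comp (measurable_powR p)).
  exact: (measurable_rquantile mX X0 rx0 Xr).
have : (((3 * r) `^ p * (m / 2))%:E <= qmoment mu m p (dist_to x))%E.
  apply: (@le_trans _ _ (\int[leb]_(u in `[(m / 2)%R, m[) (rquantile mu (dist_to x) u `^ p)%:E)%E).
    have -> : ((3 * r) `^ p * (m / 2))%:E =
        (\int[leb]_(u in `[(m / 2)%R, m[) ((3 * r) `^ p)%:E)%E.
      rewrite integral_cst//= lebesgue_measure_itv/= lte_fin m21 -EFinD -EFinM.
      by congr EFin; field.
    apply: ge0_le_integral.
    - exact: measurable_itv.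
    - by move=> u _; rewrite lee_fin powR_ge0.
    - exact: measurable_cst.
    - by apply: measurable_funTS.
    - move=> u /=; rewrite in_itv/= => /andP[u0 um]; rewrite lee_fin.
      by apply: ge0_ler_powR; rewrite ?nnegrE ?(ltW p_gt0) ?rquantile_ge0//; exact: q3.
  apply: ge0_subset_integral.
  - exact: measurable_itv.
  - exact: measurable_itv.
  - by apply: measurable_funTS.
  - by move=> u _; rewrite lee_fin powR_ge0.
  - by apply: subset_itvr; rewrite bnd_simp ltW.
rewrite -(fineK (qmoment_dist_fin x)) lee_fin => J.
have : m^-1 * fine (qmoment mu m p (dist_to x)) <= r `^ p.
  apply: (le_powR_of_root_le p_ge1) xr.
  by rewrite mulr_ge0 ?fine_qmoment_ge0// invr_ge0 ltW.
rewrite mulrC ler_pdivrMr// => J2.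
have alg (a b : R) : 0 < b -> 3 <= a -> a * b * (m / 2) <= b * m -> False.
  move=> b0 a3; apply/negP; rewrite -ltNge [ltRHS]mulrAC [_ * b]mulrC ltr_pM2l//.
  by rewrite mulrA ltr_pdivlMr// [m * 2]mulrC ltr_pM2r//; apply: lt_le_trans a3; rewrite ltr_nat.
apply: (alg (3 `^ p) (r `^ p)).
- by rewrite powR_gt0.
- by rewrite -[leLHS]powRr1// ler_powR// ler1n.
- by rewrite -powRM ?(ltW r0)//; exact: le_trans J J2.
Qed.

Lemma fdtm_covering (N : nat) (r : R) (xs : seq 'rV[R]_d) : 2 / m <= N%:R -> 0 < r ->
  all (fun x => fdtm mu x <= r) xs ->
  pairwise (fun x y => 6 * r <= edist x y) xs -> (size xs <= N)%N.
Proof.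
move=> mN r0 fxs pxs.
have mB x : measurable (eball x (3 * r) : set (borelRd R d)).
  exact: measurable_lt_borel.
pose U xs := \big[setU/set0]_(x <- xs) (eball x (3 * r) : set (borelRd R d)).
have mU xs' : measurable (U xs') by apply: bigsetU_measurable.
suff H : (((size xs)%:R * (m / 2))%:E <= mu (U xs))%E.
  have : (((size xs)%:R * (m / 2))%:E <= 1%:E)%E.
    by apply: (le_trans H); exact: probability_le1.
  rewrite lee_fin -ler_pdivlMr ?divr_gt0// => sz.
  rewrite -(ler_nat R); apply: (le_trans sz); apply: le_trans mN.
  by rewrite le_eqVlt; apply/orP; left; apply/eqP; field; rewrite gt_eqF.
elim: xs fxs pxs => [_ _|x xs IH /= /andP[fx fxs] /andP[xxs pxs]].
  by rewrite /U big_nil measure0 mul0r.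
rewrite /U big_cons measureU//; last first.
- rewrite -subset0 => z [/= xz]; rewrite -bigcup_seq => -[y /= yxs yz].
  have := allP xxs y yxs; rewrite /edist => xy6.
  have := enorm_sub_triangle z y x; rewrite (enormB y z).
  move: xz yz; rewrite /eball/= => xz yz; lra.
- exact: mU.
rewrite -[X in X%:R]addn1 addnC natrD mulrDl mul1r EFinD; apply: leeD.
  exact: fdtm_ball.
exact: IH.
Qed.
End one.
End dtm.

(** * Stability of the distance to measure under couplings *)

Section stability.
Context (R : realType) (d : nat).
Local Notation leb := (@lebesgue_measure R).
Variables (m p : R).
Hypothesis m_gt0 : 0 < m.
Hypothesis m_le1 : m <= 1.
Hypothesis p_ge1 : 1 <= p.

Lemma measurable_coord (i : 'I_d) :
  measurable_fun setT ((fun x => x ord0 i) : borelRd R d -> R).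
Proof.
apply: continuous_measurable_borel; apply: (@enorm_lip_continuous _ _ _ 1) => x y.
rewrite mul1r; apply: le_trans (normr_coord_le_enorm _ i).
by rewrite !mxE.
Qed.

(** m^(-1/p) is at most 1/m because m <= 1 and p >= 1; this is where p leaves the constant. *)
Let scale (a b c : R) : 0 <= a -> 0 <= b -> 0 <= c ->
  a `^ p^-1 <= b `^ p^-1 + c ->
  (m^-1 * a) `^ p^-1 <= (m^-1 * b) `^ p^-1 + m^-1 * c.
Proof.
move=> a0 b0 c0 H; have im0 : 0 <= m^-1 by rewrite invr_ge0 ltW.
have mp : m^-1 `^ p^-1 <= m^-1.
  rewrite -[leRHS]powRr1//; apply: ler_powR; first by rewrite invf_ge1.
  by rewrite invf_le1// (lt_le_trans ltr01).
rewrite (powRM _ im0 a0) (powRM _ im0 b0).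
apply: (@le_trans _ _ (m^-1 `^ p^-1 * (b `^ p^-1 + c))).
  by apply: ler_wpM2l H; exact: powR_ge0.
by rewrite mulrDr lerD2l; exact: ler_wpM2r.
Qed.

Context (dO : measure_display) (Om : measurableType dO) (P : probability Om R).

Lemma measurable_enormB (X Y : Om -> borelRd R d) :
  measurable_fun setT X -> measurable_fun setT Y ->
  measurable_fun setT (fun w => enorm ((X w : 'rV[R]_d) - Y w)).
Proof.
move=> mX mY.
apply: (measurableT_comp (continuous_measurable_fun (@sqrt_continuous R))).
apply: measurable_sum => i; apply: measurable_funX.
under eq_fun do rewrite !mxE.
by apply: measurable_funB; apply: (measurableT_comp (measurable_coord i)).
Qed.

Variables (X Y : Om -> borelRd R d).
Hypothesis mX : measurable_fun setT X.
Hypothesis mY : measurable_fun setT Y.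
Variables (mu nu : probability (borelRd R d) R) (K : set 'rV[R]_d).
Hypothesis K_compact : compact K.
Hypothesis muK : mu K = 1%E.
Hypothesis nuK : nu K = 1%E.
Hypothesis Xmu : forall A, measurable A -> P (X @^-1` A) = mu A.
Hypothesis Ynu : forall A, measurable A -> P (Y @^-1` A) = nu A.

Let law (Z : Om -> borelRd R d) (la : probability (borelRd R d) R) x :
  (forall A, measurable A -> P (Z @^-1` A) = la A) ->
  qmoment P m p (dist_to x \o Z) = qmoment la m p (dist_to x).
Proof.
move=> Zla; rewrite /qmoment; suff -> : rquantile P (dist_to x \o Z) = rquantile la (dist_to x) by [].
apply/funext => u; rewrite /rquantile; congr (if _ then fine _ else _).
rewrite /quantile; congr ereal_inf; congr image; apply/seteqP; split => r /= [r0];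
by rewrite -(Zla _ (measurable_lt_borel x r)).
Qed.

Let brv (Z : Om -> borelRd R d) (la : probability (borelRd R d) R) x :
  measurable_fun setT Z -> la K = 1%E ->
  (forall A, measurable A -> P (Z @^-1` A) = la A) ->
  exists r, bounded_rv P (dist_to x \o Z) r.
Proof.
move=> mZ laK Zla; have [r [mD D0 r0 Dr]] := bounded_rv_dist_to K_compact laK x.
exists r; split => //; first exact: measurableT_comp.
  by move=> w; exact: D0.
by apply: etrans Dr; rewrite -(Zla _ (measurable_lt_borel x r)).
Qed.

(** On the space of the coupling, the distances from x to X and Y have the laws needed for mu and
    nu, and they differ by at most |X - Y|, so [qmoment_minkowski] applies. *)
Lemma fdtm_stable x :
  (\int[P]_w (enorm ((X w : 'rV[R]_d) - Y w) `^ p)%:E)%E \is a fin_num ->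
  fdtm m p mu x <= fdtm m p nu x +
    m^-1 * fine (\int[P]_w (enorm ((X w : 'rV[R]_d) - Y w) `^ p)%:E)%E `^ p^-1.
Proof.
move=> If.
have [rX bX] := brv x mX muK Xmu; have [rY bY] := brv x mY nuK Ynu.
have Z12 w : (dist_to x \o X) w <= (dist_to x \o Y) w + enorm ((X w : 'rV[R]_d) - Y w).
  by rewrite /dist_to /= [leRHS]addrC; exact: (enorm_sub_triangle (Y w : 'rV[R]_d) (X w) x).
have := qmoment_minkowski m_gt0 m_le1 p_ge1 bX bY (measurable_enormB mX mY)
  (fun w => enorm_ge0 _) Z12 If.
rewrite (law x Xmu) (law x Ynu); apply: scale.
- exact: fine_qmoment_ge0.
- exact: fine_qmoment_ge0.
- exact: powR_ge0.
Qed.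
End stability.

(** * Comparison of two Fermat distances *)

Section fermat.
Context (R : realType) (d : nat).
Local Notation leb := (@lebesgue_measure R).
Variable beta : R.
Hypothesis d_gt0 : (0 < d)%N.
Hypothesis beta_ge1 : 1 <= beta.

Definition path_cost (f : 'rV[R]_d -> R) (gamma : R -> 'rV[R]_d) : \bar R :=
  (\int[leb]_(t in `[0%R, 1%R]) (f (gamma t) `^ beta * speed gamma t)%:E)%E.

Definition fermat (f : 'rV[R]_d -> R) (F : set 'rV[R]_d) (x y : 'rV[R]_d) : \bar R :=
  ereal_inf [set path_cost f gamma | gamma in admissible F x y].

Section one.
Variables (f : 'rV[R]_d -> R) (F : set 'rV[R]_d).
Hypothesis f_ge0 : forall x, 0 <= f x.
Hypothesis f_lip : forall x y, f x <= f y + enorm (x - y).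

Lemma fermat_ge0 x y : (0 <= fermat f F x y)%E.
Proof.
apply: le_ereal_inf_tmp => _ [gamma _ <-]; apply: integral_ge0 => t _.
by rewrite lee_fin mulr_ge0 ?powR_ge0// enorm_ge0.
Qed.

Lemma fermat_le_chain n (q : nat -> 'rV[R]_d) : (0 < n)%N ->
  (forall i, (0 < i < n)%N -> F (q i)) ->
  (fermat f F (q 0%N) (q n) <= (\sum_(0 <= l < n) segcost f beta (q l) (q l.+1))%:E)%E.
Proof.
move=> n0 qF; rewrite -(polygon_cost q n0 f_ge0 f_lip beta_ge1).
apply: ereal_inf_lbound; exists (polygon n q) => //; split.
- exact: polygon_rectifiable.
- by rewrite -[RHS](polygon_vertex q n0 (leq0n n)) mul0r.
- rewrite -[RHS](polygon_vertex q n0 (leqnn n)) divff//.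
  by rewrite pnatr_eq0 -lt0n.
- exact: polygon_straight.
Qed.

Lemma fermat_le_segcost x y : (fermat f F x y <= (segcost f beta x y)%:E)%E.
Proof.
have := @fermat_le_chain 1 (fun i => if i is 0 then x else y) isT.
by rewrite big_nat1; apply => -[|[]].
Qed.

Lemma admissible_chain (x y : 'rV[R]_d) (gamma : R -> 'rV[R]_d) (eta : R) :
  closed F -> admissible F x y gamma -> 0 < eta ->
  exists n (q : nat -> 'rV[R]_d),
  [/\ (0 < n)%N, q 0%N = x /\ q n = y, (forall i, (0 < i < n)%N -> F (q i)) &
      ((\sum_(0 <= l < n) segcost f beta (q l) (q l.+1))%:E <=
        path_cost f gamma + eta%:E)%E].
Proof.
move=> F_closed [rect g0 g1 str] eta0.
have [L0 gL0] := rect.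
have L_ge0 : 0 <= `|L0| by [].
have gL s t : 0 <= s <= 1 -> 0 <= t <= 1 ->
    enorm (gamma s - gamma t) <= `|L0| * `|s - t|.
  by move=> s01 t01; apply: (le_trans (gL0 _ _ s01 t01)); rewrite ler_wpM2r// ler_norm.
(* The clamp makes the weight continuous and bounded on the whole line without changing it on
   [0, 1]. *)
pose w t := f (gamma (clamp01 t)) `^ beta.
have cg := clamp01_lip_continuous L_ge0 gL.
have cw : continuous w.
  move=> t; apply: (@continuous_comp _ _ _ (gamma \o @clamp01 R) (fun x => f x `^ beta)).
    exact: cg.
  exact: (pow_f_continuous f_ge0 f_lip beta_ge1).
have beta0 : 0 <= beta by exact: le_trans beta_ge1.
have wW t : 0 <= w t <= (f (gamma 0) + `|L0|) `^ beta.
  rewrite powR_ge0/=; apply: ge0_ler_powR; rewrite ?nnegrE// ?addr_ge0//.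
  apply: (le_trans (f_lip _ (gamma 0))); rewrite lerD2l.
  have /andP[c0 c1] := clamp01_in t.
  apply: (le_trans (gL _ _ (clamp01_in t) _)); first by rewrite lexx ler01.
  by rewrite subr0 (ger0_norm c0) ler_piMr.
have mw : measurable_fun (`[0, 1]%classic : set R) w.
  by apply: measurable_funTS; exact: continuous_measurable_fun.
have [S [Phi [arcS arcPhi PhiE chord]]] := rectifiable_arclength rect str mw wW.
have arcPhi' a b c : 0 <= a -> a <= b -> b <= 1 -> 0 <= c ->
    (forall t, a <= t <= b -> c <= f (gamma t) `^ beta) ->
    c * (S b - S a) <= Phi b - Phi a.
  move=> a0 ab b1 c0 cf; apply: arcPhi => // t /andP[at_ tb].
  rewrite /w clamp01_id; first by apply: cf; rewrite at_ tb.
  by rewrite (le_trans a0 at_) (le_trans tb b1).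
have [n [q [n0 [q0 qn] qF qc]]] := reach_start f_ge0 f_lip beta_ge1 L_ge0 F_closed
  gL arcS arcPhi' chord eta0.
exists n, q; split => //; first by rewrite q0 qn.
apply: (@le_trans _ _ (Phi 1 - Phi 0 + eta)%:E); first by rewrite lee_fin.
rewrite EFinD; apply: leeD2r; apply: (le_trans PhiE).
rewrite le_eqVlt; apply/orP; left; apply/eqP.
apply: eq_integral => t; rewrite inE/= in_itv/= => t01.
by rewrite /w clamp01_id.
Qed.
End one.

Lemma segcost_compare (f g : 'rV[R]_d -> R) (D e : R) (p q : 'rV[R]_d) :
  (forall x, 0 <= f x) -> (forall x y, f x <= f y + enorm (x - y)) ->
  (forall x, 0 <= g x) -> (forall x y, g x <= g y + enorm (x - y)) ->
  0 <= e -> (forall x, f x <= g x + e) -> (forall s, 0 <= s <= 1 -> f (seg p q s) <= D) ->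
  segcost f beta p q <= segcost g beta p q + beta * D `^ (beta - 1) * e * edist p q.
Proof.
move=> f0 fl g0 gl e0 fg fD.
rewrite [_ * edist p q]mulrC -mulrDr; apply: ler_wpM2l; first exact: enorm_ge0.
apply: prim_leM; [exact: seg_f_continuous..|] => s s01.
have b0 : 0 <= beta by exact: le_trans beta_ge1.
have c0 : 0 <= beta * D `^ (beta - 1) by rewrite mulr_ge0// powR_ge0.
have [fg'|/ltW gf] := leP (f (seg p q s)) (g (seg p q s)).
  apply: (@le_trans _ _ (g (seg p q s) `^ beta)).
    by apply: ge0_ler_powR => //; rewrite nnegrE.
  by rewrite lerDl mulr_ge0.
rewrite -lerBlDl; apply: (le_trans (powR_sub_le beta_ge1 (g0 _) gf (fD s s01))).
by apply: ler_wpM2l => //; rewrite lerBlDl.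
Qed.

(** The factor 2 N B + 1 of [shortcut_free_length], with c the constant of [segcost_ge]. *)
Definition length_bound (N : nat) : R :=
  2 * N%:R * (7 * 16 `^ beta / ((24 * N%:R)^-1 `^ beta / (12 * N%:R))) + 1.

(** The chain is made optimal for g, which bounds its length, and is then used as a competitor for
    f. Its vertices lie in K, being x, y or points of F, and so do its segments, where f <= D. *)
Lemma fermat_compare (f g : 'rV[R]_d -> R) (F K : set 'rV[R]_d) (D e : R) (N : nat)
    (x y : 'rV[R]_d) :
  (forall x, 0 <= f x) -> (forall x y, f x <= f y + enorm (x - y)) ->
  (forall x, 0 <= g x) -> (forall x y, g x <= g y + enorm (x - y)) ->
  0 <= e -> (forall x, f x <= g x + e) ->
  (0 < N)%N ->
  (forall (r : R) (xs : seq 'rV[R]_d), 0 < r ->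
    all (fun x => g x <= r) xs -> pairwise (fun x y => 6 * r <= edist x y) xs ->
    (size xs <= N)%N) ->
  closed F -> F `<=` K -> K x -> K y ->
  (forall p q s, K p -> K q -> 0 <= s <= 1 -> K (seg p q s)) ->
  (forall p q, K p -> K q -> enorm (p - q) <= D) -> 0 < D ->
  (forall p, K p -> f p <= D) -> (forall p, K p -> g p <= D) ->
  (fermat f F x y <= fermat g F x y + (length_bound N * beta * D `^ beta * e)%:E)%E.
Proof.
move=> f0 fl g0 gl e0 fg N0 cov cF FK Kx Ky Kseg KD D0 fD gD.
have beta0 : 0 <= beta by exact: le_trans beta_ge1.
have c0 : 0 < (24 * N%:R)^-1 `^ beta / (12 * N%:R) :> R.
  by rewrite divr_gt0 ?powR_gt0 ?invr_gt0 ?mulr_gt0 ?ltr0n.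
rewrite -leeBlDr//; apply: le_ereal_inf_tmp => _ [gamma adm <-]; rewrite leeBlDr//.
apply/lee_addgt0Pr => eta eta0.
have [n0 [q0 [n00 [q00 q0n] q0F q0c]]] := admissible_chain g0 gl cF adm eta0.
have [n [q [n_gt0 [qx qy] qF qc free]]] :=
  shortcut_free_exists (segcost g beta) n00 q0F.
rewrite {}q00 in qx; rewrite {}q0n in qy.
have qK i : (i <= n)%N -> K (q i).
  case: i => [_|i]; first by rewrite qx.
  by rewrite leq_eqVlt => /predU1P[->|i_n]; [rewrite qy|apply/FK/qF].
have len : \sum_(0 <= l < n) edist (q l) (q l.+1) <= length_bound N * D.
  apply: (shortcut_free_length (f := g) (beta := beta) _ _ _ _ g0 beta0 c0
    (segcost_le g0 gl beta_ge1) (segcost_ge g0 gl beta_ge1 N0 cov) cov free D0).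
  - by move=> u v; rewrite /edist enormB.
  - by move=> u v; exact: enorm_ge0.
  - by move=> u; rewrite /edist subrr enorm0.
  - by move=> u v z; rewrite /edist [leRHS]addrC; exact: (enorm_sub_triangle v z u).
  move=> l ln; split; first by apply: gD; exact/qK/ltnW.
  by apply: KD; apply: qK => //; exact: ltnW.
rewrite -qx -qy; apply: (le_trans (fermat_le_chain f0 fl n_gt0 qF)).
apply: (@le_trans _ _ (\sum_(0 <= l < n) segcost g beta (q l) (q l.+1) +
    length_bound N * beta * D `^ beta * e)%:E).
  rewrite lee_fin.
  apply: (@le_trans _ _ (\sum_(0 <= l < n) (segcost g beta (q l) (q l.+1) +
      beta * D `^ (beta - 1) * e * edist (q l) (q l.+1)))).
    apply: ler_sum_nat => l /andP[_ ln].
    apply: (segcost_compare f0 fl g0 gl e0 fg) => s s01.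
    by apply: fD; apply: Kseg => //; apply: qK => //; exact: ltnW.
  rewrite big_split/= lerD2l -mulr_sumr.
  apply: (@le_trans _ _ (beta * D `^ (beta - 1) * e * (length_bound N * D))).
    by apply: ler_wpM2l => //; rewrite !mulr_ge0// powR_ge0.
  rewrite -(mulr_powRB1 (ltW D0) (lt_le_trans ltr01 beta_ge1)).
  by rewrite le_eqVlt; apply/orP; left; apply/eqP; ring.
rewrite EFinD -addeA [X in (_ <= _ + X)%E]addeC addeA; apply: leeD2r.
by apply: le_trans q0c; rewrite lee_fin.
Qed.
End fermat.

(** * Convexity, diameter and the final estimate *)

Lemma convex_seg (R : realType) (d : nat) (K : set 'rV[R]_d) (p q : 'rV[R]_d) (s : R) :
  convex_set (K : set (convex_lmodType 'rV[R]_d)) ->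
  K p -> K q -> 0 <= s <= 1 -> K (seg p q s).
Proof.
move=> cK Kp Kq /andP[s0 s1].
have := cK q p (Itv01 s0 s1); rewrite !inE => /(_ Kq Kp).
suff -> : seg p q s = s *: q + (1 - s) *: p by [].
by rewrite /seg scalerBr scalerBl scale1r addrCA addrA.
Qed.

Lemma ediam_compact (R : realType) (d : nat) (K : set 'rV[R]_d) (x : 'rV[R]_d) :
  compact K -> K x ->
  exists D : R, [/\ ediam K = D%:E, 0 <= D &
    forall y z, K y -> K z -> enorm (y - z) <= D].
Proof.
move=> cK Kx; have [M [_ KM]] := compact_bounded cK.
have M1 := KM (`|M| + 1) (ltr_pwDr ltr01 (ler_norm M)).
have ub : (ediam K <= (d%:R * ((`|M| + 1) + (`|M| + 1)))%:E)%E.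
  apply: ge_ereal_sup => _ [y Ky [z Kz <-]]; rewrite lee_fin.
  apply: (le_trans (enorm_le_norm _)); apply: ler_wpM2l => //.
  by apply: (le_trans (ler_normB _ _)); apply: lerD; exact: M1.
have lb y z : K y -> K z -> ((enorm (y - z))%:E <= ediam K)%E.
  by move=> Ky Kz; apply: ereal_sup_ubound; exists y => //; exists z.
have ge0 : (0 <= ediam K)%E.
  by apply: le_trans (lb x x Kx Kx); rewrite lee_fin enorm_ge0.
have fin : ediam K \is a fin_num by rewrite ge0_fin_numE// (le_lt_trans ub)// ltry.
exists (fine (ediam K)); split; first by rewrite fineK.
  exact: fine_ge0.
by move=> y z Ky Kz; rewrite -lee_fin fineK//; exact: lb.
Qed.

Lemma fermat_dtmE (R : realType) (d : nat) (m p beta : R)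
    (mu : probability (borelRd R d) R) (K F : set 'rV[R]_d) (x y : 'rV[R]_d) :
  0 < m -> m <= 1 -> 1 <= p -> compact K -> mu K = 1%E ->
  fermat_dtm m p beta mu F x y = fermat beta (fdtm m p mu) F x y.
Proof.
move=> m0 m1 p1 cK muK; rewrite /fermat_dtm /fermat; congr ereal_inf.
congr image; apply/funext => gamma; rewrite /dtm_length /path_cost.
by apply: eq_integral => t _; rewrite (dtmE m0 m1 p1 cK muK) poweR_EFin EFinM.
Qed.

Lemma abse_sub_null (R : realType) (a b : \bar R) :
  a = 0%E -> b = 0%E -> (`|a - b| <= 0)%E.
Proof. by move=> -> ->; rewrite sube0 abse0. Qed.

Lemma abse_sub_le (R : realType) (a b : \bar R) (c : R) :
  a \is a fin_num -> b \is a fin_num ->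
  (a <= b + c%:E)%E -> (b <= a + c%:E)%E -> (`|a - b| <= c%:E)%E.
Proof.
move: a b => [a||] [b||] //= _ _.
by rewrite !lee_fin ler_norml => ab ba; apply/andP; split; lra.
Qed.

Theorem theorem8 (R : realType) (m beta : R) (m_gt0 : 0 < m) (m_le1 : m <= 1)
    (beta_ge1 : 1 <= beta) :
  exists2 C : R, 0 < C &
    forall (d : nat) (p : R) (K : set 'rV[R]_d)
      (mu nu : probability (borelRd R d) R) (F : set 'rV[R]_d),
    (0 < d)%N -> 1 <= p ->
    compact K -> convex_set (K : set (convex_lmodType 'rV[R]_d)) ->
    msupport mu `<=` K -> msupport nu `<=` K ->
    closed F -> F `<=` K ->
    (ereal_sup [set `|fermat_dtm m p beta mu F x y - fermat_dtm m p beta nu F x y|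
                | x in K & y in K]
     <= C%:E * ediam K `^ beta * wasserstein p mu nu)%E.
Proof.
have beta_gt0 : 0 < beta by exact: lt_le_trans beta_ge1.
(* The packing number depends on m alone, so the constant below depends on m and beta only; its
   factor 1/m comes from [fdtm_stable]. *)
pose N := (Num.truncn (2 / m)).+1.
have N_gt0 : (0 < N)%N by [].
have mN : 2 / m <= N%:R by rewrite ltW// truncnS_gt.
have lb_gt0 : 0 < length_bound beta N.
  by rewrite /length_bound; apply: ltr_wpDl => //; apply: mulr_ge0.
exists (length_bound beta N * beta / m).
  by rewrite divr_gt0// mulr_gt0.
move=> d p K mu nu F d_gt0 p_ge1 K_compact K_convex mu_supp nu_supp F_closed FK.
have K_closed := compact_closed_rV K_compact.
have muK := msupport_full K_closed mu_supp.
have nuK := msupport_full K_closed nu_supp.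
apply: ge_ereal_sup => _ [x Kx [y Ky <-]].
have [D [-> D_ge0 KD]] := ediam_compact K_compact Kx.
rewrite !(fermat_dtmE beta F x y m_gt0 m_le1 p_ge1 K_compact)//.
have f_ge0 := @fdtm_ge0 R d m p.
have f_lip (la : probability (borelRd R d) R) (laK : la K = 1%E) :=
  fdtm_lip m_gt0 m_le1 p_ge1 K_compact laK.
have f_le (la : probability (borelRd R d) R) (laK : la K = 1%E) z (Kz : K z) : fdtm m p la z <= D.
  apply: (fdtm_le m_gt0 p_ge1 K_compact laK) => u Ku; exact: KD.
have fin (la : probability (borelRd R d) R) (laK : la K = 1%E) :
    fermat beta (fdtm m p la) F x y \is a fin_num.
  rewrite ge0_fin_numE; last exact: fermat_ge0.
  apply: le_lt_trans (fermat_le_segcost d_gt0 beta_ge1 F (f_ge0 la) (f_lip la laK) x y) _.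
  exact: ltry.
(* If D = 0 then K is a single point and both distances vanish; [fermat_compare] and the division by
   D^beta require D > 0. *)
have [D0|D_neq0] := eqVneq D 0.
  have null (la : probability (borelRd R d) R) (laK : la K = 1%E) :
      fermat beta (fdtm m p la) F x y = 0%E.
    apply/le_anti/andP; split; last exact: fermat_ge0.
    apply: le_trans (fermat_le_segcost d_gt0 beta_ge1 F (f_ge0 la) (f_lip la laK) x y) _.
    rewrite lee_fin; apply: (le_trans (segcost_le (f_ge0 la) (f_lip la laK) beta_ge1 _ _)).
    suff -> : edist x y = 0 by rewrite mul0r.
    by apply/le_anti; rewrite enorm_ge0 andbT -D0; exact: KD.
  have beta_neq0 : beta != 0 by rewrite gt_eqF.
  apply: (le_trans (abse_sub_null (null mu muK) (null nu nuK))).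
  by rewrite D0 poweR_EFin (powR0 beta_neq0) mule0 mul0e.
have D_gt0 : 0 < D by rewrite lt_neqAle eq_sym D_neq0.
have A_gt0 : 0 < length_bound beta N * beta / m * D `^ beta.
  by rewrite mulr_gt0 ?powR_gt0// divr_gt0// mulr_gt0.
(* Dividing by the positive constant leaves the infimum over couplings alone on the right, so
   couplings can be treated one at a time. *)
rewrite poweR_EFin -EFinM -lee_pdivrMl//.
apply: le_ereal_inf_tmp => _ [pi pi_coupling <-].
have I0 : (0 <= \int[pi]_z (enorm ((z.1 : 'rV[R]_d) - (z.2 : 'rV[R]_d)) `^ p)%:E)%E.
  by apply: integral_ge0 => z _; rewrite lee_fin powR_ge0.
have p_gt0 : 0 < p by exact: lt_le_trans p_ge1.
have [Ifin|] := boolP ((\int[pi]_z (enorm ((z.1 : 'rV[R]_d) - (z.2 : 'rV[R]_d)) `^ p)%:E)%E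
    \is a fin_num); last first.
  rewrite ge0_fin_numE// -leNgt leye_eq => /eqP ->.
  by rewrite poweRyr ?leey// invr_eq0 gt_eqF.
have pi1 A : measurable A -> pi (fst @^-1` A) = mu A.
  by move=> mA; case: (pi_coupling A mA).
have pi2 A : measurable A -> pi (snd @^-1` A) = nu A.
  by move=> mA; case: (pi_coupling A mA).
(* The same coupling serves for both one-sided comparisons, with its two projections exchanged. *)
have swap : (\int[pi]_z (enorm ((z.2 : 'rV[R]_d) - (z.1 : 'rV[R]_d)) `^ p)%:E =
    \int[pi]_z (enorm ((z.1 : 'rV[R]_d) - (z.2 : 'rV[R]_d)) `^ p)%:E)%E.
  by apply: eq_integral => z _; rewrite enormB.
pose c := fine (\int[pi]_z (enorm ((z.1 : 'rV[R]_d) - (z.2 : 'rV[R]_d)) `^ p)%:E)%E `^ p^-1.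
have munu z : fdtm m p mu z <= fdtm m p nu z + m^-1 * c.
  exact: (fdtm_stable m_gt0 m_le1 p_ge1 measurable_fst measurable_snd
    K_compact muK nuK pi1 pi2 z Ifin).
have numu z : fdtm m p nu z <= fdtm m p mu z + m^-1 * c.
  have := fdtm_stable m_gt0 m_le1 p_ge1 measurable_snd measurable_fst
    K_compact nuK muK pi2 pi1 z.
  by rewrite swap; apply.
have e_ge0 : 0 <= m^-1 * c.
  by apply: mulr_ge0; [rewrite invr_ge0 ltW|exact: powR_ge0].
have Kseg u v s : K u -> K v -> 0 <= s <= 1 -> K (seg u v s) by exact: convex_seg.
have cov (la : probability (borelRd R d) R) (laK : la K = 1%E) r xs :=
  @fdtm_covering R d m p m_gt0 m_le1 p_ge1 la K K_compact laK N r xs mN.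
have H1 := fermat_compare d_gt0 beta_ge1 (f_ge0 mu) (f_lip mu muK) (f_ge0 nu) (f_lip nu nuK)
  e_ge0 munu N_gt0 (cov nu nuK) F_closed FK Kx Ky Kseg KD D_gt0 (f_le mu muK) (f_le nu nuK).
have H2 := fermat_compare d_gt0 beta_ge1 (f_ge0 nu) (f_lip nu nuK) (f_ge0 mu) (f_lip mu muK)
  e_ge0 numu N_gt0 (cov mu muK) F_closed FK Kx Ky Kseg KD D_gt0 (f_le nu nuK) (f_le mu muK).
have IE : ((\int[pi]_z (enorm ((z.1 : 'rV[R]_d) - (z.2 : 'rV[R]_d)) `^ p)%:E) `^ p^-1)%E = c%:E.
  by rewrite /c -poweR_EFin (fineK Ifin).
rewrite (lee_pdivrMl _ _ A_gt0) IE -EFinM.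
have -> : length_bound beta N * beta / m * D `^ beta * c =
  length_bound beta N * beta * D `^ beta * (m^-1 * c) by ring.
exact: abse_sub_le (fin mu muK) (fin nu nuK) H1 H2.
Qed.
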